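(* Let $s>\frac12$ and let $u\in C^\infty(\mathbb{R},H^s_+(\mathbb{T}))$ be a solution of $$ i\partial_t u=2J\Pi(|u|^2)+\overline{J}u^2,\qquad J:=(u^2\vert u).$$ Then the eigenvalues $\{\sigma_k^2\}_{k\ge1}$ (repeated with multiplicity) of $K_{u(t)}^2$ are conserved, i.e. do not depend on $t\in\mathbb{R}$.
   Context: $\mathbb{T}$ is the one-dimensional torus; $(f\vert g):=\frac1{2\pi}\int_0^{2\pi}f(e^{ix})\overline{g(e^{ix})}\,dx$. $L^2_+(\mathbb{T})=\{u\in L^2(\mathbb{T}) : \hat u(k)=0\ \forall k<0\}$, $\Pi:L^2(\mathbb{T})\to L^2_+(\mathbb{T})$ is the orthogonal projection, and $H^s_+:=H^s\cap L^2_+$. For $u\in H^{1/2}_+$, the shifted Hankel operator $K_u:L^2_+\to L^2_+$ is the $\mathbb{C}$-antilinear operator $K_u(h)=\Pi(e^{-ix}u\bar h)$. Its square $K_u^2$ is a $\mathbb{C}$-linear positive self-adjoint trace class (hence compact) operator on $L^2_+$. *)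

(* Defs.v *)
From mathcomp Require Import all_boot all_order all_algebra.
From mathcomp Require Import complex.
From mathcomp Require Import all_classical all_reals all_analysis.

Set Implicit Arguments.
Unset Strict Implicit.
Unset Printing Implicit Defensive.

Import Order.TTheory GRing.Theory Num.Theory.
Import numFieldNormedType.Exports.

Local Open Scope classical_set_scope.
Local Open Scope ring_scope.

(* A function f on the torus is represented by x |-> f(e^{ix}), a function of
   the angle; only its values on [0, 2 pi] matter, and elements of L^2(T) are
   compared with [eqT], that is, almost everywhere. *)
Definition Tfun (R : realType) : Type := R -> R[i].

Section Torus.
Context {R : realType}.
Local Notation mu := (@lebesgue_measure R).
Implicit Types (f g h u v : Tfun R) (s t : R).

Definition angles : set R := `[0, 2 * pi]%classic.

Definition eqT f g : Prop := ae_eq mu angles f g.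

Definition in_L2 f : Prop :=
  [/\ measurable_fun angles (fun x => complex.Re (f x)),
      measurable_fun angles (fun x => complex.Im (f x))
    & (\int[mu]_(x in angles) ((Normc.normc (f x)) ^+ 2)%:E < +oo)%E].

Definition integralT f : R[i] :=
  Complex (Rintegral mu angles (fun x => complex.Re (f x)))
          (Rintegral mu angles (fun x => complex.Im (f x))).

Definition inner f g : R[i] :=
  real_complex R (2 * pi)^-1 * integralT (fun x => f x * conjc (g x)).

(* x |-> e^{ikx} *)
Definition expi (k : int) : Tfun R :=
  fun x => Complex (cos (k%:~R * x)) (sin (k%:~R * x)).

Definition fourier f (k : int) : R[i] := inner f (expi k).

Definition in_L2plus f : Prop :=
  in_L2 f /\ forall k : int, k < 0 -> fourier f k = 0.

Definition is_proj f g : Prop :=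
  in_L2plus g /\
  forall h, in_L2plus h -> inner (fun x => f x - g x) h = 0.

(* The orthogonal projection of L^2 onto L^2_+, through a chosen
   representative of the a.e. class; arbitrary outside L^2. *)
Definition Pi f : Tfun R :=
  xget ((fun=> 0) : {classic (Tfun R)}) [set g | is_proj f g].

Definition Hs_norm s f : \bar R :=
  sqrte (\esum_(k in [set: int])
    ((1 + k%:~R ^+ 2) `^ s * (Normc.normc (fourier f k)) ^+ 2)%:E)%E.

Definition in_Hsplus s f : Prop := in_L2plus f /\ (Hs_norm s f < +oo)%E.

Definition Hs_is_derive s (u : R -> Tfun R) t v : Prop :=
  in_Hsplus s v /\
  Hs_norm s (fun x => real_complex R h^-1 * (u (t + h) x - u t x) - v x)
    @[h --> 0^'] --> 0%E.

(* D n is the n-th time derivative of u. *)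
Definition Hs_smooth s (u : R -> Tfun R) : Prop :=
  exists D : nat -> R -> Tfun R,
    [/\ D 0%N = u,
        forall t, in_Hsplus s (u t)
      & forall n t, Hs_is_derive s (D n) t (D n.+1 t)].

Definition Jfun u : R[i] := inner (fun x => u x ^+ 2) u.

Definition szego_rhs u : Tfun R :=
  fun x => 2 * Jfun u * Pi (fun y => u y * conjc (u y)) x
           + conjc (Jfun u) * u x ^+ 2.

Definition szego_solution s (u : R -> Tfun R) : Prop :=
  forall t, exists v, Hs_is_derive s u t v /\
    eqT (fun x => Complex 0 1 * v x) (szego_rhs (u t)).

(* The product below is in L^2 as soon as u is bounded, in particular for u in
   H^s with s > 1/2. *)
Definition Kop u h : Tfun R :=
  Pi (fun x => expi (-1) x * u x * conjc (h x)).

Definition Ksq u h : Tfun R := Kop u (Kop u h).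

Definition eigenspace_L2plus (A : Tfun R -> Tfun R) (lambda : R[i]) :
    set (Tfun R) :=
  [set h | in_L2plus h /\ eqT (A h) (fun x => lambda * h x)].

Definition independentT (n : nat) (h : 'I_n -> Tfun R) : Prop :=
  forall c : 'I_n -> R[i],
    eqT (fun x => \sum_(i < n) c i * h i x) (fun=> 0) -> forall i, c i = 0.

(* Dimension of the eigenspace, in [0, +oo]; it is 0 exactly when lambda is
   not an eigenvalue. The function lambda |-> eigen_mult A lambda is the
   multiset of the eigenvalues of A repeated with multiplicity. *)
Definition eigen_mult (A : Tfun R -> Tfun R) (lambda : R[i]) : \bar R :=
  ereal_sup [set (n%:R)%:E | n in [set n : nat |
    exists h : 'I_n -> Tfun R,
      (forall i, eigenspace_L2plus A lambda (h i)) /\ independentT h]].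

End Torus.

(* Main.v *)
From HB Require Import structures.
Require Import Defs.
From mathcomp Require Import all_boot all_order all_algebra.
From mathcomp Require Import complex.
From mathcomp Require Import all_classical all_reals all_analysis.
From mathcomp Require Import measurable_realfun.
From mathcomp Require Import zify ring lra.

(** The equation has a Lax pair. Let P be the orthogonal projector of L^2 onto
    the Hardy space L^2_+, and K_u h = P (e^{-ix} u conj h). For bounded u in the
    Hardy space, [hankel_square], [hankel_modulus_left] and
    [hankel_modulus_right] read
    K_{u^2} = T_u K_u + K_u T_{conj u} and
    K_{|u|^2} = T_{conj u} K_u = K_u T_u, with T_b h = P (b h). Since K_u is
    antilinear, the right-hand side of the equation becomes an anticommutator
    with the self-adjoint Toeplitz operator A of symbol
    J conj(u) + conj(J) u ([lax_pair]): along a solution, i K' = A K + K A, that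
    is K' = C K - K C with C = - i A skew-adjoint ([hankel_lax]). Hence
    K_{u(t2)} U = U K_{u(t1)}, where U is the evolution operator of h' = C(t) h,
    and U maps the eigenspaces of the first squared operator injectively into
    those of the second, for the same eigenvalue, zero included
    ([hankel_conjugation], [eigen_mult_le]). Exchanging the two times gives
    equality of the multiplicities.

    The evolution operator is the limit of Euler products
    (1 + d C(t + j d)) over dyadic subdivisions ([evolution]). Bounds on the
    generator and its Lipschitz constant make these products converge
    geometrically. Skewness makes each factor expand the norm, so the limit is
    injective. A family G(t) such that G(t + d) (1 + d C(t)) and
    (1 + d C(t)) G(t) differ by O(d^2) is intertwined by the limit; this is
    applied to the Hankel operators, to the scalars, and to P.

    Three analytic facts support this. The space of square-integrable classes is
    complete ([L2_complete]), so that orthogonal projections exist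
    ([orthogonal_projection]) and Pi is what it should be ([Pi_proj]). A
    square-integrable function is determined by its Fourier coefficients
    ([fourier_unique]); the operator identities reduce to this through
    [flip_decomposition], which describes the complement of the Hardy space.
    For s > 1/2 the Fourier coefficients of a function of H^s are summable
    ([sobolev]), so that the curve u and its time derivatives have continuous
    representatives, and the Sobolev derivatives yield pointwise estimates,
    uniform in the angle ([curve_lip], [curve_taylor]). *)

Set Implicit Arguments.
Unset Strict Implicit.
Unset Printing Implicit Defensive.

Import Order.TTheory GRing.Theory Num.Theory.
Import numFieldNormedType.Exports.
Import Normc.

Local Open Scope classical_set_scope.
Local Open Scope ring_scope.

(** * Complex numbers and complex-valued integrals *)

Section ComplexNumbers.
Context {R : realType}.
Implicit Types z w : R[i].
Local Notation Re := (@complex.Re R).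
Local Notation Im := (@complex.Im R).

Lemma normcE z : normc z = Num.sqrt (Re z ^+ 2 + Im z ^+ 2).
Proof. by case: z. Qed.

Lemma normc_ge0 z : 0 <= normc z.
Proof. by rewrite normcE sqrtr_ge0. Qed.

Lemma sqr_normcE z : normc z ^+ 2 = Re z ^+ 2 + Im z ^+ 2.
Proof. by rewrite normcE sqr_sqrtr// addr_ge0// sqr_ge0. Qed.

Lemma normc_conj z : normc (conjc z) = normc z.
Proof. by case: z => a b; rewrite !normcE /= sqrrN. Qed.

Lemma normc_Re_le z : `|Re z| <= normc z.
Proof. by rewrite normcE -sqrtr_sqr ler_sqrt ?addr_ge0 ?sqr_ge0// lerDl sqr_ge0. Qed.

Lemma normc_Im_le z : `|Im z| <= normc z.
Proof. by rewrite normcE -sqrtr_sqr ler_sqrt ?addr_ge0 ?sqr_ge0// lerDr sqr_ge0. Qed.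

Lemma normc_le_ReIm z : normc z <= `|Re z| + `|Im z|.
Proof.
rewrite -(@ler_pXn2r _ 2)// ?nnegrE ?normc_ge0 ?addr_ge0//.
rewrite sqr_normcE sqrrD !real_normK ?num_real//.
by rewrite -addrA lerD2l lerDr mulrn_wge0// mulr_ge0.
Qed.

Lemma normc_real (r : R) : normc (real_complex R r) = `|r|.
Proof. by rewrite normcE /= expr0n /= addr0 sqrtr_sqr. Qed.

Lemma normc_subC z w : normc (z - w) = normc (w - z).
Proof. by rewrite -opprB normcN. Qed.

Lemma normc_eq0 z : normc z = 0 -> z = 0.
Proof. exact: eq0_normc. Qed.

Lemma ReM z w : Re (z * w) = Re z * Re w - Im z * Im w.
Proof. by case: z w => a b [c d]. Qed.
Lemma ImM z w : Im (z * w) = Re z * Im w + Im z * Re w.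
Proof. by case: z w => a b [c d]. Qed.
Lemma ReD z w : Re (z + w) = Re z + Re w.
Proof. by case: z w => a b [c d]. Qed.
Lemma ImD z w : Im (z + w) = Im z + Im w.
Proof. by case: z w => a b [c d]. Qed.
Lemma ReN z : Re (- z) = - Re z.
Proof. by case: z. Qed.
Lemma ImN z : Im (- z) = - Im z.
Proof. by case: z. Qed.
Lemma ReJ z : Re (conjc z) = Re z.
Proof. by case: z. Qed.
Lemma ImJ z : Im (conjc z) = - Im z.
Proof. by case: z. Qed.

Lemma complexP z w : Re z = Re w -> Im z = Im w -> z = w.
Proof. by case: z w => a b [c d] /= -> ->. Qed.

Lemma Re_realM (r : R) z : Re (real_complex R r * z) = r * Re z.
Proof. by rewrite ReM /= mul0r subr0. Qed.
Lemma conjcM z w : conjc (z * w) = conjc z * conjc w.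
Proof. exact: rmorphM. Qed.
Lemma conjcD z w : conjc (z + w) = conjc z + conjc w.
Proof. exact: rmorphD. Qed.
Lemma conjcN z : conjc (- z) = - conjc z.
Proof. exact: rmorphN. Qed.

Lemma mulJ_normc z : z * conjc z = real_complex R (normc z ^+ 2).
Proof.
by apply: complexP; rewrite ?ReM ?ImM ?ReJ ?ImJ /= ?sqr_normcE; ring.
Qed.

End ComplexNumbers.

Section ComplexIntegral.
Context {R : realType}.
Local Notation mu := (@lebesgue_measure R).
Local Notation Re := (@complex.Re R).
Local Notation Im := (@complex.Im R).
Local Notation A := (@angles R).
Implicit Types (f g h : Tfun R).

Lemma measurable_angles : @measurable _ (measurableTypeR R) A.
Proof. exact: measurable_itv. Qed.
Hint Resolve measurable_angles : core.

Lemma pi2_gt0 : 0 < 2 * pi :> R.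
Proof. by rewrite mulr_gt0// pi_gt0. Qed.

Lemma mu_angles : mu A = (2 * pi)%:E.
Proof.
by rewrite /angles lebesgue_measure_itv /= lte_fin pi2_gt0 -EFinD subr0.
Qed.

Definition cmeas f :=
  measurable_fun A (fun x => Re (f x)) /\ measurable_fun A (fun x => Im (f x)).

Definition cint f :=
  mu.-integrable A (EFin \o (fun x => Re (f x))) /\
  mu.-integrable A (EFin \o (fun x => Im (f x))).

Lemma eq_cmeas f g : (forall x, f x = g x) -> cmeas f -> cmeas g.
Proof. by move=> /funext ->. Qed.

Lemma cmeas_cst (z : R[i]) : cmeas (fun=> z).
Proof. by split; exact: measurable_cst. Qed.

Lemma cmeasD f g : cmeas f -> cmeas g -> cmeas (fun x => f x + g x).
Proof.
move=> [fr fi] [gr gi]; split.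
- by under eq_fun do rewrite ReD; exact: measurable_funD.
- by under eq_fun do rewrite ImD; exact: measurable_funD.
Qed.

Lemma cmeasM f g : cmeas f -> cmeas g -> cmeas (fun x => f x * g x).
Proof.
move=> [fr fi] [gr gi]; split.
- under eq_fun do rewrite ReM; apply: measurable_funB; exact: measurable_funM.
- under eq_fun do rewrite ImM; apply: measurable_funD; exact: measurable_funM.
Qed.

Lemma cmeasZ (z : R[i]) f : cmeas f -> cmeas (fun x => z * f x).
Proof. by move=> mf; apply: cmeasM => //; exact: cmeas_cst. Qed.

Lemma cmeasN f : cmeas f -> cmeas (fun x => - f x).
Proof.
by move=> /(cmeasZ (-1)); apply: eq_cmeas => x; rewrite mulN1r.
Qed.

Lemma cmeasB f g : cmeas f -> cmeas g -> cmeas (fun x => f x - g x).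
Proof. by move=> mf mg; apply: cmeasD => //; exact: cmeasN. Qed.

Lemma cmeasJ f : cmeas f -> cmeas (fun x => conjc (f x)).
Proof.
move=> [fr fi]; split.
- by under eq_fun do rewrite ReJ.
- by under eq_fun do rewrite ImJ; exact: measurableT_comp.
Qed.

Lemma cmeas_normc2 f : cmeas f -> measurable_fun A (fun x => normc (f x) ^+ 2).
Proof.
move=> [fr fi]; under eq_fun do rewrite sqr_normcE.
by apply: measurable_funD; exact: measurable_funX.
Qed.

Lemma cmeas_normc f : cmeas f -> measurable_fun A (fun x => normc (f x)).
Proof.
move=> /cmeas_normc2 mf.
rewrite (_ : (fun _ => _) = (fun x => Num.sqrt (normc (f x) ^+ 2))).
  have ms : measurable_fun setT (@Num.sqrt R).
    by apply: continuous_measurable_fun; exact: sqrt_continuous.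
  exact: (measurableT_comp ms mf).
by apply/funext => x; rewrite sqrtr_sqr ger0_norm ?normc_ge0.
Qed.

Lemma integrable_le (f g : R -> R) : measurable_fun A f ->
  mu.-integrable A (EFin \o g) -> (forall x, A x -> `|f x| <= g x) ->
  mu.-integrable A (EFin \o f).
Proof.
move=> mf ig fg; apply: (le_integrable _ _ _ ig) => //.
- exact/measurable_EFinP.
- move=> x Ax /=; rewrite lee_fin (le_trans (fg _ Ax))//.
  exact: ler_norm.
Qed.

Lemma integrable_cst (r : R) : mu.-integrable A (EFin \o (fun=> r)).
Proof.
apply: measurable_bounded_integrable => //.
- exact: (eq_ind_r (fun z => (z < +oo)%E) (ltry (2 * pi)) mu_angles).
- exists `|r|; split; first exact: num_real.
  by move=> M rM x _; exact: ltW.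
Qed.

Lemma integrable_scale (r : R) (f : R -> R) :
  mu.-integrable A (EFin \o f) -> mu.-integrable A (EFin \o (fun x => r * f x)).
Proof. by move=> fi; apply: (integrableZl _ r fi). Qed.

Lemma cint_le f (g : R -> R) : cmeas f -> mu.-integrable A (EFin \o g) ->
  (forall x, A x -> normc (f x) <= g x) -> cint f.
Proof.
move=> [fr fi] ig fg; split.
- by apply: integrable_le ig _ => // x Ax; exact: le_trans (normc_Re_le _) (fg _ Ax).
- by apply: integrable_le ig _ => // x Ax; exact: le_trans (normc_Im_le _) (fg _ Ax).
Qed.

Lemma cint_meas f : cint f -> cmeas f.
Proof.
move=> [fr fi]; split; apply/measurable_EFinP.
- exact: (measurable_int mu fr).
- exact: (measurable_int mu fi).
Qed.

Lemma cint_normc f : cint f -> mu.-integrable A (EFin \o (fun x => normc (f x))).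
Proof.
move=> cf; have [fr fi] := cf.
apply: (@integrable_le _ (fun x => `|Re (f x)| + `|Im (f x)|)).
- exact: (cmeas_normc (cint_meas cf)).
- exact: (integrableD _ (integrable_norm fr) (integrable_norm fi)).
- by move=> x _; rewrite ger0_norm ?normc_ge0// normc_le_ReIm.
Qed.

Lemma integralTD f g : cint f -> cint g ->
  integralT (fun x => f x + g x) = integralT f + integralT g.
Proof.
move=> [fr fi] [gr gi]; rewrite /integralT; congr Complex.
- by under eq_Rintegral do rewrite ReD; rewrite RintegralD.
- by under eq_Rintegral do rewrite ImD; rewrite RintegralD.
Qed.

Lemma integralTZ (z : R[i]) f : cint f ->
  integralT (fun x => z * f x) = z * integralT f.
Proof.
move=> [fr fi]; apply: complexP; rewrite ?ReM ?ImM /=.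
- under eq_Rintegral do rewrite ReM.
  by rewrite RintegralB ?RintegralZl//; exact: integrable_scale.
- under eq_Rintegral do rewrite ImM.
  by rewrite RintegralD ?RintegralZl//; exact: integrable_scale.
Qed.

Lemma integralTJ f : cint f ->
  integralT (fun x => conjc (f x)) = conjc (integralT f).
Proof.
move=> [fr fi]; apply: complexP; rewrite ?ReJ ?ImJ /=.
- by under eq_Rintegral do rewrite ReJ.
- under eq_Rintegral do rewrite ImJ -mulN1r.
  by rewrite RintegralZl// mulN1r.
Qed.

Lemma Rintegral_ae (f g : R -> R) :
  measurable_fun A f -> measurable_fun A g -> ae_eq mu A f g ->
  Rintegral mu A f = Rintegral mu A g.
Proof.
move=> mf mg fg; rewrite /Rintegral; congr fine.
apply: ae_eq_integral => //; try exact/measurable_EFinP.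
by apply: filterS fg => x /= h /h ->.
Qed.

Lemma integralT_ae f g : cmeas f -> cmeas g -> eqT f g ->
  integralT f = integralT g.
Proof.
move=> [fr fi] [gr gi] fg; rewrite /integralT; congr Complex;
  apply: Rintegral_ae => //; apply: filterS fg => x /= h /h -> //.
Qed.

(** * Square-integrable functions *)

(** The bound holds at every angle, not almost everywhere: multiplication by such
    a function then preserves square integrability whatever representative it
    acts on, and pointwise bounds pass directly to operator norms. *)
Definition bddT f := cmeas f /\ exists M, forall x, normc (f x) <= M.

Lemma in_L2P f : in_L2 f <->
  cmeas f /\ mu.-integrable A (EFin \o (fun x => normc (f x) ^+ 2)).
Proof.
split=> [[fr fi foo]|[[fr fi] foo]].
- split=> //; apply/integrableP; split.
    by apply/measurable_EFinP; exact: cmeas_normc2.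
  rewrite (le_lt_trans _ foo)// le_eqVlt; apply/orP; left; apply/eqP.
  by apply: eq_integral => x _ /=; rewrite ger0_norm ?sqr_ge0.
- by split=> //; exact: integrable_lty foo.
Qed.

Lemma in_L2_meas f : in_L2 f -> cmeas f.
Proof. by move=> /in_L2P[]. Qed.

Lemma in_L2_le f (g : R -> R) : cmeas f -> mu.-integrable A (EFin \o g) ->
  (forall x, A x -> normc (f x) ^+ 2 <= g x) -> in_L2 f.
Proof.
move=> mf ig fg; apply/in_L2P; split => //; apply: integrable_le ig _ => //.
- exact: cmeas_normc2.
- by move=> x Ax; rewrite ger0_norm ?sqr_ge0 ?fg.
Qed.

Lemma in_L2D f g : in_L2 f -> in_L2 g -> in_L2 (fun x => f x + g x).
Proof.
move=> /in_L2P[mf f2] /in_L2P[mg g2].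
apply: (@in_L2_le _ (fun x => 2 * (normc (f x) ^+ 2 + normc (g x) ^+ 2))).
- exact: cmeasD.
- exact: (integrable_scale 2 (integrableD _ f2 g2)).
- move=> x _; have := sqr_ge0 (normc (f x) - normc (g x)).
  have : normc (f x + g x) ^+ 2 <= (normc (f x) + normc (g x)) ^+ 2.
    by rewrite ler_pXn2r ?nnegrE ?addr_ge0 ?normc_ge0// le_normcD.
  nra.
Qed.

Lemma in_L2_bddM f g : bddT f -> in_L2 g -> in_L2 (fun x => f x * g x).
Proof.
move=> [mf [M fM]] /in_L2P[mg g2].
apply: (@in_L2_le _ (fun x => M ^+ 2 * normc (g x) ^+ 2)).
- exact: cmeasM.
- exact: (integrable_scale _ g2).
- move=> x _; rewrite normcM exprMn ler_wpM2r ?sqr_ge0//.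
  by rewrite ler_pXn2r ?nnegrE ?normc_ge0// (le_trans (normc_ge0 _) (fM x)).
Qed.

Lemma bddT_cst (z : R[i]) : bddT (fun=> z).
Proof. by split; [exact: cmeas_cst|exists (normc z)]. Qed.

Lemma in_L2Z (z : R[i]) f : in_L2 f -> in_L2 (fun x => z * f x).
Proof. exact/in_L2_bddM/bddT_cst. Qed.

Lemma in_L2B f g : in_L2 f -> in_L2 g -> in_L2 (fun x => f x - g x).
Proof.
move=> f2 /(in_L2Z (-1)) g2; have := in_L2D f2 g2.
by under eq_fun do rewrite mulN1r.
Qed.

Lemma in_L2J f : in_L2 f -> in_L2 (fun x => conjc (f x)).
Proof.
move=> /in_L2P[mf f2]; apply: in_L2_le f2 _; first exact: cmeasJ.
by move=> x _; rewrite normc_conj.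
Qed.

Lemma bddT_L2 f : bddT f -> in_L2 f.
Proof.
move=> [mf [M fM]]; apply: (@in_L2_le _ (fun=> M ^+ 2)) => //.
- exact: integrable_cst.
- move=> x _; rewrite ler_pXn2r ?nnegrE ?normc_ge0//.
  exact: le_trans (normc_ge0 _) (fM x).
Qed.

Lemma in_L2_0 : in_L2 (fun=> 0 : R[i]).
Proof. exact/bddT_L2/bddT_cst. Qed.

Lemma bddTM f g : bddT f -> bddT g -> bddT (fun x => f x * g x).
Proof.
move=> [mf [M fM]] [mg [N gN]]; split; first exact: cmeasM.
by exists (M * N) => x; rewrite normcM ler_pM ?normc_ge0.
Qed.

Lemma bddTD f g : bddT f -> bddT g -> bddT (fun x => f x + g x).
Proof.
move=> [mf [M fM]] [mg [N gN]]; split; first exact: cmeasD.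
by exists (M + N) => x; rewrite (le_trans (le_normcD _ _))// lerD.
Qed.

Lemma bddTJ f : bddT f -> bddT (fun x => conjc (f x)).
Proof.
move=> [mf [M fM]]; split; first exact: cmeasJ.
by exists M => x; rewrite normc_conj.
Qed.

Lemma bddTZ (z : R[i]) f : bddT f -> bddT (fun x => z * f x).
Proof. exact/bddTM/bddT_cst. Qed.

Lemma bddTB f g : bddT f -> bddT g -> bddT (fun x => f x - g x).
Proof.
move=> bf /(bddTZ (-1)) bg; have := bddTD bf bg.
by under eq_fun do rewrite mulN1r.
Qed.

Lemma cintM f g : in_L2 f -> in_L2 g -> cint (fun x => f x * g x).
Proof.
move=> /in_L2P[mf f2] /in_L2P[mg g2].
apply: (@cint_le _ (fun x => normc (f x) ^+ 2 + normc (g x) ^+ 2)).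
- exact: cmeasM.
- exact: (integrableD _ f2 g2).
- move=> x _; rewrite normcM; have := sqr_ge0 (normc (f x) - normc (g x)).
  by have := normc_ge0 (f x); have := normc_ge0 (g x); nra.
Qed.

Lemma cint_L2 f : in_L2 f -> cint f.
Proof.
move=> f2; have := cintM (bddT_L2 (bddT_cst 1)) f2.
by under eq_fun do rewrite mul1r.
Qed.

(** * The inner product *)

Lemma cint_inner f g : in_L2 f -> in_L2 g -> cint (fun x => f x * conjc (g x)).
Proof. by move=> f2 g2; exact/cintM/in_L2J. Qed.

Lemma innerDl f g h : in_L2 f -> in_L2 g -> in_L2 h ->
  inner (fun x => f x + g x) h = inner f h + inner g h.
Proof.
move=> f2 g2 h2; rewrite /inner -mulrDr -integralTD; try exact: cint_inner.
by under eq_fun do rewrite mulrDl.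
Qed.

Lemma innerZl (z : R[i]) f h : in_L2 f -> in_L2 h ->
  inner (fun x => z * f x) h = z * inner f h.
Proof.
move=> f2 h2; rewrite /inner [RHS]mulrCA -(integralTZ z); last exact: cint_inner.
by under eq_fun do rewrite -mulrA.
Qed.

Lemma innerJ f g : in_L2 f -> in_L2 g -> inner g f = conjc (inner f g).
Proof.
move=> f2 g2; rewrite /inner conjcM conjc_real -integralTJ; last exact: cint_inner.
by under [in RHS]eq_fun do rewrite conjcM conjcK mulrC.
Qed.

Lemma innerBl f g h : in_L2 f -> in_L2 g -> in_L2 h ->
  inner (fun x => f x - g x) h = inner f h - inner g h.
Proof.
move=> f2 g2 h2; rewrite -mulN1r -innerZl// -innerDl//; last exact: in_L2Z.
by under [in RHS]eq_fun do rewrite mulN1r.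
Qed.

Lemma inner_ae f1 g1 f2 g2 : in_L2 f1 -> in_L2 f2 -> in_L2 g1 -> in_L2 g2 ->
  eqT f1 f2 -> eqT g1 g2 -> inner f1 g1 = inner f2 g2.
Proof.
move=> hf1 hf2 hg1 hg2 ef eg; rewrite /inner; congr (_ * _).
apply: integralT_ae.
- by apply: cmeasM; [|apply: cmeasJ]; exact: in_L2_meas.
- by apply: cmeasM; [|apply: cmeasJ]; exact: in_L2_meas.
- by apply: filterS2 ef eg => x e1 e2 Ax; rewrite e1// e2.
Qed.

Lemma inner_selfE f : in_L2 f ->
  inner f f = real_complex R ((2 * pi)^-1 *
     Rintegral mu A (fun x => normc (f x) ^+ 2)).
Proof.
move=> f2; rewrite rmorphM /inner; congr (_ * _).
under eq_fun do rewrite mulJ_normc.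
rewrite /integralT /=; apply: complexP => //=.
by rewrite Rintegral_cst// mul0r.
Qed.

(** A nonnegative function with zero integral vanishes almost everywhere. *)
Lemma inner_self_eq0 f : in_L2 f -> inner f f = 0 -> eqT f (fun=> 0).
Proof.
move=> f2; rewrite inner_selfE// => -[] /eqP.
rewrite mulf_eq0 invr_eq0 (gt_eqF pi2_gt0)/= => /eqP I0.
have [mf fi] := (in_L2P f).1 f2.
have mN : measurable_fun A (EFin \o (fun x => normc (f x) ^+ 2)).
  exact: measurable_int fi.
have /(ae_eq_integral_abs _ measurable_angles mN) :
    (\int[mu]_(x in A) `|(EFin \o (fun x => (normc (f x) ^+ 2)%R)) x| = 0)%E.
  rewrite -[LHS]fineK; last exact: (integrable_fin_num measurable_angles (integrable_abse fi)).
  congr EFin; rewrite -[RHS]I0; congr fine.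
  by apply: eq_integral => x _; rewrite gee0_abs// lee_fin sqr_ge0.
apply: filterS => x /= h /h [] /eqP; rewrite sqrf_eq0 => /eqP.
exact: normc_eq0.
Qed.

End ComplexIntegral.

(** Several almost-everywhere facts are turned into hypotheses at one angle by
    the tactic filter_upwards below. *)
Lemma ae_app d (T : measurableType d) (R : realType)
    (mu : {measure set T -> \bar R}) (P Q : T -> Prop) :
  {ae mu, forall x, P x} -> {ae mu, forall x, P x -> Q x} ->
  {ae mu, forall x, Q x}.
Proof. by move=> hP hPQ; apply: filterS2 hP hPQ => x p; apply. Qed.
Ltac ae_use H := apply: (ae_app H).
Tactic Notation "filter_upwards" "[" constr(a) "]" :=
  ae_use a; apply: aeW.
Tactic Notation "filter_upwards" "[" constr(a) "," constr(b) "]" :=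
  ae_use b; ae_use a; apply: aeW.
Tactic Notation "filter_upwards" "[" constr(a) "," constr(b) ","
    constr(c) "]" :=
  ae_use c; ae_use b; ae_use a; apply: aeW.
Tactic Notation "filter_upwards" "[" constr(a) "," constr(b) ","
    constr(c) "," constr(d) "]" :=
  ae_use d; ae_use c; ae_use b; ae_use a; apply: aeW.
Tactic Notation "filter_upwards" "[" constr(a) "," constr(b) ","
    constr(c) "," constr(d) "," constr(e) "]" :=
  ae_use e; ae_use d; ae_use c; ae_use b; ae_use a; apply: aeW.

(** * The Hilbert space of square-integrable classes *)

Section L2Space.
Context {R : realType}.
Local Notation mu := (@lebesgue_measure R).
Local Notation A := (@angles R).
Implicit Types (f g h : Tfun R).

Lemma eqT_refl f : eqT f f. Proof. exact: aeW. Qed.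

Lemma eqT_sym f g : eqT f g -> eqT g f.
Proof. by apply: filterS => x h /h ->. Qed.

Lemma eqT_trans f g h : eqT f g -> eqT g h -> eqT f h.
Proof. by move=> fg gh; apply: filterS2 fg gh => x h1 h2 Ax; rewrite h1// h2. Qed.

(** One representative per class of almost everywhere equal functions: it depends
    on f only through its class. *)
Definition canon f : Tfun R :=
  xget ((fun=> 0) : {classic (Tfun R)}) [set g | in_L2 g /\ eqT f g].

Lemma canonP f : in_L2 f -> in_L2 (canon f) /\ eqT f (canon f).
Proof.
move=> f2; rewrite /canon.
have /xgetPex : exists g : {classic (Tfun R)}, in_L2 g /\ eqT f g.
  by exists f; split => //; exact: eqT_refl.
by apply.
Qed.

Lemma canon_L2 f : in_L2 (canon f).
Proof. by rewrite /canon; case: xgetP => [g _ []//|_]; exact: in_L2_0. Qed.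

Lemma eqT_canon f g : eqT f g -> canon f = canon g.
Proof.
move=> fg; rewrite /canon; congr xget; apply/seteqP; split => h [h2 e]; split => //.
- exact: eqT_trans (eqT_sym fg) e.
- exact: eqT_trans fg e.
Qed.

(** A class is represented by its canonical element, so that equality of
    classes is Leibniz equality. *)
Record L2 := MkL2 { rep : Tfun R; repP : in_L2 rep /\ canon rep = rep }.

Lemma cls_subproof f : in_L2 (canon (canon f)) /\
  canon (canon (canon f)) = canon (canon f).
Proof.
split; first exact: canon_L2.
by apply/esym/eqT_canon; have [] := canonP (canon_L2 f).
Qed.

(** The operations below are sealed behind opaque witnesses: unification would
    otherwise unfold them down to the choice of representatives. *)
Lemma cls_key : {c : Tfun R -> L2 | forall f, rep (c f) = canon (canon f)}.
Proof. by exists (fun f => MkL2 (cls_subproof f)). Qed.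
Definition cls := sval cls_key.

Lemma rep_L2 (x : L2) : in_L2 (rep x). Proof. by case: (repP x). Qed.
Hint Resolve rep_L2 : core.

Lemma L2_inj (x y : L2) : rep x = rep y -> x = y.
Proof.
case: x y => [f hf] [g hg] /= fg; move: hf hg; rewrite fg => hf hg.
by congr MkL2; exact: Prop_irrelevance.
Qed.

Lemma L2_eqT (x y : L2) : eqT (rep x) (rep y) -> x = y.
Proof.
move=> /eqT_canon e; apply: L2_inj.
by case: (repP x) => _ <-; case: (repP y) => _ <-.
Qed.

Lemma rep_cls f : in_L2 f -> eqT (rep (cls f)) f.
Proof.
move=> f2; apply: eqT_sym; have [h1 h2] := canonP f2; rewrite /cls (svalP cls_key).
by apply: eqT_trans h2 _; have [] := canonP h1.
Qed.

Lemma cls_eq f g : in_L2 f -> in_L2 g -> eqT f g -> cls f = cls g.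
Proof.
move=> f2 g2 fg; apply: L2_eqT; apply: eqT_trans (rep_cls f2) _.
by apply: eqT_trans fg _; exact/eqT_sym/rep_cls.
Qed.

Lemma repK (x : L2) : cls (rep x) = x.
Proof. by apply: L2_eqT; exact: rep_cls. Qed.

Lemma L2_add_key : {add : L2 -> L2 -> L2 |
  forall x y, add x y = cls (fun t => rep x t + rep y t)}.
Proof. by exists (fun x y => cls (fun t => rep x t + rep y t)). Qed.
Lemma L2_opp_key : {opp : L2 -> L2 | forall x, opp x = cls (fun t => - rep x t)}.
Proof. by exists (fun x => cls (fun t => - rep x t)). Qed.
Lemma L2_scale_key : {scale : R[i] -> L2 -> L2 |
  forall z x, scale z x = cls (fun t => z * rep x t)}.
Proof. by exists (fun z x => cls (fun t => z * rep x t)). Qed.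

Definition L2_zero := cls (fun=> 0).
Definition L2_add := sval L2_add_key.
Definition L2_opp := sval L2_opp_key.
Definition L2_scale := sval L2_scale_key.

Lemma in_L2N f : in_L2 f -> in_L2 (fun t => - f t).
Proof. by move=> /(in_L2Z (-1)); under eq_fun do rewrite mulN1r. Qed.

Lemma rep_add x y : eqT (rep (L2_add x y)) (fun t => rep x t + rep y t).
Proof. by rewrite /L2_add (svalP L2_add_key); apply: rep_cls; exact: in_L2D. Qed.

Lemma rep_opp x : eqT (rep (L2_opp x)) (fun t => - rep x t).
Proof. by rewrite /L2_opp (svalP L2_opp_key); apply: rep_cls; exact: in_L2N. Qed.

Lemma rep_scale z x : eqT (rep (L2_scale z x)) (fun t => z * rep x t).
Proof. by rewrite /L2_scale (svalP L2_scale_key); apply: rep_cls; exact: in_L2Z. Qed.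

Lemma rep_zero : eqT (rep L2_zero) (fun=> 0).
Proof. exact/rep_cls/in_L2_0. Qed.

Lemma L2_addA : associative L2_add.
Proof.
move=> x y z; apply: L2_eqT.
filter_upwards [(rep_add x (L2_add y z)), (rep_add y z), (rep_add (L2_add x y) z), (rep_add x y)] => t h1 h2 h3 h4 At.
by rewrite h1// h2// h3// h4// addrA.
Qed.

Lemma L2_addC : commutative L2_add.
Proof.
move=> x y; apply: L2_eqT.
filter_upwards [(rep_add x y), (rep_add y x)] => t h1 h2 At.
by rewrite h1// h2// addrC.
Qed.

Lemma L2_add0 : left_id L2_zero L2_add.
Proof.
move=> x; apply: L2_eqT.
filter_upwards [(rep_add L2_zero x), rep_zero] => t h1 h2 At.
by rewrite h1// h2// add0r.
Qed.

Lemma L2_addN : left_inverse L2_zero L2_opp L2_add.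
Proof.
move=> x; apply: L2_eqT.
filter_upwards [(rep_add (L2_opp x) x), (rep_opp x), rep_zero] => t h1 h2 h3 At.
by rewrite h1// h2// h3// addNr.
Qed.


HB.instance Definition _ := gen_eqMixin L2.
HB.instance Definition _ := gen_choiceMixin L2.
HB.instance Definition _ :=
  GRing.isZmodule.Build L2 L2_addA L2_addC L2_add0 L2_addN.

Lemma L2_scaleA a b v : L2_scale a (L2_scale b v) = L2_scale (a * b) v.
Proof.
apply: L2_eqT.
filter_upwards [(rep_scale a (L2_scale b v)), (rep_scale b v), (rep_scale (a * b) v)]
  => t h1 h2 h3 At.
by rewrite h1// h2// h3// mulrA.
Qed.

Lemma L2_scale1 : left_id 1 L2_scale.
Proof.
by move=> x; apply: L2_eqT; filter_upwards [(rep_scale 1 x)] => t h At; rewrite h// mul1r.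
Qed.

Lemma L2_scaleDr : right_distributive L2_scale +%R.
Proof.
move=> a x y; apply: L2_eqT.
filter_upwards [(rep_scale a (x + y)), (rep_add x y), (rep_add (L2_scale a x) (L2_scale a y)), (rep_scale a x), (rep_scale a y)]
  => t h1 h2 h3 h4 h5 At.
by rewrite h1// [rep (x + y) t]h2// [RHS]h3// h4// h5// mulrDr.
Qed.

Lemma L2_scaleDl v : {morph L2_scale^~ v : a b / a + b}.
Proof.
move=> a b; apply: L2_eqT.
filter_upwards [(rep_scale (a + b) v), (rep_add (L2_scale a v) (L2_scale b v)), (rep_scale a v), (rep_scale b v)]
  => t h1 h3 h4 h5 At.
by rewrite h1// [RHS]h3// h4// h5// mulrDl.
Qed.

HB.instance Definition _ := GRing.Zmodule_isLmodule.Build R[i] L2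
  L2_scaleA L2_scale1 L2_scaleDr L2_scaleDl.

Implicit Types (x y z : L2).

Lemma repD x y : eqT (rep (x + y)) (fun t => rep x t + rep y t).
Proof. exact: rep_add. Qed.

Lemma repN x : eqT (rep (- x)) (fun t => - rep x t).
Proof. exact: rep_opp. Qed.


Lemma repB x y : eqT (rep (x - y)) (fun t => rep x t - rep y t).
Proof.
by filter_upwards [(repD x (- y)), (repN y)] => t h1 h2 At; rewrite h1// h2.
Qed.

Lemma repZ (a : R[i]) x : eqT (rep (a *: x)) (fun t => a * rep x t).
Proof. exact: rep_scale. Qed.

Lemma clsD f g : in_L2 f -> in_L2 g -> cls (fun t => f t + g t) = cls f + cls g.
Proof.
move=> f2 g2; apply: L2_eqT.
filter_upwards [(rep_cls (in_L2D f2 g2)), (repD (cls f) (cls g)), (rep_cls f2), (rep_cls g2)] => t h1 h2 h3 h4 At.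
by rewrite h1// h2// h3// h4.
Qed.

Lemma clsZ (a : R[i]) f : in_L2 f -> cls (fun t => a * f t) = a *: cls f.
Proof.
move=> f2; apply: L2_eqT.
filter_upwards [(rep_cls (in_L2Z a f2)), (repZ a (cls f)), (rep_cls f2)] => t h1 h2 h3 At.
by rewrite h1// h2// h3.
Qed.

Lemma clsB f g : in_L2 f -> in_L2 g -> cls (fun t => f t - g t) = cls f - cls g.
Proof.
move=> f2 g2; apply: L2_eqT.
filter_upwards [(rep_cls (in_L2B f2 g2)), (repB (cls f) (cls g)), (rep_cls f2), (rep_cls g2)] => t h1 h2 h3 h4 At.
by rewrite h1// h2// h3// h4.
Qed.

Lemma cls0 : cls (fun=> 0) = 0.
Proof. by []. Qed.

Lemma ip_key : {p : L2 -> L2 -> R[i] | forall x y, p x y = inner (rep x) (rep y)}.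
Proof. by exists (fun x y => inner (rep x) (rep y)). Qed.
Definition ip := sval ip_key.

Lemma ipE x y : ip x y = inner (rep x) (rep y).
Proof. exact: svalP ip_key x y. Qed.

Lemma ip_cls f g : in_L2 f -> in_L2 g -> ip (cls f) (cls g) = inner f g.
Proof. by move=> f2 g2; rewrite ipE; apply: inner_ae => //; exact: rep_cls. Qed.

Lemma ipDl x y z : ip (x + y) z = ip x z + ip y z.
Proof.
rewrite !ipE -innerDl//; apply: inner_ae => //; [exact: in_L2D|exact: repD|].
exact: eqT_refl.
Qed.

Lemma ipZl (a : R[i]) x z : ip (a *: x) z = a * ip x z.
Proof.
rewrite !ipE -innerZl//; apply: inner_ae => //; [exact: in_L2Z|exact: repZ|].
exact: eqT_refl.
Qed.

Lemma ipJ x y : ip y x = conjc (ip x y).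
Proof. by rewrite !ipE; exact: innerJ. Qed.

Lemma ipNl x z : ip (- x) z = - ip x z.
Proof. by rewrite -scaleN1r ipZl mulN1r. Qed.

Lemma ipBl x y z : ip (x - y) z = ip x z - ip y z.
Proof. by rewrite ipDl ipNl. Qed.

Lemma ip0l z : ip 0 z = 0.
Proof. by rewrite -(subrr z) ipBl subrr. Qed.

Lemma ipDr x y z : ip x (y + z) = ip x y + ip x z.
Proof. by rewrite ipJ ipDl conjcD -!ipJ. Qed.

Lemma ipZr (a : R[i]) x y : ip x (a *: y) = conjc a * ip x y.
Proof. by rewrite ipJ ipZl conjcM -ipJ. Qed.

Lemma ipBr x y z : ip x (y - z) = ip x y - ip x z.
Proof. by rewrite ipJ ipBl conjcD conjcN -!ipJ. Qed.

Lemma ip_selfE x : ip x x = real_complex R ((2 * pi)^-1 *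
  Rintegral mu A (fun t => normc (rep x t) ^+ 2)).
Proof. by rewrite ipE; exact: inner_selfE. Qed.

Lemma ip_ge0 x : 0 <= complex.Re (ip x x).
Proof.
rewrite ip_selfE /= mulr_ge0 ?invr_ge0 ?(ltW pi2_gt0)//.
by apply: Rintegral_ge0 => t _; rewrite sqr_ge0.
Qed.

Lemma ip_eq0 x : complex.Re (ip x x) = 0 -> x = 0.
Proof.
move=> e; have /inner_self_eq0 h : inner (rep x) (rep x) = 0.
  by move: e; rewrite -ipE ip_selfE /= => ->.
by apply: L2_eqT; apply: eqT_trans (h _) (eqT_sym rep_zero).
Qed.

Lemma nrm_key : {n : L2 -> R | forall x, n x = Num.sqrt (complex.Re (ip x x))}.
Proof. by exists (fun x => Num.sqrt (complex.Re (ip x x))). Qed.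
Definition nrm := sval nrm_key.

Lemma nrmE x : nrm x = Num.sqrt (complex.Re (ip x x)).
Proof. exact: svalP nrm_key x. Qed.

Lemma nrm_ge0 x : 0 <= nrm x. Proof. by rewrite nrmE sqrtr_ge0. Qed.

Lemma sqr_nrm x : nrm x ^+ 2 = complex.Re (ip x x).
Proof. by rewrite nrmE sqr_sqrtr// ip_ge0. Qed.

Lemma nrm0_eq0 x : nrm x = 0 -> x = 0.
Proof. by move=> e; apply: ip_eq0; rewrite -sqr_nrm e expr0n. Qed.

Lemma nrm0 : nrm 0 = 0.
Proof. by rewrite !nrmE ip0l sqrtr0. Qed.

Lemma nrmZ (a : R[i]) x : nrm (a *: x) = normc a * nrm x.
Proof.
rewrite !nrmE ipZl ipZr mulrA mulJ_normc Re_realM sqrtrM ?sqr_ge0//.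
by rewrite sqrtr_sqr ger0_norm ?normc_ge0.
Qed.

Lemma nrmN x : nrm (- x) = nrm x.
Proof. by rewrite -scaleN1r nrmZ normcN normc1 mul1r. Qed.

Lemma nrm_subC x y : nrm (x - y) = nrm (y - x).
Proof. by rewrite -opprB nrmN. Qed.


Lemma sqr_nrmD x y :
  nrm (x + y) ^+ 2 = nrm x ^+ 2 + 2 * complex.Re (ip x y) + nrm y ^+ 2.
Proof.
rewrite !sqr_nrm ipDl !ipDr !ReD (ipJ x y) ReJ; ring.
Qed.

(** The square norm of x minus its projection on the line of y is nonnegative. *)
Lemma cauchy_schwarz x y : complex.Re (ip x y) <= nrm x * nrm y.
Proof.
have [y0|ypos] := eqVneq (nrm y) 0.
  by rewrite y0 mulr0 (nrm0_eq0 y0) ipJ ip0l.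
have yp : 0 < nrm y by rewrite lt_neqAle eq_sym ypos nrm_ge0.
have := sqr_ge0 (nrm (x - real_complex R (complex.Re (ip x y) / nrm y ^+ 2) *: y)).
set b := complex.Re (ip x y).
rewrite -scaleNr sqr_nrmD nrmZ normcN normc_real ipZr conjcN conjc_real.
rewrite mulNr ReN Re_realM -/b exprMn real_normK ?num_real//.
move=> h.
have [b0|b0] := leP b 0; first by rewrite (le_trans b0)// mulr_ge0 ?nrm_ge0.
rewrite -(@ler_pXn2r _ 2)// ?nnegrE ?(ltW b0) ?mulr_ge0 ?nrm_ge0// exprMn.
rewrite -ler_pdivrMr ?exprn_gt0// -subr_ge0.
have -> : nrm x ^+ 2 - b ^+ 2 / nrm y ^+ 2 =
  nrm x ^+ 2 + 2 * - (b / nrm y ^+ 2 * b) + (b / nrm y ^+ 2) ^+ 2 * nrm y ^+ 2.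
  by field.
exact: h.
Qed.

Lemma nrmD x y : nrm (x + y) <= nrm x + nrm y.
Proof.
rewrite -(@ler_pXn2r _ 2)// ?nnegrE ?addr_ge0 ?nrm_ge0//.
by rewrite sqr_nrmD sqrrD; have := cauchy_schwarz x y; rewrite mulr2n; lra.
Qed.

Lemma nrmB x y : nrm (x - y) <= nrm x + nrm y.
Proof. by rewrite (le_trans (nrmD _ _))// nrmN. Qed.

Lemma nrm_dist_tri z x y : nrm (x - y) <= nrm (x - z) + nrm (z - y).
Proof.
have -> : x - y = (x - z) + (z - y) by rewrite addrA subrK.
exact: nrmD.
Qed.

(** The factor 2 comes from bounding real and imaginary parts apart. *)
Lemma normc_ip_le x y : normc (ip x y) <= 2 * (nrm x * nrm y).
Proof.
rewrite (le_trans (normc_le_ReIm _))// mulr_natl mulr2n.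
have H v w : `|complex.Re (ip v w)| <= nrm v * nrm w.
  rewrite ler_norml cauchy_schwarz andbT lerNl -ReN -ipNl.
  by rewrite (le_trans (cauchy_schwarz _ _))// nrmN.
apply: lerD; first exact: H.
have n1 : normc (Complex 0 (-1) : R[i]) = 1.
  by rewrite normcE /= expr0n /= add0r sqrrN expr1n sqrtr1.
have := H (Complex 0 (-1) *: x) y; rewrite nrmZ n1 mul1r.
suff -> : complex.Re (ip (Complex 0 (-1) *: x) y) = complex.Im (ip x y) by [].
by rewrite ipZl ReM [complex.Re _]/= [complex.Im (Complex _ _)]/=; ring.
Qed.

Lemma parallelogram x y :
  nrm (x + y) ^+ 2 + nrm (x - y) ^+ 2 = 2 * nrm x ^+ 2 + 2 * nrm y ^+ 2.
Proof.
rewrite (sqr_nrmD x y) (sqr_nrmD x (- y)) nrmN; have -> : ip x (- y) = - ip x y.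
  by rewrite -scaleN1r ipZr conjcN conjc1 mulN1r.
by rewrite ReN; ring.
Qed.


Lemma Rintegral_nrm x :
  Rintegral mu A (fun t => normc (rep x t) ^+ 2) = 2 * pi * nrm x ^+ 2.
Proof. by rewrite sqr_nrm ip_selfE /= mulrA mulfV ?mul1r// gt_eqF// pi2_gt0. Qed.

Lemma integral_nrm x :
  (\int[mu]_(t in A) ((normc (rep x t) ^+ 2)%R)%:E)%E = (2 * pi * nrm x ^+ 2)%:E.
Proof.
rewrite -Rintegral_nrm fineK//; apply: (integrable_fin_num measurable_angles).
exact: ((in_L2P _).1 (rep_L2 x)).2.
Qed.

End L2Space.
#[global] Hint Resolve rep_L2 : core.
#[global] Hint Resolve measurable_angles : core.
Arguments L2 : clear implicits.

(** * Completeness and orthogonal projections *)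

Section DyadicBounds.
Context {R : realType}.

Lemma expr2_gt0 n : 0 < (2 : R) ^+ n.
Proof. by rewrite exprn_gt0. Qed.
Hint Resolve expr2_gt0 : core.

(** Every limit below is reached at a geometric rate, so that passing to the limit
    in an estimate means letting n grow in the bound c / 2^n. *)
Lemma le_dyadic (a b c : R) : (forall n, a <= b + c / 2 ^+ n) -> a <= b.
Proof.
move=> h; rewrite leNgt; apply/negP => ba.
have d0 : 0 < a - b by rewrite subr_gt0.
have c0 : 0 <= `|c| / (a - b) by rewrite divr_ge0// ltW.
have := archi_boundP c0; set n := Num.Def.archi_bound _ => hn.
have n2 : n%:R <= (2 : R) ^+ n by rewrite -natrX ler_nat ltnW// ltn_expl.
have := h n; rewrite leNgt => /negP; apply.
rewrite -ltrBrDl ltr_pdivrMr// (le_lt_trans (ler_norm c))//.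
by rewrite mulrC -ltr_pdivrMr// (lt_le_trans hn).
Qed.

Lemma nneseries_dyadic_lty (c : R) : 0 <= c ->
  (\sum_(0 <= i <oo) (c / 2 ^+ i)%:E < +oo)%E.
Proof.
move=> c0; have c20 : 0 <= c * 2 by rewrite mulr_ge0.
apply: le_lt_trans (ltry (c * 2)).
rewrite (le_trans _ (epsilon_trick0 xpredT c20))//.
apply: lee_nneseries => i _.
  by move=> _; rewrite lee_fin divr_ge0// ltW.
by rewrite lee_fin natrX exprS invfM mulrA mulfK.
Qed.

Lemma nneseries_lty_cvg (a : R^nat) : (forall n, 0 <= a n) ->
  (\sum_(0 <= i <oo) (a i)%:E < +oo)%E -> cvgn (series a).
Proof.
move=> a0 foo.
have s0 : (0 <= \sum_(0 <= i <oo) (a i)%:E)%E.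
  by apply: nneseries_ge0 => n _ _; rewrite lee_fin.
apply: nondecreasing_is_cvgn.
  by apply: nondecreasing_series => n _ _; exact: a0.
exists (fine (\sum_(0 <= i <oo) (a i)%:E)%E) => _ [n _ <-].
rewrite -lee_fin fineK ?ge0_fin_numE// /series /= -sumEFin.
by apply: nneseries_lim_ge => k _ _; rewrite lee_fin.
Qed.

Lemma cvg_of_summable_increments (a b : R^nat) :
  (forall n, `|a n.+1 - a n| <= b n) -> cvgn (series b) -> cvgn a.
Proof.
move=> ab cb.
have b0 n : 0 <= b n by exact: le_trans (normr_ge0 _) (ab n).
have ct : cvgn (series (telescope a)).
  by apply: normed_cvg; apply: series_le_cvg cb => //= n; exact: ab.
have -> : a = (fun n => a 0%N + series (telescope a) n).
  by apply/funext => n; rewrite -eq_sum_telescope.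
by apply: is_cvgD => //; exact: is_cvg_cst.
Qed.

End DyadicBounds.
#[global] Hint Resolve expr2_gt0 : core.

Section Completeness.
Context {R : realType}.
Local Notation mu := (@lebesgue_measure R).
Local Notation A := (@angles R).
Implicit Types (x : nat -> L2 R) (C : R).

(** The arithmetic-geometric mean inequality with a free parameter e replaces the
    Cauchy-Schwarz inequality against the constant function; for increments of
    norm 2^-n the choice e = 2^-n keeps the bound summable. *)
Lemma integral_normc_le (y : L2 R) (e : R) : 0 < e ->
  (\int[mu]_(t in A) (normc (rep y t))%:E <=
    (pi * (e + e^-1 * nrm y ^+ 2))%:E)%E.
Proof.
move=> e0; have [my y2] := (in_L2P _).1 (rep_L2 y).
have iy := cint_normc (cint_L2 (rep_L2 y)).
have i2 := integrable_scale (2^-1 * e^-1) y2.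
have i1 := integrable_cst (2^-1 * e).
rewrite -[leLHS]fineK; last exact: (integrable_fin_num measurable_angles iy).
rewrite lee_fin.
suff -> : pi * (e + e^-1 * nrm y ^+ 2) = \int[mu]_(t in A)
    (2^-1 * e + 2^-1 * e^-1 * normc (rep y t) ^+ 2).
  apply: le_Rintegral => //.
    exact: (integrableD measurable_angles i1 i2).
  move=> t _; rewrite -subr_ge0.
  rewrite (_ : _ - _ = 2^-1 * e^-1 * (normc (rep y t) - e) ^+ 2).
    by rewrite mulr_ge0 ?sqr_ge0// mulr_ge0// invr_ge0 ltW.
  by field; rewrite gt_eqF.
rewrite RintegralD// Rintegral_cst// RintegralZl// Rintegral_nrm.
have -> : fine (mu A) = 2 * pi by rewrite mu_angles.
by field; rewrite gt_eqF.
Qed.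

(** The integrals of the increments are summable, hence by monotone convergence
    the increments themselves are, at almost every angle. *)
Lemma ae_increments x C : (forall n, nrm (x n.+1 - x n) <= C / 2 ^+ n) ->
  {ae mu, forall t, A t -> cvgn (series (fun n => normc (rep (x n.+1 - x n) t)))}.
Proof.
move=> hx; pose d n t := normc (rep (x n.+1 - x n) t).
have md n : measurable_fun A (EFin \o d n).
  by apply/measurable_EFinP; exact: (cmeas_normc (in_L2_meas (rep_L2 _))).
have d0 n t : (0 <= (d n t)%:E)%E by rewrite lee_fin normc_ge0.
have C0 : 0 <= C.
  by have := hx 0%N; rewrite expr0 divr1; exact: le_trans (nrm_ge0 _).
have dB n : (\int[mu]_(t in A) (d n t)%:E <= (pi * (1 + C ^+ 2) / 2 ^+ n)%:E)%E.
  have e0 : 0 < (2 ^+ n : R)^-1 by rewrite invr_gt0.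
  apply: (le_trans (integral_normc_le _ e0)); rewrite lee_fin.
  have : nrm (x n.+1 - x n) ^+ 2 <= (C / 2 ^+ n) ^+ 2.
    by rewrite ler_pXn2r ?nnegrE ?nrm_ge0// divr_ge0// ltW.
  move=> h; rewrite -mulrA ler_pM2l ?pi_gt0// mulrDl mul1r lerD2l invrK.
  rewrite (le_trans (ler_wpM2l _ h)) ?(ltW (expr2_gt0 n))//.
  by rewrite le_eqVlt; apply/orP; left; apply/eqP; field; rewrite gt_eqF.
have I : (\int[mu]_(t in A) \sum_(0 <= n <oo) (d n t)%:E < +oo)%E.
  rewrite integral_nneseries//.
  apply: le_lt_trans (@nneseries_dyadic_lty _ (pi * (1 + C ^+ 2)) _).
    apply: lee_nneseries => n _; last exact: dB.
    by move=> _; exact: integral_ge0.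
  by rewrite mulr_ge0 ?pi_ge0// addr_ge0// sqr_ge0.
have /(integrable_ae measurable_angles) :
    mu.-integrable A (fun t => \sum_(0 <= n <oo) (d n t)%:E)%E.
  apply/integrableP; split.
    have := @ge0_emeasurable_sum _ _ R A (fun n t => (d n t)%:E) xpredT
      (fun k t _ _ => d0 k t) (fun k _ => md k).
    have -> : (fun t => \sum_(0 <= n <oo) (d n t)%:E)%E =
        (fun t => \sum_(0 <= i <oo | i \in xpredT) (d i t)%:E)%E.
      by apply/funext => t; apply: eq_eseriesl.
    by move=> h; exact: h.
  under eq_integral do rewrite gee0_abs ?nneseries_ge0//.
  exact: I.
apply: filterS => t h At; apply: nneseries_lty_cvg.
  by move=> n; exact: normc_ge0.
by have := h At; rewrite fin_numElt => /andP[].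
Qed.

Lemma dist_le_dyadic x C : (forall n, nrm (x n.+1 - x n) <= C / 2 ^+ n) ->
  forall n j, nrm (x (n + j)%N - x n) <= 2 * C / 2 ^+ n.
Proof.
move=> hx n j.
have C0 : 0 <= C.
  by have := hx 0%N; rewrite expr0 divr1; exact: le_trans (nrm_ge0 _).
suff h : nrm (x (n + j)%N - x n) <= 2 * C / 2 ^+ n - 2 * C / 2 ^+ (n + j).
  by rewrite (le_trans h)// gerBl divr_ge0 ?mulr_ge0// ltW.
elim: j => [|j ih]; first by rewrite addn0 !subrr nrm0.
rewrite addnS (le_trans (nrm_dist_tri (x (n + j)%N) _ _))//.
rewrite (le_trans (lerD (hx _) ih))// exprS invfM.
rewrite le_eqVlt; apply/orP; left; apply/eqP.
by field; rewrite !gt_eqF.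
Qed.

(** Riesz-Fischer for sequences that converge geometrically: such a sequence
    converges almost everywhere, and Fatou's lemma controls the distance to
    the pointwise limit. *)
Theorem L2_complete x C : (forall n, nrm (x n.+1 - x n) <= C / 2 ^+ n) ->
  exists y, forall n, nrm (y - x n) <= 2 * C / 2 ^+ n.
Proof.
move=> hx.
have mRe n : measurable_fun A (fun t => complex.Re (rep (x n) t)).
  by have [] := in_L2_meas (rep_L2 (x n)).
have mIm n : measurable_fun A (fun t => complex.Im (rep (x n) t)).
  by have [] := in_L2_meas (rep_L2 (x n)).
(* The upper limit is measurable unconditionally and equals the limit wherever
   the latter exists. *)
pose G (p : R[i] -> R) t := fine (limn_esup (fun n => (p (rep (x n) t))%:E)).
pose F t := Complex (G (@complex.Re R) t) (G (@complex.Im R) t).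
have mF : cmeas F.
  split; rewrite /F /=.
  - have ml : measurable_fun A
        (fun t => limn_esup (fun n => (complex.Re (rep (x n) t))%:E)).
      apply: (measurable_fun_limn_esup
        (f := fun n t => (complex.Re (rep (x n) t))%:E)) => n.
      exact/measurable_EFinP.
    exact: (measurableT_comp (fine_measurable measurableT) ml).
  - have ml : measurable_fun A
        (fun t => limn_esup (fun n => (complex.Im (rep (x n) t))%:E)).
      apply: (measurable_fun_limn_esup
        (f := fun n t => (complex.Im (rep (x n) t))%:E)) => n.
      exact/measurable_EFinP.
    exact: (measurableT_comp (fine_measurable measurableT) ml).
have cF : {ae mu, forall t, A t ->
    (fun n => complex.Re (rep (x n) t)) @ \oo --> complex.Re (F t) /\
    (fun n => complex.Im (rep (x n) t)) @ \oo --> complex.Im (F t)}.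
  have /ae_foralln hd : forall n, {ae mu, forall t, A t ->
      rep (x n.+1 - x n) t = rep (x n.+1) t - rep (x n) t}.
    by move=> n; exact: repB.
  apply: filterS2 hd (ae_increments hx) => t hd hc At.
  have H (p : R[i] -> R) : (forall a b, p (a - b) = p a - p b) ->
      (forall a, `|p a| <= normc a) ->
      (fun n => p (rep (x n) t)) @ \oo --> G p t.
    move=> pB pn.
    have cp : cvgn (fun n => p (rep (x n) t)).
      apply: cvg_of_summable_increments (hc At) => n.
      by rewrite hd// -pB.
    have cE : (fun n => (p (rep (x n) t))%:E) @ \oo -->
        (limn (fun n => p (rep (x n) t)))%:E.
      by apply: cvg_EFin; [exact: nearW|exact: cp].
    by rewrite /G (cvg_limn_einf_sup cE).2.
  split; apply: H.
  - by move=> a b; rewrite ReD ReN.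
  - exact: normc_Re_le.
  - by move=> a b; rewrite ImD ImN.
  - exact: normc_Im_le.
pose D n t := normc (F t - rep (x n) t) ^+ 2.
have mD n : measurable_fun A (D n).
  by apply: cmeas_normc2; apply: cmeasB => //; exact: in_L2_meas (rep_L2 _).
have bound n : (\int[mu]_(t in A) (D n t)%:E <=
    (2 * pi * (2 * C / 2 ^+ n) ^+ 2)%:E)%E.
  pose g m t := ((normc (rep (x (m + n)%N - x n) t) ^+ 2)%R)%:E.
  have mg m : measurable_fun A (g m).
    by apply/measurable_EFinP; exact: (cmeas_normc2 (in_L2_meas (rep_L2 _))).
  have g0 m t : (0 <= g m t)%E by rewrite lee_fin sqr_ge0.
  have gB m : (\int[mu]_(t in A) g m t <= (2 * pi * (2 * C / 2 ^+ n) ^+ 2)%:E)%E.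
    rewrite integral_nrm lee_fin ler_pM2l ?pi2_gt0// addnC.
    have h := dist_le_dyadic hx n m.
    by rewrite ler_pXn2r ?nnegrE ?nrm_ge0// (le_trans _ h)// nrm_ge0.
  have -> : (\int[mu]_(t in A) (D n t)%:E =
      \int[mu]_(t in A) limn_einf (g ^~ t))%E.
    apply: ae_eq_integral => //.
    - by apply/measurable_EFinP; exact: mD.
    - rewrite (_ : (fun t => limn_einf (g ^~ t)) =
        (fun t => (- limn_esup (fun m => (- g m t)%E))%E)).
        apply: measurableT_comp => //.
        apply: (measurable_fun_limn_esup (f := fun m t => (- g m t)%E)) => m.
        by apply: measurableT_comp => //; exact: mg.
      by apply/funext => t; rewrite -limn_einfN; congr limn_einf;
        apply/funext => m; exact/esym/oppeK.
    have /ae_foralln hd : forall m, {ae mu, forall t, A t ->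
        rep (x (m + n)%N - x n) t = rep (x (m + n)%N) t - rep (x n) t}.
      by move=> m; exact: repB.
    apply: filterS2 hd cF => t hd hc At; have [cr ci] := hc At.
    apply/esym; apply: (cvg_limn_einf_sup _).1.
    rewrite /g /D.
    apply: cvg_EFin; first exact: nearW.
    rewrite (_ : fine \o _ = fun m =>
      (complex.Re (rep (x (m + n)%N) t) - complex.Re (rep (x n) t)) ^+ 2 +
      (complex.Im (rep (x (m + n)%N) t) - complex.Im (rep (x n) t)) ^+ 2);
      last first.
      by apply/funext => m /=; rewrite hd// sqr_normcE ReD ImD ReN ImN.
    rewrite sqr_normcE ReD ImD ReN ImN.
    have {}cr := cvg_comp _ _ (cvg_addnr n) cr.
    have {}ci := cvg_comp _ _ (cvg_addnr n) ci.
    apply: cvgD; rewrite expr2; under eq_fun do rewrite expr2.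
    - by apply: cvgM; apply: cvgB => //; exact: cvg_cst.
    - by apply: cvgM; apply: cvgB => //; exact: cvg_cst.
  apply: le_trans (fatou _ _ _ _) _ => //.
  rewrite limn_einf_lim; apply: lime_le; first exact: is_cvg_einfs.
  apply: nearW => m; apply: le_trans (gB m).
  by apply: ereal_inf_lbound; exists m => /=.
have F2 : in_L2 F.
  have D2 : in_L2 (fun t => F t - rep (x 0%N) t).
    have [mr mi] : cmeas (fun t => F t - rep (x 0%N) t).
      by apply: cmeasB => //; exact: in_L2_meas (rep_L2 _).
    by split => //; exact: le_lt_trans (bound 0%N) (ltry _).
  have := in_L2D D2 (rep_L2 (x 0%N)).
  by under eq_fun do rewrite subrK.
exists (cls F) => n.
have C0 : 0 <= C.
  by have := hx 0%N; rewrite expr0 divr1; exact: le_trans (nrm_ge0 _).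
have e0 : 0 <= 2 * C / 2 ^+ n by rewrite divr_ge0 ?mulr_ge0// ltW.
rewrite -(@ler_pXn2r _ 2)// ?nnegrE ?nrm_ge0//.
rewrite -(ler_pM2l (@pi2_gt0 R)) -lee_fin -integral_nrm.
apply: le_trans (bound n); rewrite le_eqVlt; apply/orP; left; apply/eqP.
apply: ae_eq_integral => //.
- by apply/measurable_EFinP; exact: (cmeas_normc2 (in_L2_meas (rep_L2 _))).
- by apply/measurable_EFinP; exact: mD.
apply: filterS2 (repB (cls F) (x n)) (rep_cls F2) => t h1 h2 At.
by rewrite /D h1// h2.
Qed.

End Completeness.

Section Projection.
Context {R : realType}.
Implicit Types (S : L2 R -> Prop) (x y s : L2 R).

(** The closest point exists because the parallelogram identity turns a
    minimizing sequence into a geometrically Cauchy one. *)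
Theorem orthogonal_projection S : S 0 -> (forall a s t, S s -> S t -> S (a *: s + t)) ->
  (forall (s : nat -> L2 R) y c, (forall n, S (s n)) ->
     (forall n, nrm (y - s n) <= c / 2 ^+ n) -> S y) ->
  forall x, exists2 p, S p & forall s, S s -> ip (x - p) s = 0.
Proof.
move=> S0 SD Scl x.
pose E := [set r | exists2 s, S s & r = nrm (x - s) ^+ 2].
have iE : has_inf E.
  split; first by exists (nrm (x - 0) ^+ 2); exists 0.
  by exists 0 => _ [s _ ->]; exact: sqr_ge0.
set d := inf E.
have dle s : S s -> d <= nrm (x - s) ^+ 2.
  by move=> Ss; apply: ge_inf; [case: iE|exists s].
have exs n : exists s, S s /\ nrm (x - s) ^+ 2 <= d + (4 ^+ n)^-1.
  have e0 : 0 < (4 ^+ n : R)^-1 by rewrite invr_gt0 exprn_gt0.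
  have [_ [s Ss ->] h] := inf_adherent e0 iE.
  by exists s; split => //; exact: ltW.
have [s /all_and2[Ss hs]] := choice exs.
have four n : (4 : R) ^+ n = 2 ^+ n * 2 ^+ n by rewrite -exprMn -natrM.
have cau n : nrm (s n.+1 - s n) <= 2 / 2 ^+ n.
  have p2 := expr2_gt0 (R := R) n.
  rewrite -(@ler_pXn2r _ 2)// ?nnegrE ?nrm_ge0 ?divr_ge0// ?(ltW p2)//.
  have mid : S (2^-1 *: s n.+1 + 2^-1 *: s n).
    by apply: (SD); rewrite // -[_ *: s n]addr0; apply: SD.
  have := dle _ mid; have := hs n; have := hs n.+1.
  have := parallelogram (x - s n.+1) (x - s n).
  have -> : x - s n.+1 - (x - s n) = - (s n.+1 - s n).
    by rewrite !opprB [LHS]addrC addrA subrK.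
  have -> : x - s n.+1 + (x - s n) =
      (2 : R[i]) *: (x - (2^-1 *: s n.+1 + 2^-1 *: s n)).
    rewrite scalerBr scalerDr !scalerA mulfV ?pnatr_eq0// !scale1r.
    by rewrite scaler_nat mulr2n opprD addrACA.
  have n2 : normc (2 : R[i]) = 2.
    by rewrite -[2 in LHS](rmorph_nat (real_complex R)) normc_real ger0_norm.
  rewrite nrmN nrmZ n2 exprMn (exprS 4 n) (four n).
  have -> : (2 / 2 ^+ n) ^+ 2 = 4 * (2 ^+ n * 2 ^+ n : R)^-1.
    by field; rewrite gt_eqF.
  have -> : (4 * (2 ^+ n * 2 ^+ n) : R)^-1 = 4^-1 * (2 ^+ n * 2 ^+ n)^-1.
    by rewrite invfM.
  have : 0 < (2 ^+ n * 2 ^+ n : R)^-1 by rewrite invr_gt0 mulr_gt0.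
  by move: (_^-1) => e; nra.
have [p hp] := L2_complete cau.
have Sp : S p by exact: (Scl s p (2 * 2)).
have minp t : S t -> nrm (x - p) <= nrm (x - t).
  move=> St; apply: (@le_dyadic _ _ _ 5) => n.
  apply: le_trans (nrm_dist_tri (s n) _ _) _.
  have := hp n; rewrite (nrm_subC p) => h1.
  have h2 : nrm (x - s n) <= nrm (x - t) + 1 / 2 ^+ n.
    have i0 : 0 <= (2 ^+ n : R)^-1 by rewrite invr_ge0 ltW.
    rewrite div1r -(@ler_pXn2r _ 2)// ?nnegrE ?nrm_ge0 ?addr_ge0 ?nrm_ge0//.
    move: i0 (hs n) (dle t St); rewrite (four n) invfM.
    move: (2 ^+ n)^-1 => e e0 hsn dt; rewrite sqrrD mulr2n.
    have := mulr_ge0 (nrm_ge0 (x - t)) e0; rewrite (expr2 e).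
    move: dt hsn; move: (_ ^+ 2) (_ ^+ 2) (_ * _) (_ * _) => a b c f; lra.
  by have -> : (5 : R) / 2 ^+ n = 1 / 2 ^+ n + 2 * 2 / 2 ^+ n; [ring|lra].
have re0 t : S t -> complex.Re (ip (x - p) t) = 0.
  move=> St; set r := complex.Re _.
  have quad (e : R) : 2 * e * r <= e ^+ 2 * nrm t ^+ 2.
    have St' : S (p + real_complex R e *: t) by rewrite addrC; exact: SD.
    have := minp _ St'.
    rewrite -(@ler_pXn2r _ 2)// ?nnegrE ?nrm_ge0// opprD addrA -scaleNr.
    rewrite (sqr_nrmD (x - p)) nrmZ normcN normc_real ipZr conjcN conjc_real.
    by rewrite mulNr ReN Re_realM -/r exprMn real_normK ?num_real//; lra.
  (* The quadratic inequality forces r = 0; this value of e shows it without a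
     case distinction on the norm of t. *)
  have := quad (r / (nrm t ^+ 2 + 1)).
  have k0 : 0 < nrm t ^+ 2 + 1 by rewrite ltr_wpDl// sqr_ge0.
  set k := nrm t ^+ 2 in k0 *.
  have -> : 2 * (r / (k + 1)) * r = 2 * (k + 1) * (r / (k + 1)) ^+ 2.
    by field; rewrite gt_eqF.
  move=> h; have : (k + 2) * (r / (k + 1)) ^+ 2 <= 0 by lra.
  rewrite pmulr_rle0 ?(lt_trans k0)// ?ltrD2l ?ltr1n//.
  rewrite le_eqVlt ltNge sqr_ge0 orbF sqrf_eq0 mulf_eq0 invr_eq0 (gt_eqF k0) orbF.
  by move/eqP.
(* The imaginary part is the real part against i t. *)
exists p => // t St; apply: complexP; first exact: re0.
have -> : complex.Im (ip (x - p) t) =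
    complex.Re (conjc (Complex 0 1) * ip (x - p) t).
  by rewrite ReM ReJ ImJ /=; ring.
by rewrite -ipZr re0// -[_ *: t]addr0; exact: SD.
Qed.

End Projection.

(** * Uniqueness of Fourier coefficients *)

Section Exponentials.
Context {R : realType}.
Implicit Types (x : R) (j k : int).

Lemma expiD j k x : expi (j + k) x = expi j x * expi k x.
Proof.
by apply: complexP; rewrite ?ReM ?ImM /= intrD mulrDl ?cosD ?sinD; ring.
Qed.

Lemma expi0 x : expi 0 x = 1.
Proof. by rewrite /expi mul0r cos0 sin0. Qed.

Lemma conjc_expi k x : conjc (expi k x) = expi (- k) x.
Proof. by rewrite /expi /= rmorphN/= mulNr cosN sinN. Qed.

Lemma normc_expi k x : normc (expi k x) = 1.
Proof. by rewrite normcE /= cos2Dsin2 sqrtr1. Qed.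

Lemma expiVr k x : expi k x * expi (- k) x = 1.
Proof. by rewrite -expiD subrr expi0. Qed.

Lemma bddT_expi k : bddT (@expi R k).
Proof.
split; last by exists 1 => x; rewrite normc_expi.
have m : measurable_fun (@angles R) (fun x : R => k%:~R * x).
  by apply: measurable_funM => //; exact: measurable_cst.
split.
- apply: (measurableT_comp (f := @cos R) _ m).
  by apply: continuous_measurable_fun; exact: continuous_cos.
- apply: (measurableT_comp (f := @sin R) _ m).
  by apply: continuous_measurable_fun; exact: continuous_sin.
Qed.

Lemma in_L2_expi k : in_L2 (@expi R k).
Proof. exact/bddT_L2/bddT_expi. Qed.

End Exponentials.
#[global] Hint Resolve in_L2_expi bddT_expi : core.

Section StepApproximation.
Context {R : realType}.
Implicit Types (y a : R) (n m : nat).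

(** The polynomials of Brosowski and Deutsch: on [0, 1] they tend boundedly to
    the indicator function of [0, 1/2[. *)
Definition step_poly n y := (1 - y ^+ n) ^+ (2 ^ n).

Lemma bernoulli_le a m : 0 <= a <= 1 -> 1 - m%:R * a <= (1 - a) ^+ m.
Proof.
move=> /andP[a0 a1]; elim: m => [|m ih]; first by rewrite mul0r subr0 expr0.
rewrite exprS; have h : (1 - a) * (1 - m%:R * a) <= (1 - a) * (1 - a) ^+ m.
  by rewrite ler_wpM2l// subr_ge0.
apply: le_trans h; rewrite -natr1.
have := mulr_ge0 (ler0n R m) (sqr_ge0 a); rewrite expr2; lra.
Qed.

Lemma step_poly_bound n y : 0 <= y <= 1 -> 0 <= step_poly n y <= 1.
Proof.
move=> /andP[y0 y1]; have yn : 0 <= y ^+ n <= 1 by rewrite exprn_ge0// exprn_ile1.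
move: yn => /andP[h0 h1].
by rewrite exprn_ge0 ?subr_ge0//= exprn_ile1// ?subr_ge0// gerBl.
Qed.

(** By Bernoulli's inequality the value is at least 1 - (2 y)^n. *)
Lemma step_poly_cvg1 y : 0 <= y -> y < 2^-1 ->
  (fun n => step_poly n y) @ \oo --> (1 : R).
Proof.
move=> y0 y1.
have yle : y <= 1 by lra.
apply: (@squeeze_cvgr _ _ _ _ (fun n => 1 - (2 * y) ^+ n) (fun=> 1)).
- have y01 : 0 <= y <= 1 by rewrite y0.
  apply: nearW => n; have /andP[_ ->] := step_poly_bound n y01.
  have yn : 0 <= y ^+ n <= 1 by rewrite exprn_ge0// exprn_ile1.
  by rewrite exprMn -natrX andbT; exact: bernoulli_le.
- rewrite -[X in _ --> X](subr0 1); apply: cvgB; first exact: cvg_cst.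
  by apply: cvg_expr; rewrite ger0_norm ?mulr_ge0//; lra.
- exact: cvg_cst.
Qed.

(** With a = y^n and m = 2^n, the product of (1 - a)^m and (1 + a)^m is at most 1,
    while (1 + a)^m is at least 1 + (2 y)^n, which grows linearly. *)
Lemma step_poly_cvg0 y : 2^-1 < y -> y <= 1 ->
  (fun n => step_poly n y) @ \oo --> (0 : R).
Proof.
move=> y1 yle; have y0 : 0 <= y by lra.
set c := 2 * y - 1; have c0 : 0 < c by rewrite /c; lra.
have c1 : c <= 1 by rewrite /c; lra.
apply: (@squeeze_cvgr _ _ _ _ (fun=> 0) (fun n => c^-1 * harmonic n)).
- have y01 : 0 <= y <= 1 by rewrite y0.
  apply: nearW => n; have /andP[-> _] := step_poly_bound n y01.
  rewrite /= /step_poly /harmonic -invfM; set a := y ^+ n.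
  have /andP[a0 a1] : 0 <= a <= 1 by rewrite exprn_ge0// exprn_ile1.
  have pow : 1 + (2 ^ n)%:R * a <= (1 + a) ^+ (2 ^ n).
    elim: (2 ^ n)%N => [|m ih]; first by rewrite mul0r addr0 expr0.
    have a10 : 0 <= 1 + a by lra.
    rewrite exprS; apply: le_trans (ler_wpM2l a10 ih); rewrite -natr1.
    by have := mulr_ge0 (ler0n R m) (sqr_ge0 a); rewrite expr2; lra.
  have grow : c * n.+1%:R <= 1 + (2 ^ n)%:R * a.
    rewrite natrX -exprMn -/(2 * y).
    have -> : 2 * y = 1 + c by rewrite /c; lra.
    suff : 1 + n%:R * c <= (1 + c) ^+ n by rewrite -natr1; lra.
    elim: n {a a0 a1 pow} => [|n ih]; first by rewrite mul0r addr0 expr0.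
    have c10 : 0 <= 1 + c by lra.
    rewrite exprS; apply: le_trans (ler_wpM2l c10 ih); rewrite -natr1.
    by have := mulr_ge0 (ler0n R n) (sqr_ge0 c); rewrite expr2; lra.
  have p0 : 0 < c * n.+1%:R by rewrite mulr_gt0.
  rewrite -[leRHS]div1r ler_pdivlMr//.
  apply: le_trans (ler_wpM2l _ (le_trans grow pow)) _.
    by rewrite exprn_ge0// subr_ge0.
  rewrite -exprMn; apply: exprn_ile1; first by rewrite mulr_ge0 ?subr_ge0// addr_ge0.
  by have := sqr_ge0 a; rewrite expr2; lra.
- exact: cvg_cst.
- rewrite -[X in _ --> X](mulr0 c^-1); apply: cvgM; first exact: cvg_cst.
  exact: cvg_harmonic.
Qed.

Lemma cos_arc_inside (r x : R) : 0 < r < pi -> 0 < x < 2 * r -> cos r < cos (x - r).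
Proof.
move=> /andP[r0 rp] /andP[x0 x2].
have [xr|xr] := leP r x.
- by rewrite ltr_cos ?in_itv/=; lra.
- rewrite -[cos (x - r)]cosN opprB ltr_cos ?in_itv/=; lra.
Qed.

Lemma cos_arc_outside (r x : R) : 0 < r < pi -> 2 * r < x < 2 * pi ->
  cos (x - r) < cos r.
Proof.
move=> /andP[r0 rp] /andP[x0 x2].
have [xr|xr] := leP (x - r) pi.
- by rewrite ltr_cos ?in_itv/=; lra.
- have -> : cos (x - r) = cos (pi - (x - r - pi)).
    by rewrite !cosB sinB cospi sinpi; ring.
  by rewrite ltr_cos ?in_itv/=; lra.
Qed.

End StepApproximation.

Section FourierUniqueness.
Context {R : realType}.
Local Notation mu := (@lebesgue_measure R).
Local Notation A := (@angles R).
Variable f : Tfun R.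
Hypothesis f2 : in_L2 f.

(** This property of p is stable under multiplication by trigonometric
    polynomials, hence by any polynomial in the function arc below. *)
Definition killed (p : Tfun R) :=
  bddT p /\ forall k, integralT (fun x => f x * p x * expi k x) = 0.

Lemma cint_killed p k : bddT p -> cint (fun x => f x * p x * expi k x).
Proof.
move=> bp; apply: cintM; last exact: in_L2_expi.
by under eq_fun do rewrite mulrC; exact: in_L2_bddM.
Qed.

Lemma killedD p q : killed p -> killed q -> killed (fun x => p x + q x).
Proof.
move=> [bp hp] [bq hq]; split => [|k]; first exact: bddTD.
under eq_fun do rewrite mulrDr mulrDl.
by rewrite integralTD ?hp ?hq ?addr0//; exact: cint_killed.
Qed.

Lemma killedZ (z : R[i]) p : killed p -> killed (fun x => z * p x).
Proof.
move=> [bp hp]; split => [|k]; first exact: bddTZ.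
under eq_fun do rewrite mulrCA -mulrA.
by rewrite integralTZ ?hp ?mulr0//; exact: cint_killed.
Qed.

Lemma killed_expi j p : killed p -> killed (fun x => expi j x * p x).
Proof.
move=> [bp hp]; split => [|k]; first exact: bddTM.
rewrite -[RHS](hp (j + k)); congr integralT; apply/funext => x.
by rewrite expiD; ring.
Qed.

(** A trigonometric polynomial with values in [0, 1], below 1/2 exactly on the
    open arc ]0, 2 r[. *)
Definition arc (r x : R) : R := 2^-1 + (cos r - cos (x - r)) / 4.

Lemma arc_bound r x : 0 <= arc r x <= 1.
Proof.
have := cos_le1 r; have := cos_geN1 r.
have := cos_le1 (x - r); have := cos_geN1 (x - r); rewrite /arc; lra.
Qed.

Lemma arcE r x : real_complex R (arc r x) =
  real_complex R (2^-1 + cos r / 4) +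
  (Complex (- cos r / 8) (sin r / 8) * expi 1 x +
   Complex (- cos r / 8) (- sin r / 8) * expi (- 1) x).
Proof.
rewrite /arc cosB; apply: complexP; rewrite ?ReD ?ImD ?ReM ?ImM /=.
- by rewrite rmorphN /= !mulN1r !mul1r cosN sinN; field.
- by rewrite rmorphN /= !mulN1r !mul1r cosN sinN; field.
Qed.

Lemma eq_killed p q : p =1 q -> killed p -> killed q.
Proof. by move=> /funext ->. Qed.

Lemma killed_arc r p : killed p -> killed (fun x => real_complex R (arc r x) * p x).
Proof.
move=> kp; have k0 := killedZ (real_complex R (2^-1 + cos r / 4)) kp.
have k1 := killedZ (Complex (- cos r / 8) (sin r / 8)) (killed_expi 1 kp).
have k2 := killedZ (Complex (- cos r / 8) (- sin r / 8)) (killed_expi (- 1) kp).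
apply: eq_killed (killedD k0 (killedD k1 k2)) => x.
by rewrite arcE; ring.
Qed.

Lemma killed_arcX r n p : killed p ->
  killed (fun x => real_complex R (arc r x ^+ n) * p x).
Proof.
move=> kp; elim: n => [|n /(killed_arc r)].
  by apply: eq_killed kp => x; rewrite expr0 mul1r.
by apply: eq_killed => x; rewrite exprS rmorphM mulrA.
Qed.

(** Hence f is orthogonal to the step polynomials of an arc, which approximate the
    indicator function of that arc. *)
Lemma killed_step r n p : killed p ->
  killed (fun x => real_complex R (step_poly n (arc r x)) * p x).
Proof.
rewrite /step_poly => kp; elim: (2 ^ n)%N => [|m ih].
  by apply: eq_killed kp => x; rewrite expr0 mul1r.
apply: eq_killed (killedD ih (killedZ (-1) (killed_arcX r n ih))) => x.
by rewrite exprS rmorphM rmorphB rmorph1; ring.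
Qed.

Hypothesis f_killed : killed (fun=> 1).

Lemma Rintegral_step r n :
  Rintegral mu A (fun x => complex.Re (f x) * step_poly n (arc r x)) = 0 /\
  Rintegral mu A (fun x => complex.Im (f x) * step_poly n (arc r x)) = 0.
Proof.
have [_ /(_ 0)] := killed_step r n f_killed.
rewrite /integralT => -[h1 h2]; rewrite -{1}h1 -h2; split.
- congr Rintegral; apply/funext => x.
  by rewrite expi0 !mulr1 ReM /= mulr0 subr0.
- congr Rintegral; apply/funext => x.
  by rewrite expi0 !mulr1 ImM /= mulr0 add0r mulrC.
Qed.

End FourierUniqueness.

Section FourierUniquenessTheorem.
Context {R : realType}.
Local Notation mu := (@lebesgue_measure R).
Local Notation A := (@angles R).
Implicit Types (g : R -> R).

Lemma anglesP (x : R) : A x <-> (0 <= x <= 2 * pi).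
Proof. by rewrite /angles /= in_itv. Qed.

Lemma ae_neq (a : R) : {ae mu, forall x, x <> a}.
Proof.
exists [set a]; split; [exact: measurable_set1|exact: lebesgue_measure_set1|].
by move=> x /= /contrapT.
Qed.

Lemma continuous_arc (r : R) : continuous (arc r).
Proof.
move=> x; apply: cvgD; first exact: cvg_cst.
apply: cvgM; last exact: cvg_cst.
apply: cvgB; first exact: cvg_cst.
apply: (@continuous_comp _ _ _ (fun y => y - r) cos); last exact: continuous_cos.
by apply: cvgB; [exact: cvg_id|exact: cvg_cst].
Qed.

Lemma measurable_step_arc n (r : R) :
  measurable_fun A (fun x => step_poly n (arc r x)).
Proof.
have ma : measurable_fun A (arc r).
  apply: measurable_funTS; apply: continuous_measurable_fun.
  exact: continuous_arc.
apply: measurable_funX; apply: measurable_funB; first exact: measurable_cst.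
exact: measurable_funX.
Qed.

Lemma step_arc_cvg (r x : R) : 0 < r < pi -> A x ->
  x <> 0 -> x <> 2 * r -> x <> 2 * pi ->
  (fun n => step_poly n (arc r x)) @ \oo --> (\1_(`[0, 2 * r]%classic) x : R).
Proof.
move=> rp /anglesP/andP[x0 x2] /eqP n0 /eqP nr /eqP np.
have xp : 0 < x by rewrite lt_neqAle eq_sym n0.
have xq : x < 2 * pi by rewrite lt_neqAle np.
have /andP[a0 a1] := arc_bound r x.
have [xr|xr] := ltP x (2 * r).
- rewrite indicE mem_set/=; last by rewrite in_itv/= x0 ltW.
  apply: step_poly_cvg1 => //.
  have := @cos_arc_inside _ r x rp; rewrite xp xr => /(_ isT).
  by rewrite /arc; lra.
- have rx : 2 * r < x by rewrite lt_neqAle eq_sym nr.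
  rewrite indicE memNset/=; last by rewrite in_itv/= x0 leNgt rx.
  apply: step_poly_cvg0 => //.
  have := @cos_arc_outside _ r x rp; rewrite rx xq => /(_ isT).
  by rewrite /arc; lra.
Qed.

(** Dominated convergence: the step polynomials of the arc tend boundedly to the
    indicator function of [0, z] outside three points. *)
Lemma Rintegral_prefix0 g : mu.-integrable A (EFin \o g) ->
  (forall r n, Rintegral mu A (fun x => g x * step_poly n (arc r x)) = 0) ->
  forall z, 0 < z < 2 * pi -> Rintegral mu (`[0, z]%classic) g = 0.
Proof.
move=> ig hg z /andP[z0 zp]; set r := z / 2.
have zE : z = 2 * r by rewrite /r; field.
have rp : 0 < r < pi by rewrite /r; lra.
have mg : measurable_fun A g by apply/measurable_EFinP; exact: (measurable_int mu ig).
have sP n x : `|step_poly n (arc r x)| <= 1.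
  have /andP[h0 h1] := step_poly_bound n (arc_bound r x).
  by rewrite ger0_norm.
have mP : measurable_fun A (\1_(`[0, z]%classic) : R -> R).
  have mI : @measurable _ (measurableTypeR R) `[0, z]%classic.
    exact: measurable_itv.
  exact: (measurable_indic mI).
have iS n : mu.-integrable A (EFin \o (fun x => g x * step_poly n (arc r x))).
  apply: (@integrable_le _ _ (fun x => `|g x|)).
  - by apply: measurable_funM => //; exact: measurable_step_arc.
  - exact: integrable_norm.
  - by move=> x _; rewrite normrM ler_piMr.
have mf : measurable_fun A (EFin \o (fun x => g x * \1_(`[0, z]%classic) x)).
  by apply/measurable_EFinP; exact: measurable_funM.
have cv : {ae mu, forall x, A x ->
    (fun n => (g x * step_poly n (arc r x))%:E) @ \oo -->
    (EFin \o (fun x => g x * \1_(`[0, z]%classic) x)) x}.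
  filter_upwards [(ae_neq 0), (ae_neq (2 * r)), (ae_neq (2 * pi))]
    => x /= n1 n2 n3 Ax.
  apply: cvg_EFin; first exact: nearW.
  apply: cvgM; first exact: cvg_cst.
  by rewrite zE; exact: step_arc_cvg.
have bd : {ae mu, forall x n, A x ->
    (`|(g x * step_poly n (arc r x))%:E| <= (EFin \o (fun x => `|g x|%R)) x)%E}.
  by apply: aeW => x n _; rewrite lee_fin normrM ler_piMr.
have [ifz _ cI] := dominated_convergence measurable_angles
  (fun n => measurable_int mu (iS n)) mf cv (integrable_norm ig) bd.
have I0 : (\int[mu]_(x in A) (g x * \1_(`[0, z]%classic) x)%:E = 0)%E.
  have e0 n : (\int[mu]_(x in A) (g x * step_poly n (arc r x))%:E = 0)%E.
    rewrite -[LHS]fineK; first by congr EFin; exact: hg.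
    exact: (integrable_fin_num measurable_angles (iS n)).
  apply: (cvg_unique _ cI); first exact: ereal_hausdorff.
  rewrite (_ : (fun _ => _) = (fun=> 0%E)); first exact: cvg_cst.
  by apply/funext => n /=; exact: e0.
rewrite (_ : `[0, z]%classic = A `&` `[0, z]%classic); last first.
  apply/seteqP; split => [x|x []//] /=.
  rewrite in_itv/= => /andP[x0 xz]; split; last by rewrite x0.
  by apply/anglesP; rewrite x0 (le_trans xz)// ltW.
rewrite Rintegral_mkcondr /Rintegral -[RHS](congr1 fine I0); congr fine.
apply: eq_integral => x _; rewrite /patch indicE.
by case: ifP => _; rewrite ?mulr1 ?mulr0.
Qed.

(** All primitives of g vanish, and at almost every point g is the derivative of
    its primitive. *)
Lemma step_orth_ae0 g : mu.-integrable A (EFin \o g) ->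
  (forall r n, Rintegral mu A (fun x => g x * step_poly n (arc r x)) = 0) ->
  {ae mu, forall x, A x -> g x = 0}.
Proof.
move=> ig hg; have F0 := Rintegral_prefix0 ig hg.
have iT : mu.-integrable setT (EFin \o (g \_ A)).
  have := (@integrable_mkcond _ _ _ mu A (EFin \o g) measurable_angles).1 ig.
  by rewrite restrict_EFin.
have iy (y : R) : mu.-integrable [set` Interval (BLeft 0) (BRight y)]
    (EFin \o (g \_ A)).
  by apply: integrableS iT => //; exact: measurable_itv.
have loc := integrable_locally_restrict measurable_angles ig.
have ftc := FTC1 iy loc.
filter_upwards [ftc, (ae_neq 0), (ae_neq (2 * pi))] => x /= h n0 np Ax.
have /andP[x0 x2] := (anglesP x).1 Ax.
have xp : 0 < x by rewrite lt_neqAle eq_sym x0 andbT; exact/eqP.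
have xq : x < 2 * pi by rewrite lt_neqAle x2 andbT; exact/eqP.
have [|_] := h; first by rewrite lte_fin.
rewrite patchE mem_set// => <-; rewrite derive1E.
rewrite (@near_eq_derive _ _ _ _ (fun=> 0)); first exact: derive_cst.
near=> y; transitivity (Rintegral mu (`[0, y]%classic) g); last first.
  apply: F0; apply/andP; split; near: y; [exact: lt_nbhsr|exact: lt_nbhsl].
apply: eq_Rintegral => t /[!inE] /= /[!in_itv]/= /andP[t0 ty].
rewrite patchE mem_set//; apply/anglesP; rewrite t0 (le_trans ty)// ltW//.
near: y; exact: lt_nbhsl.
Unshelve. all: by end_near. Qed.

(** Completeness of the trigonometric system: a function orthogonal to all
    exponentials is orthogonal to all step polynomials. *)
Theorem fourier_unique (f : Tfun R) : in_L2 f -> (forall k, fourier f k = 0) ->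
  eqT f (fun=> 0).
Proof.
move=> f2 hf.
have fk : killed f (fun=> 1).
  split; first exact: bddT_cst.
  move=> k; have /eqP := hf (- k).
  rewrite /fourier /inner mulf_eq0 => /orP[|/eqP].
    rewrite (_ : 0 = real_complex R 0)// => /eqP /(congr1 (@complex.Re R)) /=.
    by move/eqP; rewrite invr_eq0 (gt_eqF pi2_gt0).
  move=> <-; congr integralT; apply/funext => x.
  by rewrite conjc_expi opprK mulr1.
have [ir ii] := cint_L2 f2.
have hr := step_orth_ae0 ir (fun r n => (Rintegral_step f2 fk r n).1).
have hi := step_orth_ae0 ii (fun r n => (Rintegral_step f2 fk r n).2).
filter_upwards [hr, hi] => x /= h1 h2 Ax.
by apply: complexP; [exact: h1|exact: h2].
Qed.

End FourierUniquenessTheorem.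

(** * The Hardy space and the Szego projector *)

Section ExponentialOrthogonality.
Context {R : realType}.
Local Notation mu := (@lebesgue_measure R).
Local Notation A := (@angles R).

Lemma Rintegral_angles_derive (f F : R -> R) : continuous f ->
  (forall x : R, is_derive x 1 F (f x)) ->
  Rintegral mu A f = F (2 * pi) - F 0.
Proof.
move=> cf dF.
have cF : continuous F.
  move=> x; apply: differentiable_continuous.
  by apply/derivable1_diffP; have [] := dF x.
rewrite /Rintegral /angles (@continuous_FTC2 R f F)//.
- exact: pi2_gt0.
- exact: continuous_subspaceT.
- split.
  + by move=> x _; have [] := dF x.
  + by apply: cvg_at_right_filter; exact: cF.
  + by apply: cvg_at_left_filter; exact: cF.
- by move=> x _; rewrite derive1E; have [_ ->] := dF x.
Qed.

Lemma expi_nat (n : nat) (x : R) : expi n%:Z x = expi 1 x ^+ n.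
Proof.
elim: n => [|n ih]; first by rewrite expi0.
by rewrite -addn1 PoszD expiD ih addn1 exprSr.
Qed.

Lemma expi_2pi (k : int) : expi k (2 * pi) = 1 :> R[i].
Proof.
have e1 : expi 1 (2 * pi) = 1 :> R[i].
  by rewrite /expi mul1r mulr_natl cos2pi sin2pi.
have en (n : nat) : expi n%:Z (2 * pi) = 1 :> R[i].
  by rewrite expi_nat e1 expr1n.
case: k => n; first exact: en.
by rewrite NegzE -conjc_expi en conjc1.
Qed.

(** Both parts have periodic primitives. *)
Lemma integralT_expi (k : int) : k != 0 -> integralT (@expi R k) = 0.
Proof.
move=> k0; have c0 : k%:~R != 0 :> R by rewrite intr_eq0.
have [e1 e2] : cos (k%:~R * (2 * pi)) = 1 :> R /\ sin (k%:~R * (2 * pi)) = 0 :> R.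
  by have := expi_2pi k; rewrite /expi => -[].
have cl : continuous (fun x : R => k%:~R * x).
  by move=> x; apply: cvgM; [exact: cvg_cst|exact: cvg_id].
have dl (x : R) : is_derive x 1 (fun x : R => k%:~R * x) k%:~R.
  have h : is_derive x 1 (fun x : R => k%:~R * x) (k%:~R *: 1) :=
    is_deriveZ k%:~R (is_derive_id x (1 : R)).
  by apply: (is_derive_eq h); rewrite /GRing.scale /= mulr1.
rewrite /integralT /expi /=; congr Complex.
- have cc : continuous (fun x : R => cos (k%:~R * x)).
    by move=> x; exact: (cvg_comp _ _ (cl x) (@continuous_cos R (k%:~R * x))).
  have dc (x : R) : is_derive x 1 (fun x => k%:~R^-1 * sin (k%:~R * x))
      (cos (k%:~R * x)).
    have h : is_derive x 1 (fun x => k%:~R^-1 * sin (k%:~R * x))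
      (k%:~R^-1 *: (cos (k%:~R * x) * k%:~R)) := is_deriveZ k%:~R^-1
      (is_derive1_comp (is_derive_sin (k%:~R * x)) (dl x)).
    by apply: (is_derive_eq h); rewrite /GRing.scale /= mulrCA mulVf ?mulr1.
  by rewrite (Rintegral_angles_derive cc dc) e2 mulr0 mulr0 sin0 mulr0 subr0.
- have cc : continuous (fun x : R => sin (k%:~R * x)).
    by move=> x; exact: (cvg_comp _ _ (cl x) (@continuous_sin R (k%:~R * x))).
  have dc (x : R) : is_derive x 1 (fun x => - k%:~R^-1 * cos (k%:~R * x))
      (sin (k%:~R * x)).
    have h : is_derive x 1 (fun x => - k%:~R^-1 * cos (k%:~R * x))
      (- k%:~R^-1 *: (- sin (k%:~R * x) * k%:~R)) := is_deriveZ (- k%:~R^-1)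
      (is_derive1_comp (is_derive_cos (k%:~R * x)) (dl x)).
    apply: (is_derive_eq h); rewrite /GRing.scale /=.
    by rewrite !mulNr mulrN opprK mulrCA mulVf ?mulr1.
  by rewrite (Rintegral_angles_derive cc dc) e1 mulr0 cos0 subrr.
Qed.

End ExponentialOrthogonality.

Section Hardy.
Context {R : realType}.
Implicit Types (f g : Tfun R) (x y s : L2 R) (j k : int).

Lemma coef_key : {c : L2 R -> int -> R[i] |
  forall x k, c x k = ip x (cls (expi k))}.
Proof. by exists (fun x k => ip x (cls (expi k))). Qed.
Definition coef := sval coef_key.

Lemma coef_ip x k : coef x k = ip x (cls (expi k)).
Proof. exact: svalP coef_key x k. Qed.

Lemma coef_cls f k : in_L2 f -> coef (cls f) k = fourier f k.
Proof. by move=> f2; rewrite coef_ip ip_cls. Qed.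

Lemma coef_rep x k : fourier (rep x) k = coef x k.
Proof. by rewrite -[in RHS](repK x) coef_cls. Qed.

Lemma coefD x y k : coef (x + y) k = coef x k + coef y k.
Proof. by rewrite !coef_ip ipDl. Qed.
Lemma coefZ (a : R[i]) x k : coef (a *: x) k = a * coef x k.
Proof. by rewrite !coef_ip ipZl. Qed.
Lemma coefB x y k : coef (x - y) k = coef x k - coef y k.
Proof. by rewrite !coef_ip ipBl. Qed.
Lemma coef0 k : coef 0 k = 0.
Proof. by rewrite coef_ip ip0l. Qed.

(** Identities between operators are proved below by comparing Fourier
    coefficients. *)
Lemma L2_ext x y : (forall k, coef x k = coef y k) -> x = y.
Proof.
move=> h; apply/eqP; rewrite -subr_eq0; apply/eqP; apply: L2_eqT.
apply: eqT_trans (eqT_sym (@rep_zero R)).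
apply: fourier_unique => // k.
by rewrite coef_rep coefB h subrr.
Qed.

Definition hardy x := forall k, k < 0 -> coef x k = 0.

Lemma hardyP x : hardy x <-> in_L2plus (rep x).
Proof.
split=> [h|[_ h] k k0]; last by rewrite -coef_rep h.
by split=> // k k0; rewrite coef_rep h.
Qed.

Lemma hardy_cls f : in_L2plus f -> hardy (cls f).
Proof. by move=> [f2 h] k k0; rewrite coef_cls// h. Qed.

Lemma hardyDZ (a : R[i]) x y : hardy x -> hardy y -> hardy (a *: x + y).
Proof. by move=> hx hy k k0; rewrite coefD coefZ hx// hy// mulr0 add0r. Qed.

Lemma hardy0 : hardy 0. Proof. by move=> k _; rewrite coef0. Qed.
Lemma hardyB x y : hardy x -> hardy y -> hardy (x - y).
Proof. by move=> hx hy k k0; rewrite coefB hx// hy// subrr. Qed.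

Lemma hardy_closed (s : nat -> L2 R) y (c : R) : (forall n, hardy (s n)) ->
  (forall n, nrm (y - s n) <= c / 2 ^+ n) -> hardy y.
Proof.
move=> hs hy k k0; apply: normc_eq0; apply/eqP.
rewrite eq_le normc_ge0 andbT.
apply: (@le_dyadic _ _ _ (2 * c * nrm (cls (expi k)))) => n.
rewrite add0r -[coef y k](subr0) -(hs n k k0) -coefB coef_ip.
rewrite (le_trans (normc_ip_le _ _))// -!mulrA ler_pM2l//.
rewrite (le_trans (ler_wpM2r (nrm_ge0 _) (hy n)))//.
by rewrite -!mulrA (mulrC (nrm _)).
Qed.

Lemma hardy_expi k : 0 <= k -> hardy (cls (expi k)).
Proof.
move=> k0 j j0; rewrite coef_cls// /fourier /inner.
under eq_fun do rewrite conjc_expi -expiD.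
rewrite integralT_expi ?mulr0// subr_eq0; apply/eqP => e.
by move: k0; rewrite e leNgt j0.
Qed.

Lemma proj_key : {P : L2 R -> L2 R |
  forall x, hardy (P x) /\ forall s, hardy s -> ip (x - P x) s = 0}.
Proof.
apply: cid.
have h x : exists p, hardy p /\ forall s, hardy s -> ip (x - p) s = 0.
  have [p h1 h2] := orthogonal_projection hardy0 hardyDZ hardy_closed x.
  by exists p.
by have [P hP] := choice h; exists P.
Qed.
Definition proj := sval proj_key.
Local Notation P := proj.

Lemma hardy_proj x : hardy (P x).
Proof. by have [] := svalP proj_key x. Qed.
Hint Resolve hardy_proj : core.

Lemma proj_orth x s : hardy s -> ip (x - P x) s = 0.
Proof. by have [_] := svalP proj_key x; apply. Qed.

Lemma proj_unique x p : hardy p -> (forall s, hardy s -> ip (x - p) s = 0) ->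
  P x = p.
Proof.
move=> hp hs; apply/eqP; rewrite -subr_eq0; apply/eqP/ip_eq0.
have hd : hardy (P x - p) by exact: hardyB.
have e : P x - p = (x - p) - (x - P x).
  by rewrite opprB [RHS]addrC addrA subrK.
by rewrite {1}e ipBl hs// proj_orth// subrr.
Qed.

Lemma proj_hardy x : hardy x -> P x = x.
Proof. by move=> hx; apply: proj_unique => // s _; rewrite subrr ip0l. Qed.

Lemma proj_idem x : P (P x) = P x. Proof. exact: proj_hardy. Qed.

Lemma projDZ (a : R[i]) x y : P (a *: x + y) = a *: P x + P y.
Proof.
apply: proj_unique => [|s hs]; first exact: hardyDZ.
rewrite opprD addrACA -scalerBr ipDl ipZl !proj_orth//.
by rewrite mulr0 addr0.
Qed.

HB.instance Definition _ := GRing.isLinear.Build R[i] (L2 R) (L2 R) *:%R proj projDZ.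

Lemma coef_proj x k : coef (P x) k = if 0 <= k then coef x k else 0.
Proof.
case: ifPn => [k0|]; last by rewrite -ltNge => k0; exact: hardy_proj.
apply/eqP; rewrite eq_sym -subr_eq0 -coefB coef_ip proj_orth//.
exact: hardy_expi.
Qed.

Lemma ip_proj x y : ip (P x) y = ip x (P y).
Proof.
have h u s : hardy s -> ip u s = ip (P u) s.
  by move=> hs; apply/eqP; rewrite -subr_eq0 -ipBl proj_orth.
by rewrite [RHS]h// (ipJ y) [in RHS](ipJ (P y)) h.
Qed.

Lemma nrm_proj x : nrm (P x) <= nrm x.
Proof.
have [z|n0] := eqVneq (nrm (P x)) 0; first by rewrite z nrm_ge0.
have p0 : 0 < nrm (P x) by rewrite lt_neqAle eq_sym n0 nrm_ge0.
rewrite -(ler_pM2r p0) -expr2 sqr_nrm ip_proj proj_idem.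
exact: cauchy_schwarz.
Qed.

(** The chosen representative that defines Pi is a genuine projection, because the
    orthogonal projection exists; on classes it is therefore the operator proj. *)
Lemma Pi_proj f : in_L2 f -> in_L2plus (Pi f) /\ cls (Pi f) = P (cls f).
Proof.
move=> f2.
have [g2 go] : is_proj f (Pi f).
  rewrite /Pi; apply: (xgetPex (0 : {classic (Tfun R)})).
  exists (rep (P (cls f))); split; first exact/hardyP.
  move=> h [h2 hh]; rewrite -(proj_orth (cls f) (hardy_cls (conj h2 hh))).
  rewrite ipE; apply: inner_ae => //.
  - exact: in_L2B.
  - filter_upwards [(repB (cls f) (P (cls f))), (rep_cls f2)] => t h1 h3 At.
    by rewrite h1// h3.
  - exact/eqT_sym/rep_cls.
split=> //; apply/esym/proj_unique; first exact: hardy_cls.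
move=> s hs; have [g3 _] := g2.
by rewrite -clsB// -(repK s) ip_cls ?go//; [exact/hardyP|exact: in_L2B].
Qed.

End Hardy.
#[global] Hint Resolve hardy_proj : core.

(** * Multiplication, Toeplitz and Hankel operators *)

Section Operators.
Context {R : realType}.
Implicit Types (f g u v a : Tfun R) (x y h : L2 R) (j k : int).
Local Notation P := (@proj R).

Definition conjL2 x : L2 R := cls (fun t => conjc (rep x t)).

Definition mulL2 f x : L2 R := cls (fun t => f t * rep x t).
Local Notation cj := conjL2.
Local Notation M := mulL2.

Lemma clsP x : exists2 f, in_L2 f & x = cls f.
Proof. by exists (rep x) => //; rewrite repK. Qed.

Lemma eq_cls f g : f =1 g -> cls f = cls g.
Proof. by move=> /funext ->. Qed.

Lemma conj_cls f : in_L2 f -> cj (cls f) = cls (fun t => conjc (f t)).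
Proof.
move=> f2; apply: cls_eq; [exact: in_L2J|exact: in_L2J|].
by filter_upwards [(rep_cls f2)] => t h At; rewrite h.
Qed.

Lemma mul_cls f g : bddT f -> in_L2 g -> M f (cls g) = cls (fun t => f t * g t).
Proof.
move=> bf g2; apply: cls_eq; [exact: in_L2_bddM|exact: in_L2_bddM|].
by filter_upwards [(rep_cls g2)] => t h At; rewrite h.
Qed.

Lemma conjL2D x y : cj (x + y) = cj x + cj y.
Proof.
have [f f2 ->] := clsP x; have [g g2 ->] := clsP y.
rewrite -clsD// !conj_cls//; last exact: in_L2D.
rewrite -clsD; [|exact: in_L2J|exact: in_L2J].
by apply: eq_cls => t; rewrite conjcD.
Qed.

Lemma conjL2Z (c : R[i]) x : cj (c *: x) = conjc c *: cj x.
Proof.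
have [f f2 ->] := clsP x; rewrite -clsZ// !conj_cls//; last exact: in_L2Z.
rewrite -clsZ; last exact: in_L2J.
by apply: eq_cls => t; rewrite conjcM.
Qed.

Lemma conjL2K x : cj (cj x) = x.
Proof.
have [f f2 ->] := clsP x; rewrite !conj_cls//; last exact: in_L2J.
by apply: eq_cls => t; rewrite conjcK.
Qed.

Lemma mulL2_linear f (c : R[i]) x y : bddT f ->
  M f (c *: x + y) = c *: M f x + M f y.
Proof.
move=> bf; have [p p2 ->] := clsP x; have [q q2 ->] := clsP y.
rewrite -clsZ// -clsD//; last exact: in_L2Z.
rewrite !mul_cls//; last by apply: in_L2D => //; exact: in_L2Z.
rewrite -clsZ; last exact: in_L2_bddM.
rewrite -clsD; [|exact/in_L2Z/in_L2_bddM|exact: in_L2_bddM].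
by apply: eq_cls => t; ring.
Qed.

Lemma mulL2D f x y : bddT f -> M f (x + y) = M f x + M f y.
Proof. by move=> bf; rewrite -[x]scale1r mulL2_linear// !scale1r. Qed.

Lemma mulL2_0 f : bddT f -> M f 0 = 0.
Proof.
by move=> bf; apply: (addrI (M f 0)); rewrite -mulL2D// !addr0.
Qed.

Lemma mulL2Z f (c : R[i]) x : bddT f -> M f (c *: x) = c *: M f x.
Proof. by move=> bf; rewrite -[c *: x]addr0 mulL2_linear// mulL2_0// addr0. Qed.

Lemma mulL2B f x y : bddT f -> M f (x - y) = M f x - M f y.
Proof. by move=> bf; rewrite mulL2D// -scaleN1r mulL2Z// scaleN1r. Qed.

Lemma mulL2_comp f g x : bddT f -> bddT g -> M f (M g x) = M (fun t => f t * g t) x.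
Proof.
move=> bf bg; have [p p2 ->] := clsP x.
rewrite !mul_cls//; [|exact: bddTM|exact: in_L2_bddM].
by apply: eq_cls => t; rewrite mulrA.
Qed.

Lemma mulL2_symbol (c : R[i]) f g x : bddT f -> bddT g ->
  M (fun t => c * f t + g t) x = c *: M f x + M g x.
Proof.
move=> bf bg; have [p p2 ->] := clsP x.
rewrite !mul_cls//; last by apply: bddTD => //; exact: bddTZ.
rewrite -clsZ; last exact: in_L2_bddM.
rewrite -clsD; [|exact/in_L2Z/in_L2_bddM|exact: in_L2_bddM].
by apply: eq_cls => t; ring.
Qed.

Lemma eq_mulL2 f g x : f =1 g -> M f x = M g x.
Proof. by move=> /funext ->. Qed.

Lemma mulL2_1 x : M (fun=> 1) x = x.
Proof.
rewrite -[RHS]repK; apply: eq_cls => t; exact: mul1r.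
Qed.

Lemma mulL2_expiV k x : M (expi k) (M (expi (- k)) x) = x.
Proof.
rewrite mulL2_comp// -[RHS]mulL2_1; apply: eq_mulL2 => t; exact: expiVr.
Qed.

Lemma mulL2_expiK k x : M (expi (- k)) (M (expi k) x) = x.
Proof. by have := mulL2_expiV (- k) x; rewrite opprK. Qed.

Lemma conj_mul f x : bddT f -> cj (M f x) = M (fun t => conjc (f t)) (cj x).
Proof.
move=> bf; have [p p2 ->] := clsP x.
rewrite mul_cls// !conj_cls//; last exact: in_L2_bddM.
rewrite mul_cls//; [|exact: bddTJ|exact: in_L2J].
by apply: eq_cls => t; rewrite conjcM.
Qed.

Lemma conj_mul_expi k x : cj (M (expi k) x) = M (expi (- k)) (cj x).
Proof. by rewrite conj_mul//; apply: eq_mulL2 => t; exact: conjc_expi. Qed.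

(** The adjoint of a multiplication is the multiplication by the conjugate. *)
Lemma ip_mul f x y : bddT f -> ip (M f x) y = ip x (M (fun t => conjc (f t)) y).
Proof.
move=> bf; have [p p2 ->] := clsP x; have [q q2 ->] := clsP y.
have bj := bddTJ bf; rewrite !mul_cls// !ip_cls//; try exact: in_L2_bddM.
rewrite /inner; congr (_ * integralT _); apply/funext => t.
by rewrite conjcM conjcK; ring.
Qed.

Lemma coef_mul_expi j x k : coef (M (expi j) x) k = coef x (k - j).
Proof.
rewrite !coef_ip ip_mul// mul_cls//; last exact: bddTJ.
congr ip; apply: eq_cls => t.
by rewrite conjc_expi -expiD addrC.
Qed.

Lemma coef_conj x k : coef (cj x) k = conjc (coef x (- k)).
Proof.
have [p p2 ->] := clsP x; rewrite conj_cls// !coef_cls//; last exact: in_L2J.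
rewrite /fourier -innerJ// /inner; congr (_ * integralT _); apply/funext => t.
by rewrite conjc_expi mulrC.
Qed.

Lemma nrm_mul_le f x (B : R) : bddT f -> (forall t, normc (f t) <= B) ->
  nrm (M f x) <= B * nrm x.
Proof.
move=> bf fB; have B0 : 0 <= B by exact: le_trans (normc_ge0 _) (fB 0).
rewrite -(@ler_pXn2r _ 2)// ?nnegrE ?mulr_ge0 ?nrm_ge0// exprMn.
rewrite -(ler_pM2l (@pi2_gt0 R)) [leRHS]mulrCA -!Rintegral_nrm.
have [m2 i2] := (in_L2P _).1 (rep_L2 x).
have [m1 i1] := (in_L2P _).1 (rep_L2 (M f x)).
have [m3 i3] := (in_L2P _).1 (in_L2_bddM bf (rep_L2 x)).
rewrite -RintegralZl//.
rewrite (@Rintegral_ae _ _ (fun t => normc (f t * rep x t) ^+ 2)).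
- apply: le_Rintegral => //; first exact: integrable_scale.
  move=> t _; rewrite normcM exprMn ler_wpM2r ?sqr_ge0//.
  by rewrite ler_pXn2r ?nnegrE ?normc_ge0.
- exact: cmeas_normc2.
- exact: cmeas_normc2.
- have h := rep_cls (in_L2_bddM bf (rep_L2 x)).
  by apply: filterS h => t h At; rewrite h.
Qed.

Lemma nrm_conj x : nrm (cj x) = nrm x.
Proof.
have [p p2 ->] := clsP x; rewrite conj_cls//.
have pj := in_L2J p2; rewrite !nrmE !ip_cls// !inner_selfE//.
by under eq_Rintegral do rewrite normc_conj.
Qed.

(** The antiunitary flip of the circle exchanges the Hardy space with its
    orthogonal complement. *)
Lemma flip_decomposition x :
  x = P x + cj (M (expi 1) (P (M (expi (- 1)) (cj x)))).
Proof.
apply: L2_ext => k; rewrite coefD coef_conj coef_mul_expi !coef_proj.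
rewrite coef_mul_expi coef_conj.
have -> : - (- k - 1 - - 1) = k by ring.
have [k0|k0] := leP 0 k.
- by rewrite ifF ?conjc0 ?addr0//; apply/negbTE; rewrite -ltNge; lia.
- by rewrite ifT ?conjcK ?add0r//; lia.
Qed.

Lemma proj_antihardy y : (forall k, 0 <= k -> coef y k = 0) -> P y = 0.
Proof.
move=> hy; apply: L2_ext => k; rewrite coef_proj coef0.
by case: ifP => // /hy.
Qed.

Lemma coef_conj_mul u k j : in_L2 u -> bddT u ->
  coef (M (fun t => conjc (u t)) (cls (expi k))) j =
  conjc (coef (cls u) (k - j)).
Proof.
move=> u2 bu; rewrite mul_cls//; last exact: bddTJ.
rewrite !coef_cls//; last by apply: in_L2_bddM => //; exact: bddTJ.
rewrite /fourier -innerJ// /inner; congr (_ * integralT _); apply/funext => t.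
by rewrite conjc_expi expiD; ring.
Qed.

(** By duality: multiplying a negative exponential by the conjugate of u leaves
    only negative frequencies, which are orthogonal to x. *)
Lemma hardy_mul u x : bddT u -> hardy (cls u) -> hardy x -> hardy (M u x).
Proof.
move=> bu hu hx k k0; rewrite coef_ip ip_mul//.
rewrite -(proj_hardy hx) ip_proj proj_antihardy ?(ipJ 0) ?ip0l ?conjc0// => j j0.
rewrite coef_conj_mul//; last exact: bddT_L2.
by rewrite hu ?conjc0//; lia.
Qed.

Lemma hardy_mul_expi k x : 0 <= k -> hardy x -> hardy (M (expi k) x).
Proof. by move=> k0; apply: hardy_mul => //; exact: hardy_expi. Qed.

(** The adjoint statement: multiplication by conj(u) preserves the orthogonal
    complement of the Hardy space. *)
Lemma proj_conj_mul u y : bddT u -> hardy (cls u) ->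
  P (M (fun t => conjc (u t)) (P y)) = P (M (fun t => conjc (u t)) y).
Proof.
move=> bu hu; have bj := bddTJ bu.
apply/esym/proj_unique => // s hs.
have -> : M (fun t => conjc (u t)) y - P (M (fun t => conjc (u t)) (P y)) =
  M (fun t => conjc (u t)) (y - P y) +
  (M (fun t => conjc (u t)) (P y) - P (M (fun t => conjc (u t)) (P y))).
  by rewrite mulL2B// addrA subrK.
rewrite ipDl (proj_orth _ hs) addr0 ip_mul//.
rewrite (@eq_mulL2 _ u); last by move=> t; rewrite conjcK.
by rewrite proj_orth//; exact: hardy_mul.
Qed.

(** The shifted Hankel operator of symbol u; the inner projector extends it from
    the Hardy space to the whole of L^2 by zero. *)
Definition hankel u x : L2 R := P (M (expi (- 1)) (M u (cj (P x)))).

Lemma hankelD u x y : bddT u -> hankel u (x + y) = hankel u x + hankel u y.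
Proof.
by move=> bu; rewrite /hankel linearD/= conjL2D !mulL2D// linearD.
Qed.

Lemma hankelZ u (c : R[i]) x : bddT u -> hankel u (c *: x) = conjc c *: hankel u x.
Proof.
by move=> bu; rewrite /hankel linearZ/= conjL2Z !mulL2Z// linearZ.
Qed.

Lemma hankel_symbol (c : R[i]) u v x : bddT u -> bddT v ->
  hankel (fun t => c * u t + v t) x = c *: hankel u x + hankel v x.
Proof.
by move=> bu bv; rewrite /hankel mulL2_symbol// mulL2_linear// projDZ.
Qed.

Lemma proj_hankel u x : P (hankel u x) = hankel u x.
Proof. exact: proj_idem. Qed.

Lemma nrm_hankel_le u x (B : R) : bddT u -> (forall t, normc (u t) <= B) ->
  nrm (hankel u x) <= B * nrm x.
Proof.
move=> bu uB; have B0 : 0 <= B by exact: le_trans (normc_ge0 _) (uB 0).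
rewrite (le_trans (nrm_proj _))//.
have := @nrm_mul_le (expi (-1)) (M u (cj (P x))) 1 (bddT_expi _) _.
rewrite mul1r => h; rewrite (le_trans (h _))//.
  by move=> t; rewrite normc_expi.
rewrite (le_trans (nrm_mul_le _ bu uB))// nrm_conj.
by rewrite ler_wpM2l// nrm_proj.
Qed.

(** A symbol acts through its Hardy projection only: against a nonnegative
    exponential, the conjugated argument can be moved to the other side, where it
    gives a Hardy function. This is how the projection of |u|^2, which may be
    unbounded, is traded for |u|^2 itself. *)
Lemma hankel_antihardy w x : bddT w -> P (cls w) = 0 -> hankel w x = 0.
Proof.
move=> bw w0; apply: proj_antihardy => j j0.
rewrite coef_ip; set y := P x; have [p p2 yE] := clsP y.
have hp : hardy (M (expi (1 + j)) y).
  by apply: hardy_mul_expi; [lia|exact: hardy_proj].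
have e0 : ip (cls w) (M (expi (1 + j)) y) = 0.
  by rewrite -(proj_hardy hp) -ip_proj w0 ip0l.
rewrite -[RHS]e0 yE conj_cls// !mul_cls//; try exact: in_L2J; last first.
  by apply: in_L2_bddM => //; exact: in_L2J.
rewrite !ip_cls//; try exact: in_L2_bddM; try exact: bddT_L2; last first.
  by apply: in_L2_bddM => //; apply: in_L2_bddM => //; exact: in_L2J.
rewrite /inner; congr (_ * integralT _); apply/funext => t.
by rewrite conjcM !conjc_expi opprD expiD; ring.
Qed.

Section LaxIdentities.
Variable u : Tfun R.
Hypotheses (bu : bddT u) (hu : hardy (cls u)).
Local Notation ub := (fun t => conjc (u t)).
Let bub : bddT ub := bddTJ bu.

(** Splitting the function e^{-ix} u conj(P x) with the flip decomposition
    gives the two terms. *)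
Lemma hankel_square x : hankel (fun t => u t * u t) x =
  P (M u (hankel u x)) + hankel u (P (M ub (P x))).
Proof.
rewrite /hankel -mulL2_comp//; set c := cj (P x).
have swap f g y : bddT f -> bddT g -> M f (M g y) = M g (M f y).
  by move=> bf bg; rewrite !mulL2_comp//; apply: eq_mulL2 => t; rewrite mulrC.
rewrite (swap (expi (- 1)))//; set g := M (expi (- 1)) (M u c).
rewrite [g in LHS]flip_decomposition mulL2D// linearD/=; congr (_ + _).
rewrite proj_idem (swap (expi (-1)))//; congr (P (M u _)).
rewrite conj_mul_expi; congr (M _ (cj (P _))).
by rewrite /g conj_mul_expi opprK mulL2_expiK conj_mul// /c conjL2K.
Qed.

(** Multiplication by conj(u) commutes with the projector up to projection. *)
Lemma hankel_modulus_left x :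
  hankel (fun t => u t * conjc (u t)) x = P (M ub (hankel u x)).
Proof.
rewrite /hankel proj_conj_mul//; congr P.
have bum : bddT (fun t => u t * conjc (u t)) by exact: bddTM.
have beu : bddT (fun t => conjc (u t) * expi (-1) t) by exact: bddTM.
by rewrite !mulL2_comp//; apply: eq_mulL2 => t; ring.
Qed.

(** Multiplication by u preserves the Hardy space, so that P fixes the argument
    u (P x). *)
Lemma hankel_modulus_right x :
  hankel (fun t => u t * conjc (u t)) x = hankel u (P (M u (P x))).
Proof.
rewrite /hankel proj_idem (proj_hardy (hardy_mul bu hu (hardy_proj x))).
by rewrite conj_mul// -mulL2_comp.
Qed.

(** The Lax pair of the equation i v = 2 J Pi(|u|^2) + conj(J) u^2: the
    generator is the Toeplitz operator of a = J conj(u) + conj(J) u. *)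
Lemma lax_pair (J : R[i]) v x : bddT v -> hardy (cls v) ->
  Complex 0 1 *: cls v = (2 * J) *: P (cls (fun t => u t * conjc (u t))) +
    conjc J *: cls (fun t => u t * u t) ->
  let a := fun t => J * conjc (u t) + conjc J * u t in
  Complex 0 1 *: hankel v x =
  P (M a (P (hankel u x))) + hankel u (P (M a (P x))).
Proof.
move=> bv hv ev a.
have buu : bddT (fun t => u t * u t) by exact: bddTM.
have bum : bddT (fun t => u t * conjc (u t)) by exact: bddTM.
pose b t := (2 * J) * (u t * conjc (u t)) + conjc J * (u t * u t).
pose w t := Complex 0 1 * v t + (-1) * b t.
have bb : bddT b by apply: bddTD; exact: bddTZ.
have w0 : hankel w x = 0.
  apply: hankel_antihardy; first by apply: bddTD; exact: bddTZ.
  have hs : hardy (cls (fun t => u t * u t)).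
    have u2 := bddT_L2 bu.
    by rewrite -mul_cls//; exact: hardy_mul.
  have m2 := bddT_L2 bum; have s2 := bddT_L2 buu; have v2 := bddT_L2 bv.
  have -> : cls w = Complex 0 1 *: cls v -
      ((2 * J) *: cls (fun t => u t * conjc (u t)) +
       conjc J *: cls (fun t => u t * u t)).
    rewrite -!clsZ// -clsD; [|exact: in_L2Z|exact: in_L2Z].
    rewrite -clsB; [|exact: in_L2Z|exact: bddT_L2].
    by apply: eq_cls => t; rewrite /w mulN1r.
  rewrite ev linearB/= !linearD/= !linearZ/= proj_idem.
  by rewrite !scalerN addrACA !subrr addr0.
have : Complex 0 1 *: hankel v x = hankel b x.
  move: w0; rewrite /w (@hankel_symbol _ v (fun t => -1 * b t))//; last exact: bddTZ.
  have -> : hankel (fun t => -1 * b t) x = - hankel b x.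
    have := @hankel_symbol (-1) b (fun=> 0) x bb (bddT_cst 0).
    have -> : hankel (fun=> 0) x = 0.
      by apply: hankel_antihardy; [exact: bddT_cst|rewrite cls0 linear0].
    by rewrite addr0 scaleN1r => <-; congr hankel; apply/funext => t; rewrite addr0.
  by move/eqP; rewrite subr_eq0 => /eqP.
move=> ->.
have -> : hankel b x = (2 * J) *: hankel (fun t => u t * conjc (u t)) x +
    conjc J *: hankel (fun t => u t * u t) x.
  rewrite /b (@hankel_symbol _ _ (fun t => conjc J * (u t * u t)))//; last exact: bddTZ.
  congr (_ + _).
  have := @hankel_symbol (conjc J) (fun t => u t * u t) (fun=> 0) x buu (bddT_cst 0).
  have -> : hankel (fun=> 0) x = 0.
    by apply: hankel_antihardy; [exact: bddT_cst|rewrite cls0 linear0].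
  by rewrite addr0 => <-; congr hankel; apply/funext => t; rewrite addr0.
have Pa y : P (M a y) = J *: P (M ub y) + conjc J *: P (M u y).
  have -> : M a y = J *: M ub y + conjc J *: M u y.
    rewrite /a (@mulL2_symbol _ _ (fun t => conjc J * u t))//; last exact: bddTZ.
    congr (_ + _); have := @mulL2_symbol (conjc J) u (fun=> 0) y bu (bddT_cst 0).
    have -> : M (fun=> 0) y = 0.
      by rewrite -cls0; apply: eq_cls => t; rewrite mul0r.
    by rewrite addr0 => <-; apply: eq_mulL2 => t; rewrite addr0.
  by rewrite linearD/= !linearZ.
rewrite !Pa proj_hankel hankelD// !hankelZ// conjcK.
rewrite -hankel_modulus_left -hankel_modulus_right hankel_square scalerDr.
rewrite mulr_natl mulr2n scalerDl -!addrA; congr (_ + _).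
by rewrite addrCA; congr (_ + _); rewrite addrC.
Qed.

End LaxIdentities.

(** A Toeplitz operator with real symbol is self-adjoint. *)
Lemma toeplitz_real a x : bddT a -> (forall t, conjc (a t) = a t) ->
  complex.Im (ip (P (M a (P x))) x) = 0.
Proof.
move=> ba ra; rewrite ip_proj; set y := P x.
have e : conjc (ip (M a y) y) = ip (M a y) y.
  by rewrite -ipJ [RHS]ip_mul//; congr ip; apply: eq_mulL2.
by have := congr1 (@complex.Im R) e; rewrite ImJ; lra.
Qed.

End Operators.

(** * Linear evolution equations with skew generators *)

Section Evolution.
Context {R : realType}.
Local Notation "r %:C" := (real_complex R r).
Implicit Types (x y : L2 R) (d t : R) (j n : nat).
Variables (I : R -> Prop) (C : R -> L2 R -> L2 R) (m L : R).
Hypothesis m0 : 0 <= m.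
Hypothesis L0 : 0 <= L.
Hypothesis C_linear : forall t (c : R[i]) x y, C t (c *: x + y) = c *: C t x + C t y.
Hypothesis C_bound : forall t x, I t -> nrm (C t x) <= m * nrm x.
Hypothesis C_lip : forall t t' x, I t -> I t' ->
  nrm (C t x - C t' x) <= L * `|t - t'| * nrm x.
Hypothesis C_skew : forall t x, I t -> complex.Re (ip (C t x) x) = 0.

Definition step d t x := x + d%:C *: C t x.

Fixpoint euler d t j x :=
  if j is i.+1 then step d (t + i%:R * d) (euler d t i x) else x.

Lemma nrmZr d x : nrm (d%:C *: x) = `|d| * nrm x.
Proof. by rewrite nrmZ normc_real. Qed.

Lemma gen_add t x y : C t (x + y) = C t x + C t y.
Proof. by rewrite -[x]scale1r C_linear !scale1r. Qed.

Lemma gen_zero t : C t 0 = 0.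
Proof. by apply: (addrI (C t 0)); rewrite -gen_add !addr0. Qed.

Lemma gen_sub t x y : C t (x - y) = C t x - C t y.
Proof. by apply/eqP; rewrite eq_sym subr_eq -gen_add subrK. Qed.

Lemma gen_scale t (c : R[i]) x : C t (c *: x) = c *: C t x.
Proof. by rewrite -[c *: x]addr0 C_linear gen_zero addr0. Qed.

Lemma stepD d t x y : step d t (x + y) = step d t x + step d t y.
Proof. by rewrite /step gen_add scalerDr addrACA. Qed.

Lemma stepB d t x y : step d t (x - y) = step d t x - step d t y.
Proof. by rewrite /step gen_sub scalerBr opprD addrACA. Qed.

Lemma eulerD d t j x y : euler d t j (x + y) = euler d t j x + euler d t j y.
Proof. by elim: j => //= j ->; rewrite stepD. Qed.

Lemma step_le d t x : I t -> nrm (step d t x) <= (1 + `|d| * m) * nrm x.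
Proof.
move=> It; rewrite (le_trans (nrmD _ _))// nrmZr mulrDl mul1r lerD2l.
by rewrite -mulrA ler_wpM2l// C_bound.
Qed.

(** Skewness makes the cross term of the square norm vanish, so that every Euler
    step expands the norm. This is all that is kept of unitarity: it gives the
    injectivity of the limit. *)
Lemma step_ge d t x : I t -> nrm x <= nrm (step d t x).
Proof.
move=> It; rewrite -(@ler_pXn2r _ 2)// ?nnegrE ?nrm_ge0// /step sqr_nrmD.
rewrite ipZr conjc_real Re_realM (ipJ (C t x)) ReJ C_skew// !mulr0 addr0.
by rewrite lerDl sqr_ge0.
Qed.

Lemma euler_le d t j x : (forall i, (i < j)%N -> I (t + i%:R * d)) ->
  nrm (euler d t j x) <= (1 + `|d| * m) ^+ j * nrm x.
Proof.
elim: j => [_|j ih hI] /=; first by rewrite expr0 mul1r.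
rewrite (le_trans (step_le _ _ (hI j _)))// exprS -mulrA.
by rewrite ler_wpM2l ?addr_ge0 ?mulr_ge0// ih// => i ij; apply: hI; exact: ltnW.
Qed.

Lemma euler_ge d t j x : (forall i, (i < j)%N -> I (t + i%:R * d)) ->
  nrm x <= nrm (euler d t j x).
Proof.
elim: j => [_|j ih hI] //=.
rewrite (le_trans _ (step_ge _ _ (hI j _)))// ih// => i ij.
by apply: hI; exact: ltnW.
Qed.

(** Discrete Gronwall inequality. *)
Lemma gronwall (e : nat -> R) (q b : R) J : 1 <= q -> 0 <= b -> e 0%N = 0 ->
  (forall j, (j < J)%N -> e j.+1 <= q * e j + b * q ^+ j) ->
  forall j, (j <= J)%N -> e j <= j%:R * b * q ^+ j.
Proof.
move=> q1 b0 e0 he; elim=> [_|j ih jJ]; first by rewrite e0 !mul0r.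
have q0 : 0 <= q by exact: le_trans q1.
rewrite (le_trans (he j jJ))// -natr1 mulrDl mul1r mulrDl.
apply: lerD.
  by rewrite exprS mulrCA ler_wpM2l// ih// ltnW.
by rewrite ler_wpM2l// ler_weXn2l.
Qed.

(** Two half steps differ from one step by a variation of the generator and by a
    term of second order, both of size d^2. *)
Lemma step_halving d t x : I t -> I (t + d / 2) ->
  nrm (step (d / 2) (t + d / 2) (step (d / 2) t x) - step d t x)
    <= d ^+ 2 / 4 * (L + m ^+ 2) * nrm x.
Proof.
move=> It It'; set h := d / 2; set t' := t + h.
have -> : step h t' (step h t x) - step d t x =
    h%:C *: (C t' x - C t x) + (h ^+ 2)%:C *: C t' (C t x).
  have -> : step d t x = x + h%:C *: C t x + h%:C *: C t x.
    rewrite /step -addrA -scalerDl -rmorphD; congr (_ + real_complex R _ *: _).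
    by rewrite /h; field.
  rewrite /step gen_add gen_scale scalerBr scalerDr scalerA -rmorphM -expr2.
  rewrite [X in X - _ = _](addrC (x + _)) opprD addrA addrK.
  by rewrite addrAC.
rewrite (le_trans (nrmD _ _))// !nrmZr.
have h1 := C_lip x It' It; have h2 := C_bound (C t x) It'.
have h3 := ler_wpM2l m0 (C_bound x It).
have dh : `|t' - t| = `|h| by rewrite /t' addrC addKr.
rewrite dh in h1; have := ler_wpM2l (normr_ge0 h) h1.
have := ler_wpM2l (normr_ge0 (h ^+ 2)) (le_trans h2 h3).
have -> : `|h ^+ 2| = d ^+ 2 / 4 by rewrite ger0_norm ?sqr_ge0// /h; field.
have hh : `|h| * `|h| = d ^+ 2 / 4.
  by rewrite -expr2 real_normK ?num_real// /h; field.
have -> : `|h| * (L * `|h| * nrm x) = d ^+ 2 / 4 * (L * nrm x).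
  by rewrite -hh; ring.
move: (d ^+ 2 / 4 * nrm _) (`|h| * nrm _) => a b ha hb.
have -> : d ^+ 2 / 4 * (L + m ^+ 2) * nrm x =
  d ^+ 2 / 4 * (L * nrm x) + d ^+ 2 / 4 * (m * (m * nrm x)) by ring.
by rewrite lerD.
Qed.

(** The local errors of step_halving accumulate linearly in the number of steps;
    with 2^n steps of size 2^-n the total is of size 2^-n. *)
Lemma euler_halving d t J x : (forall i, (i <= J.*2)%N -> I (t + i%:R * (d / 2))) ->
  nrm (euler (d / 2) t J.*2 x - euler d t J x)
    <= J%:R * (d ^+ 2 / 4 * (L + m ^+ 2) * nrm x) * (1 + `|d / 2| * m) ^+ J.*2.
Proof.
move=> hI; set q := 1 + `|d / 2| * m.
have q1 : 1 <= q by rewrite lerDl mulr_ge0.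
have q2 : 1 <= q ^+ 2 by rewrite exprn_ege1.
have half i : t + i%:R * d = t + i.*2%:R * (d / 2).
  by rewrite -muln2 natrM; congr (_ + _); field.
have -> : q ^+ J.*2 = (q ^+ 2) ^+ J by rewrite -exprM mul2n.
have c0 : 0 <= d ^+ 2 / 4 * (L + m ^+ 2).
  by rewrite mulr_ge0 ?divr_ge0 ?sqr_ge0// addr_ge0 ?sqr_ge0.
apply: (@gronwall (fun j => nrm (euler (d / 2) t j.*2 x - euler d t j x)) _ _ J) => //.
- by rewrite mulr_ge0 ?nrm_ge0.
- by rewrite /= subrr nrm0.
move=> j jJ; rewrite doubleS /=.
have It : I (t + j%:R * d) by rewrite half; apply: hI; rewrite leq_double ltnW.
have tE : t + j.*2%:R * (d / 2) = t + j%:R * d by rewrite half.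
have tE' : t + j.*2.+1%:R * (d / 2) = t + j%:R * d + d / 2.
  by rewrite -tE -natr1; ring.
have It' : I (t + j%:R * d + d / 2).
  by rewrite -tE'; apply: hI; lia.
rewrite tE tE'; set s := t + j%:R * d in It It' *.
set a := euler (d / 2) t j.*2 x; set b := euler d t j x.
have -> : step (d / 2) (s + d / 2) (step (d / 2) s a) - step d s b =
  step (d / 2) (s + d / 2) (step (d / 2) s (a - b)) +
  (step (d / 2) (s + d / 2) (step (d / 2) s b) - step d s b).
  by rewrite !stepB addrA subrK.
rewrite (le_trans (nrmD _ _))// lerD//.
  rewrite (le_trans (step_le _ _ It'))// expr2 -mulrA.
  by rewrite ler_wpM2l ?(le_trans ler01)// step_le.
have := step_halving b It It'; move: (_ * (L + _)) c0 => k c0 sh.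
rewrite (le_trans sh)// -[leRHS]mulrA ler_wpM2l// [leRHS]mulrC.
have hb : nrm b <= (1 + `|d| * m) ^+ j * nrm x.
  apply: euler_le => i ij; rewrite half; apply: hI.
  by rewrite leq_double (leq_trans (ltnW ij))// ltnW.
rewrite (le_trans hb)// ler_wpM2r ?nrm_ge0//; apply: lerXn2r.
- by rewrite nnegrE addr_ge0 ?mulr_ge0.
- by rewrite nnegrE sqr_ge0.
rewrite /q sqrrD expr1n mul1r -addrA lerD2l.
have -> : `|d / 2| * m *+ 2 = `|d| * m.
  have h2 : `|2^-1 : R| = 2^-1 by rewrite ger0_norm.
  by rewrite normrM h2 -mulr_natr; field.
by rewrite lerDl sqr_ge0.
Qed.


(** A family of operators that every Euler step intertwines up to second order
    is intertwined by the Euler scheme up to first order. *)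
Lemma euler_intertwine (G : R -> L2 R -> L2 R) c d t J x :
  (forall s y z, G s (y - z) = G s y - G s z) -> 0 <= c ->
  (forall s y, I s -> I (s + d) ->
     nrm (G (s + d) (step d s y) - step d s (G s y)) <= c * d ^+ 2 * nrm y) ->
  (forall i, (i <= J)%N -> I (t + i%:R * d)) ->
  nrm (G (t + J%:R * d) (euler d t J x) - euler d t J (G t x))
    <= J%:R * (c * d ^+ 2 * nrm x) * (1 + `|d| * m) ^+ J.
Proof.
move=> GB c0 hG hI; set q := 1 + `|d| * m.
have q1 : 1 <= q by rewrite lerDl mulr_ge0.
have cd : 0 <= c * d ^+ 2 by rewrite mulr_ge0 ?sqr_ge0.
apply: (@gronwall (fun j => nrm (G (t + j%:R * d) (euler d t j x)
  - euler d t j (G t x))) _ _ J) => //.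
- by rewrite mulr_ge0 ?nrm_ge0.
- by rewrite /= mul0r addr0 subrr nrm0.
move=> j jJ /=.
have It : I (t + j%:R * d) by apply: hI; exact: ltnW.
have It' : I (t + j%:R * d + d).
  by have := hI j.+1 jJ; rewrite -natr1 mulrDl mul1r addrA.
have -> : t + j.+1%:R * d = t + j%:R * d + d by rewrite -natr1; ring.
set s := t + j%:R * d in It It' *.
set a := euler d t j x; set b := euler d t j (G t x).
have -> : G (s + d) (step d s a) - step d s b =
  step d s (G s a - b) + (G (s + d) (step d s a) - step d s (G s a)).
  by rewrite stepB [RHS]addrC addrA subrK.
rewrite (le_trans (nrmD _ _))// lerD ?step_le//.
rewrite (le_trans (hG _ _ It It'))// -[leRHS]mulrA ler_wpM2l// [leRHS]mulrC.
by apply: euler_le => i ij; apply: hI; exact: leq_trans (ltnW ij) (ltnW jJ).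
Qed.

Variables t0 t1 : R.
Hypothesis segment : forall n i, (i <= 2 ^ n)%N ->
  I (t0 + i%:R * ((t1 - t0) / 2 ^+ n)).

Local Notation delta n := ((t1 - t0) / 2 ^+ n).
Let B := expR (`|t1 - t0| * m).

(** The amplification factors stay bounded as the subdivision is refined, by the
    inequality 1 + y <= exp y. *)
Lemma growth_le n : (1 + `|delta n| * m) ^+ (2 ^ n) <= B.
Proof.
have -> : B = expR (`|delta n| * m) ^+ (2 ^ n).
  rewrite -expRM_natl /B; congr expR.
  rewrite normrM normfV (ger0_norm (ltW (expr2_gt0 n))) natrX.
  by field; rewrite gt_eqF.
apply: lerXn2r; rewrite ?nnegrE ?expR_ge0 ?addr_ge0 ?mulr_ge0//.
exact: expR_ge1Dx.
Qed.

Lemma growth_ge0 : 0 <= B. Proof. exact: expR_ge0. Qed.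

Definition dyadic n x := euler (delta n) t0 (2 ^ n) x.

Lemma dyadic_cauchy x n : nrm (dyadic n.+1 x - dyadic n x) <=
  (t1 - t0) ^+ 2 * (L + m ^+ 2) * nrm x * B / 2 ^+ n.
Proof.
have hd : delta n.+1 = delta n / 2 by rewrite exprS; field; rewrite gt_eqF.
rewrite /dyadic hd expnS mul2n.
have hI i : (i <= (2 ^ n).*2)%N -> I (t0 + i%:R * (delta n / 2)).
  by rewrite -hd -mul2n -expnS; exact: segment.
rewrite (le_trans (euler_halving _ hI))//.
have Lm : 0 <= (L + m ^+ 2) * nrm x by rewrite mulr_ge0 ?nrm_ge0 ?addr_ge0 ?sqr_ge0.
have := growth_le n.+1; rewrite hd expnS mul2n => h.
apply: le_trans (ler_wpM2l _ h) _.
  by rewrite mulr_ge0// -mulrA mulr_ge0// mulr_ge0 ?sqr_ge0.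
have -> : (2 ^ n)%:R * (delta n ^+ 2 / 4 * (L + m ^+ 2) * nrm x) * B =
  4^-1 * ((t1 - t0) ^+ 2 * (L + m ^+ 2) * nrm x * B / 2 ^+ n).
  by rewrite natrX; field; rewrite gt_eqF.
rewrite ler_piMl//; last lra.
by rewrite divr_ge0 ?(ltW (expr2_gt0 n))// mulr_ge0 ?growth_ge0// -mulrA mulr_ge0 ?sqr_ge0.
Qed.

(** The product integral of the generators: it expands the norm and carries
    every intertwined family from one end of the segment to the other. *)
Theorem evolution : exists U : L2 R -> L2 R,
  [/\ forall x y, U (x + y) = U x + U y,
      forall x, nrm x <= nrm (U x)
    & forall (G : R -> L2 R -> L2 R) c b, 0 <= c -> 0 <= b ->
        (forall s y z, G s (y - z) = G s y - G s z) ->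
        (forall y, nrm (G t1 y) <= b * nrm y) ->
        (forall s d y, I s -> I (s + d) ->
          nrm (G (s + d) (step d s y) - step d s (G s y)) <= c * d ^+ 2 * nrm y) ->
        forall x, G t1 (U x) = U (G t0 x)].
Proof.
pose K x := 2 * ((t1 - t0) ^+ 2 * (L + m ^+ 2) * nrm x * B).
have ex x : exists y, forall n, nrm (y - dyadic n x) <= K x / 2 ^+ n.
  exact: L2_complete (dyadic_cauchy x).
have [U hU] := choice ex.
have eq_of z w : (exists k, forall n, nrm (z - w) <= k / 2 ^+ n) -> z = w.
  move=> [k hk]; apply/eqP; rewrite -subr_eq0; apply/eqP/nrm0_eq0/eqP.
  by rewrite eq_le nrm_ge0 andbT; apply: (@le_dyadic _ _ _ k) => n; rewrite add0r.
have seg' n i : (i < 2 ^ n)%N -> I (t0 + i%:R * delta n).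
  by move=> h; apply: segment; exact: ltnW.
exists U; split.
- move=> x y; apply: eq_of; exists (K (x + y) + K x + K y) => n.
  have -> : U (x + y) - (U x + U y) = U (x + y) - dyadic n (x + y)
    + - (U x - dyadic n x) + - (U y - dyadic n y).
    rewrite {1}/dyadic eulerD -!/(dyadic n _).
    rewrite !opprB -[RHS]addrA [X in _ = _ + X]addrACA [RHS]addrA subrK.
    by rewrite -opprD.
  rewrite !mulrDl; apply: le_trans (nrmD _ _) _; rewrite nrmN lerD//.
  by apply: le_trans (nrmD _ _) _; rewrite nrmN lerD.
- move=> x; apply: (@le_dyadic _ _ _ (K x)) => n.
  apply: le_trans (euler_ge x (seg' n)) _; rewrite -/(dyadic n x).
  have -> : dyadic n x = U x - (U x - dyadic n x) by rewrite opprB addrC subrK.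
  by apply: le_trans (nrmB _ _) _; rewrite lerD2l.
- move=> G c b c0 b0 GB Gb hG x; apply: eq_of.
  exists (b * K x + (t1 - t0) ^+ 2 * c * nrm x * B + K (G t0 x)) => n.
  have -> : G t1 (U x) - U (G t0 x) = G t1 (U x - dyadic n x)
    + (G t1 (dyadic n x) - dyadic n (G t0 x)) + - (U (G t0 x) - dyadic n (G t0 x)).
    by rewrite GB opprB !addrA subrK subrK.
  rewrite !mulrDl; apply: le_trans (nrmD _ _) _; rewrite nrmN lerD//.
  apply: le_trans (nrmD _ _) _; rewrite lerD//.
    by rewrite (le_trans (Gb _))// -mulrA ler_wpM2l.
  have e1 : t0 + (2 ^ n)%:R * delta n = t1 by rewrite natrX; field; rewrite gt_eqF.
  have := @euler_intertwine G c (delta n) t0 (2 ^ n) x GB c0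
    (fun s y => hG s (delta n) y) (segment (n := n)).
  rewrite e1 -!/(dyadic n _) => h; apply: le_trans h _.
  apply: le_trans (ler_wpM2l _ (growth_le n)) _.
    by rewrite mulr_ge0// mulr_ge0 ?nrm_ge0// mulr_ge0 ?sqr_ge0.
  rewrite le_eqVlt; apply/orP; left; apply/eqP.
  by rewrite natrX; field; rewrite gt_eqF.
Qed.

End Evolution.

(** * Absolutely convergent Fourier series *)

Section Wiener.
Context {R : realType}.
Implicit Types (c d : nat -> R[i]) (x : R) (n k : nat).

Definition l1 c := cvgn (series (fun k => normc (c k))).
Definition norm1 c := limn (series (fun k => normc (c k))).

Lemma l1_le c (B : R) : (forall n, series (fun k => normc (c k)) n <= B) ->
  l1 c /\ norm1 c <= B.
Proof.
move=> h; have cv : l1 c.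
  apply: nondecreasing_is_cvgn.
    by apply: nondecreasing_series => k _ _; exact: normc_ge0.
  by exists B => _ [n _ <-].
by split=> //; apply: limr_le => //; exact: nearW.
Qed.

Lemma series_le_norm1 c n : l1 c -> series (fun k => normc (c k)) n <= norm1 c.
Proof.
move=> lc; apply: nondecreasing_cvgn_le => //.
by apply: nondecreasing_series => k _ _; exact: normc_ge0.
Qed.

Lemma norm1_ge0 c : l1 c -> 0 <= norm1 c.
Proof. by move=> /(series_le_norm1 0); rewrite /series /= big_geq. Qed.

Lemma l1_linear (a : R[i]) c d : l1 c -> l1 d -> l1 (fun k => a * c k + d k).
Proof.
move=> lc ld.
have [] // := @l1_le (fun k => a * c k + d k) (normc a * norm1 c + norm1 d) _.
move=> n; rewrite /series /=.
apply: (@le_trans _ _ (normc a * series (fun k => normc (c k)) n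
  + series (fun k => normc (d k)) n)).
  rewrite /series /= mulr_sumr -big_split /=; apply: ler_sum => k _.
  by rewrite (le_trans (le_normcD _ _))// normcM.
by rewrite lerD ?series_le_norm1// ler_wpM2l ?normc_ge0// series_le_norm1.
Qed.

Lemma l1_0 : l1 (fun=> 0) /\ norm1 (fun=> 0) <= 0.
Proof. by apply: l1_le => n; rewrite /series /= big1// => k _; exact: normc0. Qed.

Lemma series_shift (V : zmodType) (a : nat -> V) n :
  series a n.+1 = a 0%N + series (fun k => a k.+1) n.
Proof. by rewrite /series /= big_nat_recl. Qed.

Lemma lim_series_shift (a : nat -> R) : cvgn (series (fun k => a k.+1)) ->
  cvgn (series a) /\ limn (series a) = a 0%N + limn (series (fun k => a k.+1)).
Proof.
move=> ca.
have h : series a @ \oo --> a 0%N + limn (series (fun k => a k.+1)).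
  rewrite -cvg_shiftS.
  rewrite (_ : (fun n => _) = (fun n => a 0%N + series (fun k => a k.+1) n)).
    by apply: cvgD => //; exact: cvg_cst.
  by apply/funext => n; rewrite series_shift.
by split; [apply/cvg_ex; eexists; exact: h|exact/cvg_lim].
Qed.

Lemma l1_shift c : l1 c -> l1 (fun k => c k.+1) /\
  norm1 (fun k => c k.+1) = norm1 c - normc (c 0%N).
Proof.
move=> lc.
have [l _] : l1 (fun k => c k.+1) /\ norm1 (fun k => c k.+1) <= norm1 c.
  apply: l1_le => n; apply: le_trans (series_le_norm1 n.+1 lc).
  by rewrite series_shift lerDr normc_ge0.
split=> //; have [_] := @lim_series_shift (fun k => normc (c k)) l; rewrite -/(norm1 c) => ->.
by rewrite addrC addKr.
Qed.

Definition term c x k : R[i] := c k * expi k%:Z x.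

(** The sum of the Fourier series with coefficients c at nonnegative frequencies;
    real and imaginary parts are summed apart. *)
Definition synth c : Tfun R := fun x =>
  Complex (limn (series (fun k => complex.Re (term c x k))))
          (limn (series (fun k => complex.Im (term c x k)))).

Lemma normc_term c x k : normc (term c x k) = normc (c k).
Proof. by rewrite normcM normc_expi mulr1. Qed.

Lemma synth_cvg c x : l1 c ->
  cvgn (series (fun k => complex.Re (term c x k))) /\
  cvgn (series (fun k => complex.Im (term c x k))).
Proof.
move=> lc; split; apply: normed_cvg; apply: series_le_cvg lc => //= k;
  rewrite ?normc_ge0//.
- by rewrite (le_trans (normc_Re_le _))// normc_term.
- by rewrite (le_trans (normc_Im_le _))// normc_term.
Qed.

Lemma Re_sum (I : Type) (r : seq I) (F : I -> R[i]) :
  complex.Re (\sum_(i <- r) F i) = \sum_(i <- r) complex.Re (F i).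
Proof. by elim/big_rec2: _ => // i y z _ <-; rewrite ReD. Qed.

Lemma Im_sum (I : Type) (r : seq I) (F : I -> R[i]) :
  complex.Im (\sum_(i <- r) F i) = \sum_(i <- r) complex.Im (F i).
Proof. by elim/big_rec2: _ => // i y z _ <-; rewrite ImD. Qed.

Lemma normc_sum (I : Type) (r : seq I) (F : I -> R[i]) :
  normc (\sum_(i <- r) F i) <= \sum_(i <- r) normc (F i).
Proof.
elim/big_rec2: _ => [|i y z _ h]; first by rewrite normc0.
by rewrite (le_trans (le_normcD _ _))// lerD2l.
Qed.

Lemma synth_le c x : l1 c -> normc (synth c x) <= norm1 c.
Proof.
move=> lc; have [cr ci] := synth_cvg x lc.
rewrite -(@ler_pXn2r _ 2)// ?nnegrE ?normc_ge0 ?norm1_ge0// sqr_normcE /=.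
pose r n := series (fun k => complex.Re (term c x k)) n.
pose i n := series (fun k => complex.Im (term c x k)) n.
have h : (fun n => r n * r n + i n * i n) @ \oo -->
    limn r ^+ 2 + limn i ^+ 2.
  by rewrite !expr2; apply: cvgD; apply: cvgM.
rewrite -(cvg_lim _ h)//; apply: limr_le; first by apply/cvg_ex; eexists; exact: h.
apply: nearW => n; rewrite -!expr2 /r /i /series /= -Re_sum -Im_sum -sqr_normcE.
rewrite ler_pXn2r ?nnegrE ?normc_ge0 ?norm1_ge0//.
rewrite (le_trans (normc_sum _ _))// (le_trans _ (series_le_norm1 n lc))//.
by rewrite /series /=; apply: ler_sum => k _; rewrite normc_term.
Qed.

Lemma synth_linear (a : R[i]) c d x : l1 c -> l1 d ->
  synth (fun k => a * c k + d k) x = a * synth c x + synth d x.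
Proof.
move=> lc ld; have [cr ci] := synth_cvg x lc; have [dr di] := synth_cvg x ld.
apply: complexP; rewrite ?ReD ?ImD ?ReM ?ImM /=; apply/cvg_lim => //.
- rewrite (_ : series _ = (fun n =>
     complex.Re a * series (fun k => complex.Re (term c x k)) n -
     complex.Im a * series (fun k => complex.Im (term c x k)) n +
     series (fun k => complex.Re (term d x k)) n)).
    by apply: cvgD => //; apply: cvgB; apply: cvgM => //; exact: cvg_cst.
  apply/funext => n; rewrite /series /= !mulr_sumr -sumrB -big_split /=.
  by apply: eq_bigr => k _; rewrite /term !ReM !ReD !ImD !ReM !ImM; ring.
- rewrite (_ : series _ = (fun n =>
     complex.Re a * series (fun k => complex.Im (term c x k)) n +
     complex.Im a * series (fun k => complex.Re (term c x k)) n +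
     series (fun k => complex.Im (term d x k)) n)).
    by apply: cvgD => //; apply: cvgD; apply: cvgM => //; exact: cvg_cst.
  apply/funext => n; rewrite /series /= !mulr_sumr -!big_split /=.
  by apply: eq_bigr => k _; rewrite /term !ImM !ReD !ImD !ReM !ImM; ring.
Qed.

(** Splitting off the first term lets the coefficients be computed by shifting,
    without exchanging a series and an integral. *)
Lemma synth_shift c x : l1 c ->
  synth c x = c 0%N + expi 1 x * synth (fun k => c k.+1) x.
Proof.
move=> lc; have [ls _] := l1_shift lc.
have eT k : term c x k.+1 = expi 1 x * term (fun k => c k.+1) x k.
  by rewrite /term -addn1 PoszD expiD; ring.
have l1e : l1 (fun k => expi 1 x * c k.+1 + 0).
  by apply: l1_linear => //; have [] := l1_0.
have eE k : term (fun k => expi 1 x * c k.+1 + 0) x k = term c x k.+1.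
  by rewrite eT /term addr0; ring.
have [cr ci] := synth_cvg x l1e.
have [e0 n0] := l1_0.
have s0 : synth (fun=> 0) x = 0.
  apply: normc_eq0; apply/eqP; rewrite eq_le normc_ge0 andbT.
  exact: le_trans (synth_le x e0) n0.
rewrite -[X in _ + X]addr0 -[X in _ + (_ + X)]s0 -synth_linear//.
have c0 : term c x 0 = c 0%N by rewrite /term expi0 mulr1.
have er : (fun k => complex.Re (term (fun k => expi 1 x * c k.+1 + 0) x k)) =
  (fun k => complex.Re (term c x k.+1)) by apply/funext => k; rewrite eE.
have ei : (fun k => complex.Im (term (fun k => expi 1 x * c k.+1 + 0) x k)) =
  (fun k => complex.Im (term c x k.+1)) by apply/funext => k; rewrite eE.
apply: complexP; rewrite ?ReD ?ImD /=.
- by rewrite er in cr *; have [_ ->] := @lim_series_shift (fun k => complex.Re (term c x k)) cr; rewrite c0.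
- by rewrite ei in ci *; have [_ ->] := @lim_series_shift (fun k => complex.Im (term c x k)) ci; rewrite c0.
Qed.

Lemma bddT_synth c : l1 c -> bddT (synth c).
Proof.
move=> lc; split; last by exists (norm1 c) => x; exact: synth_le.
have mt k : cmeas (fun x => term c x k).
  by apply: cmeasZ; have [] := @bddT_expi R k%:Z.
split.
- apply: (measurable_fun_cvg
    (h := fun n x => series (fun k => complex.Re (term c x k)) n)).
  + move=> n; rewrite /series /=; apply: measurable_sum => k.
    by have [] := mt k.
  + by move=> x _; have [] := synth_cvg x lc.
- apply: (measurable_fun_cvg
    (h := fun n x => series (fun k => complex.Im (term c x k)) n)).
  + move=> n; rewrite /series /=; apply: measurable_sum => k.
    by have [] := mt k.
  + by move=> x _; have [] := synth_cvg x lc.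
Qed.

Lemma nrm_cls_le (f : Tfun R) (B : R) : bddT f -> (forall x, normc (f x) <= B) ->
  nrm (cls f) <= B * nrm (cls (fun=> 1)).
Proof.
move=> bf fB; have := nrm_mul_le (cls (fun=> 1)) bf fB.
rewrite mul_cls//; last exact/bddT_L2/bddT_cst.
by rewrite (@eq_cls _ _ f)// => t; rewrite mulr1.
Qed.

Lemma coef_one (j : int) : coef (cls (fun=> 1 : R[i])) j = (j == 0)%:R.
Proof.
rewrite coef_cls; last exact/bddT_L2/bddT_cst.
rewrite /fourier /inner; under eq_fun do rewrite mul1r conjc_expi.
have [->|j0] := eqVneq j 0; last by rewrite integralT_expi ?oppr_eq0// mulr0.
rewrite oppr0 (_ : expi 0 = fun=> Complex 1 0); last by apply/funext => x; exact: expi0.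
rewrite /integralT /= !Rintegral_cst; try exact: measurable_angles.
rewrite mul0r mul1r.
have -> : fine (@lebesgue_measure R angles) = 2 * pi by rewrite mu_angles.
by rewrite complexr0 -rmorphM mulVf ?rmorph1// gt_eqF// pi2_gt0.
Qed.

Lemma coef_synth_shift c (j : int) : l1 c ->
  coef (cls (synth c)) j =
  c 0%N * (j == 0)%:R + coef (cls (synth (fun k => c k.+1))) (j - 1).
Proof.
move=> lc; have [ls _] := l1_shift lc.
have bs := bddT_synth ls; have s2 := bddT_L2 bs.
have o2 : in_L2 (fun=> 1 : R[i]) by exact/bddT_L2/bddT_cst.
rewrite -coef_one -coef_mul_expi -coefZ -coefD mul_cls// -clsZ//.
rewrite -clsD; [|exact: in_L2Z|exact: in_L2_bddM].
by congr coef; apply: eq_cls => x; rewrite synth_shift// mulr1.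
Qed.

(** Shifting n times moves the frequency j to j - n and leaves only the tail of the
    series, whose sum tends to zero. *)
Lemma coef_synth_neg c (j : int) : l1 c -> j < 0 -> coef (cls (synth c)) j = 0.
Proof.
move=> lc j0; pose K : R := 2 * (nrm (cls (fun=> 1 : R[i])) * 1).
have bound d i : l1 d -> normc (coef (cls (synth d)) i) <= K * norm1 d *
    nrm (cls (@expi R i)).
  move=> ld; rewrite coef_ip (le_trans (normc_ip_le _ _))// /K mulr1.
  rewrite -!mulrA ler_pM2l// mulrA ler_wpM2r ?nrm_ge0// mulrC.
  by apply: nrm_cls_le; [exact: bddT_synth|move=> x; exact: synth_le].
have nexp i : nrm (cls (@expi R i)) <= nrm (cls (fun=> 1 : R[i])).
  by rewrite -[leRHS]mul1r; apply: nrm_cls_le => // x; rewrite normc_expi.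
have shift n : l1 (fun k => c (k + n)%N) /\
    norm1 (fun k => c (k + n)%N) = norm1 c - series (fun k => normc (c k)) n /\
    coef (cls (synth c)) j = coef (cls (synth (fun k => c (k + n)%N))) (j - n%:Z).
  elim: n => [|n [l [e1 e2]]].
    have -> : (fun k => c (k + 0)%N) = c by apply/funext => k; rewrite addn0.
    by rewrite /series /= big_geq// !subr0.
  have [l' e'] := l1_shift l.
  have E : (fun k => c (k + n.+1)%N) = (fun k => c (k.+1 + n)%N).
    by apply/funext => k; rewrite addnS addSn.
  rewrite E; split; first exact: l'.
  split.
    by rewrite e' e1 add0n /series /= big_nat_recr//= opprD addrA.
  rewrite e2 coef_synth_shift// (_ : _ == _ = false) ?mulr0 ?add0r; last first.
    by apply/negbTE; lia.
  by congr coef; lia.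
apply: normc_eq0; apply/eqP; rewrite eq_le normc_ge0 andbT.
pose Q : R := nrm (cls (fun=> 1 : R[i])).
have tail : (fun n => K * (norm1 c - series (fun k => normc (c k)) n) * Q) @ \oo
    --> K * (norm1 c - norm1 c) * Q.
  apply: cvgM; last exact: cvg_cst.
  by apply: cvgM; [exact: cvg_cst|apply: cvgB => //; exact: cvg_cst].
rewrite subrr mulr0 mul0r in tail.
rewrite -(cvg_lim _ tail)//; apply: limr_ge; first by apply/cvg_ex; eexists; exact: tail.
apply: nearW => n; have [l [<- ->]] := shift n.
rewrite (le_trans (bound _ _ l))// ler_wpM2l//.
by rewrite mulr_ge0 ?norm1_ge0// /K !mulr_ge0 ?nrm_ge0.
Qed.

Lemma coef_synth c k : l1 c -> coef (cls (synth c)) k%:Z = c k.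
Proof.
elim: k c => [|k ih] c lc; rewrite coef_synth_shift//; have [ls _] := l1_shift lc.
- by rewrite eqxx mulr1 coef_synth_neg ?addr0.
- by rewrite mulr0 add0r -addn1 PoszD addrK ih// addn1.
Qed.

Lemma hardy_synth c : l1 c -> hardy (cls (synth c)).
Proof. by move=> lc j j0; exact: coef_synth_neg. Qed.

(** By uniqueness of Fourier coefficients; in particular such a function is bounded
    up to a null set. *)
Lemma synth_fourier (f : Tfun R) : in_L2plus f -> l1 (fun k => fourier f k%:Z) ->
  cls f = cls (synth (fun k => fourier f k%:Z)).
Proof.
move=> [f2 fh] lf; apply: L2_ext => -[k|k].
- by rewrite coef_cls// coef_synth.
- by rewrite coef_cls// fh// coef_synth_neg.
Qed.

End Wiener.

(** * Sobolev embedding *)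

Section Sobolev.
Context {R : realType}.
Variable s : R.
Hypothesis hs : 2^-1 < s.
Implicit Types (f : Tfun R) (n k : nat).

Definition weight k : R := (1 + k%:~R ^+ 2) `^ s.

Lemma weight_gt0 k : 0 < weight k.
Proof. by rewrite powR_gt0// ltr_pwDl// sqr_ge0. Qed.

(** On this dyadic block the weight is at least (4^s)^n and there are 2^n terms;
    the ratio 2 / 4^s is below 1 exactly because s > 1/2. *)
Lemma weight_block n : \sum_(2 ^ n <= k < 2 ^ n.+1) (weight k)^-1 <=
  (2 / 4 `^ s) ^+ n.
Proof.
have b0 : 0 < (4 : R) `^ s by rewrite powR_gt0.
have pw : ((2 ^+ n) ^+ 2 : R) `^ s = (4 `^ s) ^+ n.
  elim: n => [|n ih]; first by rewrite !expr0 expr1n powR1.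
  have -> : (2 ^+ n.+1) ^+ 2 = 4 * (2 ^+ n) ^+ 2 :> R.
    by rewrite (exprS _ n); ring.
  by rewrite powRM ?sqr_ge0// ih [RHS]exprS.
have le1 k : (2 ^ n <= k < 2 ^ n.+1)%N -> (weight k)^-1 <= ((4 `^ s) ^+ n)^-1.
  move=> /andP[nk _]; rewrite lef_pV2 ?posrE ?exprn_gt0 ?weight_gt0// -pw.
  rewrite /weight ge0_ler_powR ?nnegrE ?sqr_ge0 ?addr_ge0 ?sqr_ge0//.
    by rewrite (le_trans _ (ltW hs)).
  apply: (@le_trans _ _ ((k%:~R : R) ^+ 2)); last by rewrite lerDr.
  by rewrite ler_pXn2r ?nnegrE// -natrX -pmulrn ler_nat.
rewrite big_nat (le_trans (ler_sum _ le1))// -big_nat sumr_const_nat.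
by rewrite expnS mul2n -addnn addnK -(mulr_natl _ (2 ^ n)) natrX exprMn exprVn.
Qed.

Lemma weight_summable : exists2 S : R, 0 <= S &
  forall n, series (fun k => (weight k)^-1) n <= S.
Proof.
set r := 2 / (4 : R) `^ s.
have r0 : 0 <= r by rewrite divr_ge0// powR_ge0.
have r1 : r < 1.
  rewrite ltr_pdivrMr ?powR_gt0// mul1r.
  have -> : (2 : R) = 4 `^ 2^-1.
    rewrite powR12_sqrt// (_ : 4 = 2 ^+ 2); last by rewrite -natrX.
    by rewrite sqrtr_sqr ger0_norm.
  rewrite /powR !gt_eqF// ltr_expR ltr_pM2r// ln_gt0//; lra.
have block n : series (fun k => (weight k)^-1) (2 ^ n)%N <=
    (weight 0)^-1 + \sum_(0 <= i < n) r ^+ i.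
  elim: n => [|n ih].
    by rewrite expn0 big_geq// addr0 /series /= big_nat1.
  rewrite /series /= (@big_cat_nat _ _ _ (2 ^ n)%N) //=; last by rewrite leq_exp2l.
  by rewrite big_nat_recr//= addrA lerD// weight_block.
have geo n : \sum_(0 <= i < n) r ^+ i <= (1 - r)^-1.
  have p0 : 0 < 1 - r by rewrite subr_gt0.
  rewrite -[leRHS]mul1r ler_pdivlMr// big_mkord mulrC -opprB mulNr -subrX1.
  by rewrite opprB gerBl exprn_ge0.
exists ((weight 0)^-1 + (1 - r)^-1).
  by rewrite addr_ge0// invr_ge0 ?subr_ge0 ?(ltW r1)// ltW// weight_gt0.
move=> n; apply: (@le_trans _ _ (series (fun k => (weight k)^-1) (2 ^ n)%N)).
  apply: nondecreasing_series; last exact/ltnW/ltn_expl.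
  by move=> k _ _; rewrite invr_ge0 ltW// weight_gt0.
by rewrite (le_trans (block n))// lerD2l.
Qed.

(** A partial sum over nonnegative frequencies is dominated by the sum over all
    integers. *)
Lemma Hs_norm_partial f (e : R) : 0 <= e -> (Hs_norm s f <= e%:E)%E ->
  forall n, series (fun k => weight k * normc (fourier f k%:Z) ^+ 2) n <= e ^+ 2.
Proof.
move=> e0 he n.
pose a (k : int) := ((1 + k%:~R ^+ 2) `^ s * normc (fourier f k) ^+ 2)%:E.
have a0 k : (0 <= a k)%E by rewrite lee_fin mulr_ge0 ?powR_ge0 ?sqr_ge0.
have X : (\esum_(k in [set: int]) a k <= (e ^+ 2)%:E)%E.
  rewrite -lee_sqrt ?lee_fin ?sqr_ge0//; apply: le_trans he _.
  by rewrite EFin_expe sqrte_sqr gee0_abs.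
rewrite -lee_fin; apply: le_trans X.
have -> : (series (fun k => weight k * normc (fourier f k%:Z) ^+ 2) n)%:E =
    (\sum_(0 <= k < n) a k%:Z)%E by rewrite /series /= -sumEFin.
apply: (@le_trans _ _ (\sum_(0 <= k <oo) a k%:Z)%E).
  by apply: nneseries_lim_ge => k _ _.
rewrite -(@esum_pred_image _ _ a Posz xpredT)//; last first.
  by move=> i j _ _ [].
rewrite esum_mkcond; apply: le_esum => k _; case: ifP => _.
  exact: lexx.
by rewrite lee_fin mulr_ge0 ?powR_ge0 ?sqr_ge0.
Qed.

Lemma amgm_series (w z : nat -> R) n (e : R) : 0 < e -> (forall k, 0 < w k) ->
  series z n <= e * series (fun k => (w k)^-1) n +
    e^-1 * series (fun k => w k * z k ^+ 2) n.
Proof.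
move=> e0 w0.
rewrite /series /= !mulr_sumr -big_split /=; apply: ler_sum => k _.
rewrite -subr_ge0.
have -> : e / w k + e^-1 * (w k * z k ^+ 2) - z k =
  (e / w k) * ((1 - 2^-1 * (w k / e * z k)) ^+ 2 + 3 / 4 * (w k / e * z k) ^+ 2).
  by field; rewrite !gt_eqF.
have p0 : 0 <= (3 : R) / 4 by lra.
by rewrite mulr_ge0 ?divr_ge0 ?(ltW e0) ?(ltW (w0 k))// addr_ge0 ?sqr_ge0// mulr_ge0 ?sqr_ge0.
Qed.

(** The Fourier coefficients of a function of H^s are summable for s > 1/2. The
    arithmetic-geometric mean inequality, weighted by e, stands for the
    Cauchy-Schwarz inequality against the summable weights. *)
Theorem sobolev : exists2 S : R, 0 < S & forall f (e : R), 0 < e ->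
  (Hs_norm s f <= e%:E)%E ->
  l1 (fun k => fourier f k%:Z) /\ norm1 (fun k => fourier f k%:Z) <= S * e.
Proof.
have [S S0 hS] := weight_summable.
exists (S + 1); first by rewrite ltr_wpDl.
move=> f e e0 he; apply: l1_le => n.
have h1 := Hs_norm_partial (ltW e0) he n; have h2 := hS n.
apply: (@le_trans _ _ (e * series (fun k => (weight k)^-1) n +
  e^-1 * series (fun k => weight k * normc (fourier f k%:Z) ^+ 2) n)); last first.
  rewrite mulrDl mul1r (mulrC S) lerD ?ler_wpM2l ?(ltW e0)//.
  by rewrite mulrC ler_pdivrMr// -expr2.
exact: (@amgm_series _ (fun k => normc (fourier f k%:Z)) n _ e0 weight_gt0).
Qed.

End Sobolev.

(** * Dependence on time *)

Section MeanValue.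
Context {R : realType}.
Local Notation "r %:C" := (real_complex R r).

(** Differentiability with an explicit threshold: unlike a filter statement, it
    can be asserted uniformly in the angle, as the Sobolev derivative allows. *)
Definition expands (phi psi : R -> R[i]) := forall t (e : R), 0 < e ->
  exists2 eta : R, 0 < eta & forall h : R, `|h| < eta ->
    normc (phi (t + h) - phi t - h%:C * psi t) <= e * `|h|.

Lemma is_derive_expansion (f df : R -> R) (t : R) :
  (forall e : R, 0 < e -> exists2 eta : R, 0 < eta & forall h : R, `|h| < eta ->
    `|f (t + h) - f t - h * df t| <= e * `|h|) -> is_derive t 1 f (df t).
Proof.
move=> hf.
have cv : h^-1 *: (f (h *: 1 + t) - f t) @[h --> 0^'] --> df t.
  apply/cvgrPdist_le => e e0; have [eta eta0 he] := hf e e0.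
  apply/nbhs_ballP; exists eta => //= h; rewrite /ball /= sub0r normrN => hh h0.
  rewrite /GRing.scale /= mulr1 (addrC h).
  have -> : df t - h^-1 * (f (t + h) - f t) =
      - (f (t + h) - f t - h * df t) / h by field.
  by rewrite normrM normrN normfV ler_pdivrMr ?normr_gt0// he.
split; first by apply/cvg_ex; exists (df t); exact: cv.
exact/cvg_lim.
Qed.

Lemma expands_Re phi psi (t : R) : expands phi psi ->
  is_derive t 1 (fun t : R => complex.Re (phi t)) (complex.Re (psi t)).
Proof.
move=> hp; apply: (is_derive_expansion (df := fun t => complex.Re (psi t))) => e e0.
have [eta eta0 he] := hp t e e0; exists eta => // h hh.
by rewrite -Re_realM -!ReN -!ReD (le_trans (normc_Re_le _))// he.
Qed.

Lemma expands_Im phi psi (t : R) : expands phi psi ->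
  is_derive t 1 (fun t : R => complex.Im (phi t)) (complex.Im (psi t)).
Proof.
move=> hp; apply: (is_derive_expansion (df := fun t => complex.Im (psi t))) => e e0.
have [eta eta0 he] := hp t e e0; exists eta => // h hh.
have -> : h * complex.Im (psi t) = complex.Im (h%:C * psi t).
  by rewrite ImM /= mul0r addr0.
by rewrite -!ImN -!ImD (le_trans (normc_Im_le _))// he.
Qed.

Lemma mvt_le (f df : R -> R) (a b M : R) : a <= b ->
  (forall t : R, is_derive t 1 f (df t)) ->
  (forall t, a <= t <= b -> `|df t| <= M) -> `|f b - f a| <= M * (b - a).
Proof.
move=> ab hf hM.
have cf : {within `[a, b], continuous f}.
  by apply: derivable_within_continuous => c _; have [] := hf c.
have [c cab ->] := MVT_segment ab (fun x _ => hf x) cf.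
rewrite in_itv/= in cab.
by rewrite normrM (ger0_norm (x := b - a)) ?subr_ge0// ler_wpM2r ?subr_ge0// hM.
Qed.

(** The factor 2 comes from treating real and imaginary parts apart. *)
Lemma mean_value phi psi (a b M : R) : expands phi psi ->
  (forall t, Num.min a b <= t <= Num.max a b -> normc (psi t) <= M) ->
  normc (phi b - phi a) <= 2 * M * `|b - a|.
Proof.
move=> hp; wlog ab : a b / a <= b => [hw|].
  case/orP: (le_total a b) => [|ba hM]; first exact: hw.
  by rewrite normc_subC distrC; apply: hw => // t; rewrite minC maxC; exact: hM.
rewrite (min_l ab) (max_r ab) => hM.
rewrite (ger0_norm (x := b - a)) ?subr_ge0// -mulrA mulr_natl mulr2n.
rewrite (le_trans (normc_le_ReIm _))// lerD//.
- rewrite ReD ReN; apply: (mvt_le ab (fun t => expands_Re t hp)) => t ht.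
  exact: le_trans (normc_Re_le _) (hM t ht).
- rewrite ImD ImN; apply: (mvt_le ab (fun t => expands_Im t hp)) => t ht.
  exact: le_trans (normc_Im_le _) (hM t ht).
Qed.

End MeanValue.

Section SmoothCurve.
Context {R : realType}.
Local Notation "r %:C" := (real_complex R r).
Variable s : R.
Hypothesis hs : 2^-1 < s.
Variable D : nat -> R -> Tfun R.
Hypothesis D_Hs : forall n t, in_Hsplus s (D n t).
Hypothesis D_derive : forall n t, Hs_is_derive s (D n) t (D n.+1 t).

Definition coefs n t k : R[i] := fourier (D n t) k%:Z.

Lemma curve_key : {c : nat -> R -> Tfun R | forall n t, c n t = synth (coefs n t)}.
Proof. by exists (fun n t => synth (coefs n t)). Qed.

(** The continuous representative of the n-th time derivative. *)
Definition curve := sval curve_key.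

Lemma curveE n t : curve n t = synth (coefs n t).
Proof. exact: svalP curve_key n t. Qed.

Lemma D_L2 n t : in_L2 (D n t).
Proof. by have [[]] := D_Hs n t. Qed.

Lemma l1_coefs n t : l1 (coefs n t).
Proof.
have [S S0 hS] := sobolev hs; have [_ h] := D_Hs n t.
have H0 : (0 <= Hs_norm s (D n t))%E by exact: sqrte_ge0.
have e0 : 0 < fine (Hs_norm s (D n t)) + 1 by rewrite ltr_wpDl// fine_ge0.
have [] // := hS (D n t) _ e0 _.
rewrite -[leLHS]fineK ?ge0_fin_numE// lee_fin; lra.
Qed.

Lemma cls_curve n t : cls (D n t) = cls (curve n t).
Proof. by rewrite curveE; apply: synth_fourier; [have [] := D_Hs n t|exact: l1_coefs]. Qed.

Lemma bddT_curve n t : bddT (curve n t).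
Proof. by rewrite curveE; exact/bddT_synth/l1_coefs. Qed.

Lemma hardy_curve n t : hardy (cls (curve n t)).
Proof. by rewrite curveE; exact/hardy_synth/l1_coefs. Qed.

(** The Sobolev embedding applied to the difference quotient minus the derivative. *)
Lemma curve_expands n t (e : R) : 0 < e ->
  exists2 eta : R, 0 < eta & forall h : R, `|h| < eta -> forall x,
    normc (curve n (t + h) x - curve n t x - h%:C * curve n.+1 t x) <= e * `|h|.
Proof.
move=> e0; have [S S0 hS] := sobolev hs.
have eS : 0 < e / S by rewrite divr_gt0.
have [_ cv] := D_derive n t.
have lt0 : (0 < (e / S)%:E)%E by rewrite lte_fin.
have /nbhs_ballP [eta eta0 he] := cv _ (open_ereal_lt' lt0).
exists eta => // h hh x.
have [->|h0] := eqVneq h 0.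
  by rewrite addr0 subrr sub0r rmorph0 mul0r oppr0 normc0 normr0 mulr0.
have hq := he h; rewrite /ball /= sub0r normrN in hq.
move: (hq hh h0) => /ltW {hq}.
set q := (X in Hs_norm s X) => hq.
have [lq nq] := hS q _ eS hq.
have sq : coefs n (t + h) = fun k => h%:C * fourier q k%:Z +
    (h%:C * coefs n.+1 t k + coefs n t k).
  apply/funext => k; rewrite /q /coefs.
  have -> : fourier (fun x => h^-1%:C * (D n (t + h) x - D n t x) - D n.+1 t x) k%:Z =
      h^-1%:C * (fourier (D n (t + h)) k%:Z - fourier (D n t) k%:Z)
        - fourier (D n.+1 t) k%:Z.
    rewrite /fourier innerBl ?innerZl ?innerBl//; try exact: D_L2;
      try apply: in_L2Z; apply: in_L2B; exact: D_L2.
  have hV : h%:C * h^-1%:C = 1 by rewrite -rmorphM mulfV// rmorph1.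
  by rewrite mulrBr mulrA hV mul1r; ring.
have lc : l1 (fun k => h%:C * coefs n.+1 t k + coefs n t k).
  by apply: l1_linear; exact: l1_coefs.
rewrite !curveE sq synth_linear// synth_linear; try exact: l1_coefs.
have -> : forall a b c : R[i], a + (b + c) - c - b = a by move=> a b c; ring.
rewrite normcM normc_real mulrC ler_wpM2r// (le_trans (synth_le x lq))//.
by rewrite (le_trans nq)// mulrC divfK// gt_eqF.
Qed.

Lemma expands_curve n x : expands (fun t => curve n t x) (fun t => curve n.+1 t x).
Proof.
move=> t e e0; have [eta eta0 he] := curve_expands n t e0.
by exists eta => // h hh; exact: he.
Qed.

(** Local boundedness, uniform in the angle, spreads to compact intervals. *)
Lemma curve_bounded n (lo hi : R) : exists2 M : R, 0 <= M &
  forall t, lo <= t <= hi -> forall x, normc (curve n t x) <= M.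
Proof.
have cpt := (@compact_near_coveringP R `[lo, hi]%classic).1 (@segment_compact R lo hi).
pose Q (M : R) t := forall x, normc (curve n t x) <= M.
have := cpt R +oo%R Q _ _; case.
- move=> t _; have [eta eta0 he] := curve_expands n t (@ltr01 R).
  pose B := norm1 (coefs n t) + norm1 (coefs n.+1 t) + 1.
  exists (ball t (Num.min eta 1), [set M : R | B < M]).
    split; first by apply: nbhsx_ballx; rewrite lt_min eta0 ltr01.
    by apply: nbhs_pinfty_gt; exact: num_real.
  move=> [t' M] /= [bt BM] x; rewrite (le_trans _ (ltW BM))//.
  have hh : `|t' - t| < eta /\ `|t' - t| < 1.
    by move: bt; rewrite /ball /= distrC lt_min => /andP[].
  have [h1 h2] := hh; set h := t' - t in h1 h2.
  have := he h h1 x; have -> : t + h = t' by rewrite /h addrC subrK.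
  rewrite mul1r => h3.
  have -> : curve n t' x = (curve n t' x - curve n t x - h%:C * curve n.+1 t x)
    + (curve n t x + h%:C * curve n.+1 t x) by ring.
  apply: le_trans (le_normcD _ _) _; rewrite /B [leRHS]addrC lerD ?(le_trans h3 (ltW h2))//.
  apply: le_trans (le_normcD _ _) _; rewrite lerD// ?curveE ?synth_le//; try exact: l1_coefs.
  rewrite normcM normc_real; have sl := synth_le x (@l1_coefs n.+1 t).
  rewrite (le_trans _ sl)// ler_piMl ?normc_ge0//; exact: ltW.
- move=> M0 [_ hM]; exists (Num.max M0 0 + 1).
    by rewrite addr_ge0// le_max lexx orbT.
  move=> t ht; apply: hM; last by rewrite /= in_itv.
  by rewrite ltr_pwDr// le_max lexx.
Qed.

Section Estimates.
Variables lo hi M : R.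
Hypothesis M0 : 0 <= M.
Hypothesis curve_M : forall n t, (n <= 2)%N -> lo <= t <= hi ->
  forall x, normc (curve n t x) <= M.
Local Notation I t := (lo <= t <= hi).

Lemma between t t' r : I t -> I t' -> Num.min t t' <= r <= Num.max t t' -> I r.
Proof.
move=> /andP[a b] /andP[c d] /andP[h1 h2].
rewrite (le_trans _ h1) ?le_min ?a ?c//= (le_trans h2)// ge_max b d//.
Qed.

Lemma curve_lip n t t' x : (n <= 1)%N -> I t -> I t' ->
  normc (curve n t' x - curve n t x) <= 2 * M * `|t' - t|.
Proof.
move=> n1 It It'; apply: (mean_value (expands_curve n x)) => r hr.
by apply: curve_M; [exact: n1|exact: between hr].
Qed.

(** The mean value inequality for r |-> u(r) - r u'(t), whose derivative
    u'(r) - u'(t) is itself small by the mean value inequality for u'. *)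
Lemma curve_taylor t t' x : I t -> I t' ->
  normc (curve 0 t' x - curve 0 t x - (t' - t)%:C * curve 1 t x)
    <= 4 * M * (t' - t) ^+ 2.
Proof.
move=> It It'.
pose phi r := curve 0 r x - r%:C * curve 1 t x.
pose psi r := curve 1 r x - curve 1 t x.
have hp : expands phi psi.
  move=> r e e0; have [eta eta0 he] := expands_curve 0 x r e0.
  exists eta => // h hh; rewrite (le_trans _ (he h hh))//.
  rewrite le_eqVlt; apply/orP; left; apply/eqP; congr normc.
  by rewrite /phi /psi rmorphD; ring.
have := @mean_value _ phi psi t t' (2 * M * `|t' - t|) hp _.
have -> : phi t' - phi t = curve 0 t' x - curve 0 t x - (t' - t)%:C * curve 1 t x.
  by rewrite /phi rmorphB; ring.
have -> : 2 * (2 * M * `|t' - t|) * `|t' - t| = 4 * M * (t' - t) ^+ 2.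
  by rewrite -(real_normK (num_real (t' - t))); ring.
apply=> r hr; rewrite /psi.
have Ir := between It It' hr.
rewrite (le_trans (curve_lip x _ It Ir))// ler_wpM2l ?mulr_ge0//.
move: hr; case: (leP t t') => [tt|tt] /andP[h1 h2].
- by rewrite !ger0_norm ?subr_ge0// lerD2r.
- by rewrite !ler0_norm ?subr_le0 ?(ltW tt)// lerN2 lerD2r.
Qed.

End Estimates.
End SmoothCurve.

(** * Isospectrality *)

Section SymbolEstimates.
Context {R : realType}.
Implicit Types (f g u : Tfun R) (x y : L2 R).
Local Notation M := mulL2.
Local Notation P := (@proj R).

Lemma mulL2_symbolB f g x : bddT f -> bddT g ->
  M f x - M g x = M (fun t => f t - g t) x.
Proof.
move=> bf bg; have := @mulL2_symbol _ (-1) g f x bg bf.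
rewrite scaleN1r addrC => <-; apply: eq_mulL2 => t; ring.
Qed.

Lemma nrm_mulL2B_le f g x (B : R) : bddT f -> bddT g ->
  (forall t, normc (f t - g t) <= B) -> nrm (M f x - M g x) <= B * nrm x.
Proof.
by move=> bf bg h; rewrite mulL2_symbolB//; apply: nrm_mul_le => //; exact: bddTB.
Qed.

Lemma hankel_symbolB f g x : bddT f -> bddT g ->
  hankel f x - hankel g x = hankel (fun t => f t - g t) x.
Proof.
move=> bf bg; have := @hankel_symbol _ (-1) g f x bg bf.
rewrite scaleN1r addrC => <-; congr hankel; apply/funext => t; ring.
Qed.

Lemma nrm_hankelB_le f g x (B : R) : bddT f -> bddT g ->
  (forall t, normc (f t - g t) <= B) -> nrm (hankel f x - hankel g x) <= B * nrm x.
Proof.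
move=> bf bg h; rewrite hankel_symbolB//.
by apply: nrm_hankel_le => //; exact: bddTB.
Qed.

Lemma hankelB u x y : bddT u -> hankel u (x - y) = hankel u x - hankel u y.
Proof. by move=> bu; rewrite -scaleN1r hankelD// hankelZ// conjcN conjc1 scaleN1r. Qed.

Lemma in_L2_ae f g : cmeas f -> eqT f g -> in_L2 g -> in_L2 f.
Proof.
move=> mf fg g2; have [mr mi] := mf; split => //.
have [_ _ foo] := g2; rewrite (le_lt_trans _ foo)// le_eqVlt; apply/orP; left.
apply/eqP; apply: ae_eq_integral => //.
- by apply/measurable_EFinP; exact: cmeas_normc2.
- by apply/measurable_EFinP; exact: (cmeas_normc2 (in_L2_meas g2)).
- by apply: filterS fg => t h At; rewrite h.
Qed.

Lemma Jfun_ip u g : bddT g -> in_L2 u -> eqT u g ->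
  Jfun u = ip (cls (fun t => g t * g t)) (cls g).
Proof.
move=> bg u2 ug; have g2 := bddT_L2 bg.
have gg2 : in_L2 (fun t => g t * g t) by exact: in_L2_bddM.
rewrite ip_cls// /Jfun; apply: inner_ae => //.
- apply: in_L2_ae gg2.
    by under eq_fun do rewrite expr2; apply: cmeasM; exact: in_L2_meas.
  by filter_upwards [ug] => t h At; rewrite h// expr2.
- by filter_upwards [ug] => t h At; rewrite h// expr2.
Qed.

(** The function u is bounded only up to a null set; replacing it by its continuous
    representative g makes the product square integrable. *)
Lemma Kop_hankel u g h : bddT g -> in_L2 u -> eqT u g -> in_L2plus h ->
  in_L2plus (Kop u h) /\ cls (Kop u h) = hankel g (cls h).
Proof.
move=> bg u2 ug hh; have [h2 _] := hh.
have i1 : in_L2 (fun t => g t * conjc (h t)) by apply: in_L2_bddM => //; exact: in_L2J.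
have i2 : in_L2 (fun t => expi (-1) t * (g t * conjc (h t))) by exact: in_L2_bddM.
have e : eqT (fun t => expi (-1) t * u t * conjc (h t))
    (fun t => expi (-1) t * (g t * conjc (h t))).
  by filter_upwards [ug] => t e At; rewrite e// mulrA.
have k2 : in_L2 (fun t => expi (-1) t * u t * conjc (h t)).
  apply: in_L2_ae e i2; apply: cmeasM; last exact/cmeasJ/in_L2_meas.
  by apply: cmeasM; [have [] := @bddT_expi R (-1)|exact: in_L2_meas].
have [pp pe] := Pi_proj k2; split => //.
rewrite /Kop pe /hankel (proj_hardy (hardy_cls hh)) (cls_eq k2 i2 e).
rewrite conj_cls// mul_cls//; last exact: in_L2J.
by rewrite mul_cls.
Qed.

Lemma Ksq_hankel u g h : bddT g -> in_L2 u -> eqT u g -> in_L2plus h ->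
  in_L2plus (Ksq u h) /\ cls (Ksq u h) = hankel g (hankel g (cls h)).
Proof.
move=> bg u2 ug hh; have [k1 e1] := Kop_hankel bg u2 ug hh.
by have [k2 e2] := Kop_hankel bg u2 ug k1; rewrite /Ksq e2 e1.
Qed.

Lemma eigenspaceP u g h (lambda : R[i]) : bddT g -> in_L2 u -> eqT u g ->
  eigenspace_L2plus (Ksq u) lambda h <->
  in_L2plus h /\ hankel g (hankel g (cls h)) = lambda *: cls h.
Proof.
move=> bg u2 ug; split=> -[hh eh]; split=> //; have [h2 _] := hh;
  have [[k2 _] ek] := Ksq_hankel bg u2 ug hh.
- by rewrite -ek -clsZ//; apply: cls_eq => //; exact: in_L2Z.
- apply: eqT_trans (eqT_sym (rep_cls k2)) _; rewrite ek eh -clsZ//.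
  exact/rep_cls/in_L2Z.
Qed.

Lemma cls_sum (n : nat) (c : 'I_n -> R[i]) (h : 'I_n -> Tfun R) :
  (forall i, in_L2 (h i)) ->
  in_L2 (fun t => \sum_(i < n) c i * h i t) /\
  cls (fun t => \sum_(i < n) c i * h i t) = \sum_(i < n) c i *: cls (h i).
Proof.
move=> h2; elim: (index_enum _) => [|i r [ih1 ih2]].
  have -> : (fun t => \sum_(i <- [::]) c i * h i t) = fun=> 0.
    by apply/funext => t; rewrite big_nil.
  by rewrite big_nil; split; [exact: in_L2_0|exact: cls0].
have -> : (fun t => \sum_(j <- i :: r) c j * h j t) =
    fun t => c i * h i t + \sum_(j <- r) c j * h j t.
  by apply/funext => t; rewrite big_cons.
have ci := in_L2Z (c i) (h2 i).
by rewrite big_cons; split; [exact: in_L2D|rewrite clsD// clsZ// ih2].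
Qed.

End SymbolEstimates.

Lemma lax_rearrange (V : zmodType) (a b c p r : V) :
  a + p - (b + c) = a - (c - r + b) + (p - r).
Proof.
move: (subrK r c) (subrK r p); move: (c - r) (p - r) => w z <- <-.
rewrite !addrA [in LHS]opprD addrACA subrr addr0.
by rewrite [LHS]addrAC (addrC b).
Qed.

Section Isospectral.
Context {R : realType}.
Local Notation "r %:C" := (real_complex R r).
Local Notation M := mulL2.
Local Notation P := (@proj R).
Variables (g g1 : R -> Tfun R) (J : R -> R[i]).
Variables (I : R -> Prop) (B L : R).
Hypothesis B0 : 0 <= B.
Hypothesis L0 : 0 <= L.
Hypothesis bg : forall t, bddT (g t).
Hypothesis hg : forall t, hardy (cls (g t)).
Hypothesis bg1 : forall t, bddT (g1 t).
Hypothesis hg1 : forall t, hardy (cls (g1 t)).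
Hypothesis g_le : forall t, I t -> forall x, normc (g t x) <= B.
Hypothesis g_lip : forall t t', I t -> I t' ->
  forall x, normc (g t' x - g t x) <= L * `|t' - t|.
Hypothesis g_taylor : forall t t', I t -> I t' -> forall x,
  normc (g t' x - g t x - (t' - t)%:C * g1 t x) <= L * (t' - t) ^+ 2.
Hypothesis JE : forall t, J t = ip (cls (fun x => g t x * g t x)) (cls (g t)).
Hypothesis szego : forall t, I t -> Complex 0 1 *: cls (g1 t) =
  (2 * J t) *: P (cls (fun x => g t x * conjc (g t x))) +
    conjc (J t) *: cls (fun x => g t x * g t x).

Definition lax_symbol t : Tfun R := fun x =>
  J t * conjc (g t x) + conjc (J t) * g t x.

(** It is -i times the Toeplitz operator of a real symbol, hence skew-adjoint. *)
Definition lax_generator t (x : L2 R) : L2 R :=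
  Complex 0 (-1) *: P (M (lax_symbol t) (P x)).

Let N1 : R := nrm (cls (fun=> 1 : R[i])).
Let BJ := 2 * (B * B * N1 * (B * N1)).
Let LJ := 2 * (2 * B * L * N1 * (B * N1)) + 2 * (B * B * N1 * (L * N1)).

Lemma bddT_lax_symbol t : bddT (lax_symbol t).
Proof. by apply: bddTD; apply: bddTZ => //; exact: bddTJ. Qed.

Lemma N1_ge0 : 0 <= N1. Proof. exact: nrm_ge0. Qed.

Lemma BJ_ge0 : 0 <= BJ.
Proof. by rewrite /BJ !mulr_ge0// N1_ge0. Qed.

Lemma LJ_ge0 : 0 <= LJ.
Proof. by rewrite /LJ addr_ge0// !mulr_ge0// N1_ge0. Qed.

Lemma J_le t : I t -> normc (J t) <= BJ.
Proof.
move=> It; rewrite JE (le_trans (normc_ip_le _ _))// ler_pM2l//.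
apply: ler_pM; rewrite ?nrm_ge0//; apply: nrm_cls_le => //.
- exact: bddTM.
- by move=> x; rewrite normcM ler_pM ?normc_ge0 ?g_le.
- exact: g_le.
Qed.

Lemma J_lip t t' : I t -> I t' -> normc (J t - J t') <= LJ * `|t - t'|.
Proof.
move=> It It'; rewrite !JE.
have g2 r : in_L2 (g r) by exact: bddT_L2.
have gg2 r : in_L2 (fun x => g r x * g r x) by exact/bddT_L2/bddTM.
set a := cls (fun x => g t x * g t x); set b := cls (g t).
set a' := cls (fun x => g t' x * g t' x); set b' := cls (g t').
have -> : ip a b - ip a' b' = ip (a - a') b + ip a' (b - b').
  by rewrite ipBl ipBr; ring.
rewrite (le_trans (le_normcD _ _))// /LJ mulrDl lerD//.
- rewrite (le_trans (normc_ip_le _ _))// -mulrA ler_pM2l//.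
  have -> : 2 * B * L * N1 * (B * N1) * `|t - t'| =
    2 * B * L * `|t - t'| * N1 * (B * N1) by ring.
  apply: ler_pM; rewrite ?nrm_ge0//.
  + rewrite -clsB//; apply: nrm_cls_le; first by apply: bddTB; exact: bddTM.
    move=> x; have -> : g t x * g t x - g t' x * g t' x =
      (g t x + g t' x) * (g t x - g t' x) by ring.
    rewrite normcM -mulrA; apply: ler_pM; rewrite ?normc_ge0//; last exact: g_lip.
    by rewrite (le_trans (le_normcD _ _))// mulr_natl mulr2n lerD ?g_le.
  + by apply: nrm_cls_le => // x; exact: g_le.
- rewrite (le_trans (normc_ip_le _ _))// -mulrA ler_pM2l//.
  have -> : B * B * N1 * (L * N1) * `|t - t'| =
    B * B * N1 * (L * `|t - t'| * N1) by ring.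
  apply: ler_pM; rewrite ?nrm_ge0//.
  + apply: nrm_cls_le; first exact: bddTM.
    by move=> x; rewrite normcM ler_pM ?normc_ge0 ?g_le.
  + rewrite -clsB//; apply: nrm_cls_le; first exact: bddTB.
    by move=> x; exact: g_lip.
Qed.

Let m := 2 * (BJ * B).
Let La := 2 * (LJ * B + BJ * L).

Lemma lax_symbol_le t x : I t -> normc (lax_symbol t x) <= m.
Proof.
move=> It; rewrite (le_trans (le_normcD _ _))// !normcM !normc_conj /m.
rewrite mulr_natl mulr2n.
by apply: lerD; apply: ler_pM; rewrite ?normc_ge0 ?J_le ?g_le.
Qed.

Lemma lax_symbol_lip t t' x : I t -> I t' ->
  normc (lax_symbol t x - lax_symbol t' x) <= La * `|t - t'|.
Proof.
move=> It It'; pose K := (LJ * B + BJ * L) * `|t - t'|.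
have key (j j' z z' : R[i]) : normc (j - j') <= LJ * `|t - t'| -> normc j' <= BJ ->
    normc (z - z') <= L * `|t - t'| -> normc z <= B -> normc (j * z - j' * z') <= K.
  move=> h1 h2 h3 h4.
  have -> : j * z - j' * z' = (j - j') * z + j' * (z - z') by ring.
  rewrite (le_trans (le_normcD _ _))// !normcM /K mulrDl lerD//.
    have -> : LJ * B * `|t - t'| = LJ * `|t - t'| * B by ring.
    by apply: ler_pM; rewrite ?normc_ge0.
  by rewrite -mulrA; apply: ler_pM; rewrite ?normc_ge0.
have cB (z w : R[i]) : conjc z - conjc w = conjc (z - w).
  by rewrite conjcD conjcN.
have -> : lax_symbol t x - lax_symbol t' x =
  (J t * conjc (g t x) - J t' * conjc (g t' x)) +
  (conjc (J t) * g t x - conjc (J t') * g t' x) by rewrite /lax_symbol; ring.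
have -> : La * `|t - t'| = K + K by rewrite /La /K; ring.
rewrite (le_trans (le_normcD _ _))// lerD//; apply: key;
  rewrite ?cB ?normc_conj; [exact: J_lip|exact: J_le|exact: g_lip|exact: g_le|
    exact: J_lip|exact: J_le|exact: g_lip|exact: g_le].
Qed.

Lemma normc_Ni : normc (Complex 0 (-1) : R[i]) = 1.
Proof. by rewrite normcE /= expr0n /= add0r sqrrN expr1n sqrtr1. Qed.

Lemma lax_generator_linear t (c : R[i]) x y :
  lax_generator t (c *: x + y) = c *: lax_generator t x + lax_generator t y.
Proof.
rewrite /lax_generator projDZ mulL2_linear; last exact: bddT_lax_symbol.
by rewrite projDZ scalerDr !scalerA mulrC.
Qed.

Lemma lax_generator_le t x : I t -> nrm (lax_generator t x) <= m * nrm x.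
Proof.
move=> It; rewrite /lax_generator nrmZ normc_Ni mul1r (le_trans (nrm_proj _))//.
have h := nrm_mul_le (P x) (bddT_lax_symbol t) (fun y => lax_symbol_le y It).
rewrite (le_trans h)// ler_wpM2l ?nrm_proj//.
by rewrite /m mulr_ge0// mulr_ge0// BJ_ge0.
Qed.

Lemma lax_generator_lip t t' x : I t -> I t' ->
  nrm (lax_generator t x - lax_generator t' x) <= La * `|t - t'| * nrm x.
Proof.
move=> It It'; rewrite /lax_generator -scalerBr -linearB nrmZ normc_Ni mul1r.
rewrite (le_trans (nrm_proj _))//.
have h := nrm_mulL2B_le (P x) (bddT_lax_symbol t) (bddT_lax_symbol t')
  (fun y => lax_symbol_lip y It It').
rewrite (le_trans h)// ler_wpM2l ?nrm_proj// mulr_ge0//.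
by rewrite /La mulr_ge0// addr_ge0// mulr_ge0// ?LJ_ge0// BJ_ge0.
Qed.

Lemma lax_generator_skew t x : I t -> complex.Re (ip (lax_generator t x) x) = 0.
Proof.
move=> It; rewrite /lax_generator ipZl ReM [complex.Re (Complex _ _)]/=.
rewrite [complex.Im (Complex _ _)]/= toeplitz_real ?mulr0 ?mul0r ?subrr//.
- exact: bddT_lax_symbol.
- by move=> y; rewrite /lax_symbol conjcD !conjcM !conjcK addrC.
Qed.

Lemma proj_lax_generator t x : P (lax_generator t x) = lax_generator t x.
Proof. by rewrite /lax_generator linearZ/= proj_idem. Qed.

Lemma lax_generator_proj t x : lax_generator t (P x) = lax_generator t x.
Proof. by rewrite /lax_generator proj_idem. Qed.

(** The Lax equation K' = C K - K C. *)
Lemma hankel_lax t x : I t -> hankel (g1 t) x =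
  lax_generator t (hankel (g t) x) - hankel (g t) (lax_generator t x).
Proof.
move=> It; have := lax_pair (bg t) (hg t) x (bg1 t) (hg1 t) (szego It).
rewrite /= -/(lax_symbol t) => e.
have -> : hankel (g1 t) x = Complex 0 (-1) *: (Complex 0 1 *: hankel (g1 t) x).
  rewrite scalerA (_ : _ * _ = 1) ?scale1r//.
  by apply: complexP; rewrite ?ReM ?ImM /=; ring.
rewrite e scalerDr; congr (_ + _).
rewrite /lax_generator hankelZ// -scaleNr; congr (_ *: _).
by apply: complexP; rewrite /= ?opprK ?oppr0.
Qed.

Local Notation estep := (step lax_generator).

(** Three errors: the Taylor remainder of the curve, the variation of the Hankel
    operator along one step, and the Lax equation, which cancels the first-order
    terms. *)
Lemma hankel_step t d x : I t -> I (t + d) ->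
  nrm (hankel (g (t + d)) (estep d t x) - estep d t (hankel (g t) x))
    <= (L + L * m) * d ^+ 2 * nrm x.
Proof.
move=> It It'; set C := lax_generator t.
have td : t + d - t = d by rewrite addrC addKr.
have -> : hankel (g (t + d)) (estep d t x) - estep d t (hankel (g t) x) =
    (hankel (g (t + d)) x - hankel (fun y => d%:C * g1 t y + g t y) x) +
    d%:C *: (hankel (g (t + d)) (C x) - hankel (g t) (C x)).
  rewrite /step hankelD// hankelZ// conjc_real hankel_symbol// hankel_lax//.
  by rewrite !scalerBr; exact: lax_rearrange.
have m0 : 0 <= m by rewrite /m mulr_ge0// mulr_ge0// BJ_ge0.
have bd1 : bddT (fun y => d%:C * g1 t y + g t y).
  by apply: bddTD => //; exact: bddTZ.
have h1 : nrm (hankel (g (t + d)) x - hankel (fun y => d%:C * g1 t y + g t y) x)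
    <= L * d ^+ 2 * nrm x.
  apply: nrm_hankelB_le => // y; have := g_taylor It It' y; rewrite td.
  by rewrite opprD addrA addrAC.
have h2 : nrm (hankel (g (t + d)) (C x) - hankel (g t) (C x))
    <= L * `|d| * nrm (C x).
  by apply: nrm_hankelB_le => // y; have := g_lip It It' y; rewrite td.
rewrite (le_trans (nrmD _ _))// !mulrDl lerD// nrmZr.
rewrite (le_trans (ler_wpM2l (normr_ge0 d) h2))//.
have -> : `|d| * (L * `|d| * nrm (C x)) = L * d ^+ 2 * nrm (C x).
  by rewrite -(real_normK (num_real d)); ring.
have -> : L * m * d ^+ 2 * nrm x = L * d ^+ 2 * (m * nrm x) by ring.
apply: ler_wpM2l; last exact: lax_generator_le.
by rewrite mulr_ge0 ?sqr_ge0.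
Qed.

Variables t1 t2 : R.
Hypothesis segment : forall n i, (i <= 2 ^ n)%N ->
  I (t1 + i%:R * ((t2 - t1) / 2 ^+ n)).

(** The evolution operator conjugates the two Hankel operators, preserves the
    Hardy space, and is linear and injective. *)
Theorem hankel_conjugation : exists U : L2 R -> L2 R,
  [/\ forall x y, U (x + y) = U x + U y,
      forall (c : R[i]) x, U (c *: x) = c *: U x,
      forall x, U x = 0 -> x = 0,
      forall x, hardy x -> hardy (U x)
    & forall x, hankel (g t2) (U x) = U (hankel (g t1) x)].
Proof.
have m0 : 0 <= m by rewrite /m mulr_ge0// mulr_ge0// BJ_ge0.
have La0 : 0 <= La.
  by rewrite /La mulr_ge0// addr_ge0// mulr_ge0// ?LJ_ge0// BJ_ge0.
have [U [UD Uge UG]] := evolution m0 La0 lax_generator_linear lax_generator_le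
  lax_generator_lip lax_generator_skew segment.
have I2 : I t2.
  have := @segment 0 1 isT; rewrite expr0 divr1 mul1r => h.
  by have -> : t2 = t1 + (t2 - t1) by rewrite addrC subrK.
have exact_step (G : L2 R -> L2 R) t d x : G (estep d t x) = estep d t (G x) ->
    nrm (G (estep d t x) - estep d t (G x)) <= 0 * d ^+ 2 * nrm x.
  by move=> ->; rewrite subrr nrm0 !mul0r.
exists U; split=> //.
- move=> c x; apply/esym.
  apply: (UG (fun=> *:%R c) 0 (normc c)) => //; first exact: normc_ge0.
  + by move=> _ y z; rewrite scalerBr.
  + by move=> y; rewrite nrmZ.
  + move=> t d y _ _; apply: exact_step.
    rewrite /step (gen_scale lax_generator_linear) scalerDr !scalerA.
    by congr (_ + _ *: _); rewrite (mulrC c).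
- move=> x Ux0; apply: nrm0_eq0; apply/eqP; rewrite eq_le nrm_ge0 andbT.
  by have := Uge x; rewrite Ux0 nrm0.
- move=> x hx; rewrite -(proj_hardy hx) -(UG (fun=> P) 0 1)//.
  + by move=> _ y z; rewrite linearB.
  + by move=> y; rewrite mul1r nrm_proj.
  + move=> t d y _ _; apply: exact_step.
    by rewrite /step linearD linearZ /= proj_lax_generator lax_generator_proj.
- have Lm0 : 0 <= L + L * m by apply: addr_ge0 => //; exact: mulr_ge0.
  apply: (UG (fun t => hankel (g t)) _ B Lm0 B0) => [t y z|y|t d y It It'].
  + by rewrite hankelB.
  + by apply: nrm_hankel_le => //; exact: g_le.
  + exact: hankel_step.
Qed.

End Isospectral.

(** An injective linear map that intertwines the Hankel operators maps independent
    eigenvectors to independent eigenvectors for the same eigenvalue. *)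
Lemma eigen_mult_le (R : realType) (u1 u2 g1 g2 : Tfun R) (U : L2 R -> L2 R)
    (lambda : R[i]) :
  bddT g1 -> in_L2 u1 -> eqT u1 g1 -> bddT g2 -> in_L2 u2 -> eqT u2 g2 ->
  (forall x y, U (x + y) = U x + U y) ->
  (forall (c : R[i]) x, U (c *: x) = c *: U x) ->
  (forall x, U x = 0 -> x = 0) -> (forall x, hardy x -> hardy (U x)) ->
  (forall x, hankel g2 (U x) = U (hankel g1 x)) ->
  (eigen_mult (Ksq u1) lambda <= eigen_mult (Ksq u2) lambda)%E.
Proof.
move=> bg1 u12 e1 bg2 u22 e2 UD UZ Ui Uh UG.
have U0 : U 0 = 0 by apply: (addrI (U 0)); rewrite -UD !addr0.
apply: ereal_sup_le => _ [n [h [hE hI]] <-]; exists n => //.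
have hP i := (eigenspaceP _ _ bg1 u12 e1).1 (hE i).
have h2 i : in_L2 (h i) by have [[]] := hP i.
exists (fun i => rep (U (cls (h i)))); split.
- move=> i; have [hp ei] := hP i; apply/(eigenspaceP _ _ bg2 u22 e2); split.
    by apply/hardyP; apply: Uh; exact: hardy_cls.
  by rewrite repK !UG ei UZ.
- move=> c hc; apply: hI.
  have [r2 rE] := cls_sum c (fun i => rep_L2 (U (cls (h i)))).
  have [s2 sE] := cls_sum c h2.
  have Usum : U (\sum_(i < n) c i *: cls (h i)) = \sum_(i < n) c i *: U (cls (h i)).
    by elim/big_rec2: _ => // i y x _ <-; rewrite UD UZ.
  have : U (\sum_(i < n) c i *: cls (h i)) = 0.
    rewrite Usum; under eq_bigr do rewrite -[U _]repK.
    by rewrite -rE -(@cls0 R); apply: cls_eq => //; exact: in_L2_0.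
  move=> /Ui; rewrite -sE => s0; apply: eqT_trans (eqT_sym (rep_cls s2)) _.
  by rewrite s0; exact: rep_zero.
Qed.

Section SmoothSolution.
Context {R : realType}.
Variable s : R.
Hypothesis hs : 2^-1 < s.

(** The equation constrains some time derivative of u, which has to be identified
    with the one of the smooth family: their Fourier coefficients agree because the
    Sobolev embedding bounds both distances to one difference quotient. *)
Lemma Hs_derive_unique (u : R -> Tfun R) t (v w : Tfun R) :
  (forall t, in_L2 (u t)) -> Hs_is_derive s u t v -> Hs_is_derive s u t w ->
  cls v = cls w.
Proof.
move=> u2 [[[v2 hv] _] cv] [[[w2 hw] _] cw].
have [S S0 hS] := sobolev hs.
apply: L2_ext => -[k|k]; last by rewrite !coef_cls// hv// hw.
rewrite !coef_cls//; apply/eqP; rewrite -subr_eq0; apply/eqP/normc_eq0/eqP.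
rewrite eq_le normc_ge0 andbT; apply/ler_addgt0Pr => e e0; rewrite add0r.
have e1 : 0 < e / (2 * S) by rewrite divr_gt0// mulr_gt0.
have lt0 : (0 < (e / (2 * S))%:E)%E by rewrite lte_fin.
have /nbhs_ballP [n1 n10 h1] := cv _ (open_ereal_lt' lt0).
have /nbhs_ballP [n2 n20 h2] := cw _ (open_ereal_lt' lt0).
pose h := Num.min n1 n2 / 2.
have mp : 0 < Num.min n1 n2 by rewrite lt_min n10.
have hp : 0 < h by rewrite divr_gt0.
have hlt : h < Num.min n1 n2 by rewrite ltr_pdivrMr// ltr_pMr// ltr1n.
have h0 : h != 0 by rewrite gt_eqF.
move: hlt; rewrite lt_min => /andP[l1h l2h].
have b1 : ball (0 : R) n1 h by rewrite /ball /= sub0r normrN gtr0_norm.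
have b2 : ball (0 : R) n2 h by rewrite /ball /= sub0r normrN gtr0_norm.
pose q := fun x => real_complex R h^-1 * (u (t + h) x - u t x).
have q2 : in_L2 q by apply: in_L2Z; exact: in_L2B.
have key (z : Tfun R) : in_L2 z ->
    (Hs_norm s (fun x => (q x - z x)%R) < (e / (2 * S))%:E)%E ->
    normc (fourier q k - fourier z k) <= e / 2.
  move=> z2 /ltW /(hS _ _ e1) [l n].
  have <- : fourier (fun x => q x - z x) k = fourier q k - fourier z k.
    by rewrite /fourier innerBl.
  have := series_le_norm1 k.+1 l.
  rewrite /series /= big_nat_recr//= => hk.
  have sum0 : 0 <= \sum_(0 <= i < k) normc (fourier (fun x => q x - z x) i).
    by apply: sumr_ge0 => i _; exact: normc_ge0.
  have -> : e / 2 = S * (e / (2 * S)) by field; rewrite gt_eqF.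
  by apply: le_trans n; apply: le_trans hk; rewrite lerDr.
have k1 := key v v2 (h1 h b1 h0); have k2 := key w w2 (h2 h b2 h0).
have -> : fourier v k - fourier w k =
  - (fourier q k - fourier v k) + (fourier q k - fourier w k) by ring.
rewrite (le_trans (le_normcD _ _))// normcN; lra.
Qed.

End SmoothSolution.

Theorem corollary2p4 (R : realType) (s : R) (hs : 2^-1 < s)
    (u : R -> Tfun R) (u_smooth : Hs_smooth s u)
    (u_sol : szego_solution s u) (t1 t2 : R) (lambda : R[i]) :
  eigen_mult (Ksq (u t1)) lambda = eigen_mult (Ksq (u t2)) lambda.
Proof.
have [D [D0 uH DD]] := u_smooth.
have D_Hs n t : in_Hsplus s (D n t).
  by case: n => [|n]; [rewrite D0|have [] := DD n t].
have u2 t : in_L2 (u t) by have [[]] := uH t.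
pose g := curve D.
have bg n t : bddT (g n t) by exact: bddT_curve D_Hs n t.
have hg n t : hardy (cls (g n t)) by exact: hardy_curve D_Hs n t.
have g2 n t : in_L2 (g n t) by exact: bddT_L2.
have gD n t : cls (D n t) = cls (g n t) by exact: cls_curve D_Hs n t.
have ug t : eqT (u t) (g 0%N t).
  apply: eqT_trans (eqT_sym (rep_cls (u2 t))) _.
  by rewrite -[in cls (u t)]D0 gD; exact: rep_cls.
pose J t := Jfun (u t).
have JE t : J t = ip (cls (fun x => g 0%N t x * g 0%N t x)) (cls (g 0%N t)).
  exact: Jfun_ip.
have szego t : Complex 0 1 *: cls (g 1%N t) =
    (2 * J t) *: proj (cls (fun x => g 0%N t x * conjc (g 0%N t x))) +
    conjc (J t) *: cls (fun x => g 0%N t x * g 0%N t x).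
  have [v [dv ev]] := u_sol t.
  have dD : Hs_is_derive s u t (D 1%N t) by have := DD 0%N t; rewrite D0.
  have [[[v2 _] _] _] := dv.
  rewrite -gD -(Hs_derive_unique hs u2 dv dD) -clsZ//.
  have m2 : in_L2 (fun x => g 0%N t x * conjc (g 0%N t x)).
    by apply: bddT_L2; apply: bddTM => //; exact: bddTJ.
  have s2 : in_L2 (fun x => g 0%N t x * g 0%N t x) by exact/bddT_L2/bddTM.
  have em : eqT (fun x => u t x * conjc (u t x))
      (fun x => g 0%N t x * conjc (g 0%N t x)).
    by filter_upwards [(ug t)] => x e Ax; rewrite e.
  have es : eqT (fun x => u t x ^+ 2) (fun x => g 0%N t x * g 0%N t x).
    by filter_upwards [(ug t)] => x e Ax; rewrite e// expr2.
  have um2 : in_L2 (fun x => u t x * conjc (u t x)).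
    by apply: in_L2_ae em m2; apply: cmeasM; [|apply: cmeasJ]; exact: in_L2_meas.
  have us2 : in_L2 (fun x => u t x ^+ 2).
    apply: in_L2_ae es s2; under eq_fun do rewrite expr2.
    by apply: cmeasM; exact: in_L2_meas.
  have [[p2 _] pE] := Pi_proj um2.
  rewrite -(cls_eq um2 m2 em) -(cls_eq us2 s2 es) -pE -!clsZ//.
  rewrite -clsD; [|exact: in_L2Z|exact: in_L2Z].
  by apply: cls_eq ev; [exact: in_L2Z|apply: in_L2D; exact: in_L2Z].
have cmp a b : (eigen_mult (Ksq (u a)) lambda <= eigen_mult (Ksq (u b)) lambda)%E.
  pose lo := Num.min a b; pose hi := Num.max a b.
  pose I t := lo <= t <= hi.
  have [M0 M00 hM0] := curve_bounded hs D_Hs DD 0 lo hi.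
  have [M1 M10 hM1] := curve_bounded hs D_Hs DD 1 lo hi.
  have [M2 M20 hM2] := curve_bounded hs D_Hs DD 2 lo hi.
  pose M := M0 + M1 + M2.
  have M_ge0 : 0 <= M by rewrite !addr_ge0.
  have hM n t : (n <= 2)%N -> lo <= t <= hi -> forall x, normc (g n t x) <= M.
    move=> n2 It x; rewrite /M; case: n n2 => [|[|[|//]]] _.
    - by have := hM0 t It x; rewrite -/g; lra.
    - by have := hM1 t It x; rewrite -/g; lra.
    - by have := hM2 t It x; rewrite -/g; lra.
  have L0 : 0 <= 4 * M by rewrite mulr_ge0.
  have lip t t' : I t -> I t' -> forall x,
      normc (g 0%N t' x - g 0%N t x) <= 4 * M * `|t' - t|.
    move=> It It' x.
    apply: le_trans (curve_lip hs D_Hs DD hM x (isT : (0 <= 1)%N) It It') _.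
    by rewrite ler_wpM2r// ler_wpM2r// ler_nat.
  have taylor t t' : I t -> I t' -> forall x,
      normc (g 0%N t' x - g 0%N t x - real_complex R (t' - t) * g 1%N t x)
        <= 4 * M * (t' - t) ^+ 2.
    by move=> It It' x; exact: (curve_taylor hs D_Hs DD M_ge0 hM x It It').
  have seg n i : (i <= 2 ^ n)%N -> I (a + i%:R * ((b - a) / 2 ^+ n)).
    move=> hi2; set r := i%:R / 2 ^+ n : R.
    have -> : i%:R * ((b - a) / 2 ^+ n) = r * (b - a) by rewrite /r; ring.
    have r0 : 0 <= r by rewrite divr_ge0// ltW.
    have r1 : r <= 1 by rewrite ler_pdivrMr// mul1r -natrX ler_nat.
    rewrite /I /lo /hi; case: (leP a b) => ab; apply/andP; split; nra.
  have [U [UD UZ Ui Uh UG]] := hankel_conjugation M_ge0 L0 (bg 0%N) (hg 0%N)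
    (bg 1%N) (hg 1%N) (fun t It x => hM 0%N t isT It x) lip taylor JE
    (fun t _ => szego t) seg.
  exact: (eigen_mult_le _ (bg 0%N a) (u2 a) (ug a) (bg 0%N b) (u2 b) (ug b)
    UD UZ Ui Uh UG).
by apply: le_anti; apply/andP; split; exact: cmp.
Qed.
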